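(* Let $G$, $\mathbf N$ be as in the context and assume $Z^D(G)\neq0$. Suppose the nodes are contiguously colored red, green and blue (a color may occur zero times) and that $\sigma$ is the (unique) planar pairing of $\mathbf N$ in which like RGB colors are not paired together. Let $b_1<\dots<b_n$ be the black nodes and $w_1<\dots<w_n$ the white nodes. Then $$\frac{Z^{DD}_\sigma(G,\mathbf N)}{(Z^D(G))^2}=\mathrm{sign}_{OE}(\sigma)\,\det\Big[\mathbf 1_{\{i,j\text{ RGB-colored differently}\}}\,Y_{i,j}\Big]^{i=b_1,\dots,b_n}_{j=w_1,\dots,w_n}.$$
   Context: $G=(V_1,V_2,E)$ is a finite edge-weighted planar bipartite graph embedded in the plane; vertices of $V_1$ are black, of $V_2$ white. A set $\mathbf N$ of $2n$ vertices on the outer face (nodes) is labeled $1,\dots,2n$ counterclockwise, with $n$ black and $n$ white nodes but otherwise arbitrary coloring (in particular nodes need not alternate in color or parity). $Z^D(H)$ is the weighted sum of perfect matchings of a graph $H$ (weight = product of edge weights); $G_{i,j}$ is $G$ with vertices $i,j$ deleted; $Y_{i,j}=Z^D(G_{i,j})/Z^D(G)$. A double-dimer configuration on $(G,\mathbf N)$ is a multiset of edges in which each node is an endpoint of exactly one edge and each other vertex of exactly two; its weight is the product of edge weights times $2^{\#\text{loops}}$ (loops = cycles of length $>2$). $Z^{DD}_\sigma(G,\mathbf N)$ is the total weight of configurations whose paths join the nodes according to the pairing $\sigma$. Planar pairing: no two pairs $\{a,c\},\{b,d\}$ with $a<b<c<d$. For an odd-even pairing $\pi$ (each pair has one odd and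 one even label; planar pairings are odd-even), $\mathrm{sign}_{OE}(\pi)$ is the sign of the permutation $(\pi(1)/2,\pi(3)/2,\dots,\pi(2n-1)/2)$ in one-line notation. RGB coloring: nodes partitioned into three circularly contiguous sets colored red, green, blue, independent of black/white. *)

(* Defs.v *)
From HB Require Import structures.
From mathcomp Require Import all_boot all_order all_algebra all_fingroup.
Set Implicit Arguments. Unset Strict Implicit. Unset Printing Implicit Defensive.
Import Order.TTheory GRing.Theory Num.Theory.
Local Open Scope ring_scope.

(* Graph data.  V : finite vertex type, [black] : colouring (true = black), *)
(* E : edges, each edge stored as the ordered pair (black end, white end);  *)
(* wt : edge weights.  Nodes are node k, k : 'I_(2n); label of node k is   *)
(* k+1 (so "odd label" <-> k even).                                         *)

Lemma n_le_double n : (n <= n.*2)%N.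
Proof. by rewrite -addnn leq_addr. Qed.

Definition bipartite_edges (V : finType) (black : pred V) (E : {set V * V}) :=
  forall e, e \in E -> black e.1 /\ ~~ black e.2.

Definition nclasses (D : finType) (r : rel D) : nat :=
  #|[set [set y | connect r x y] | x : D]|.

(* A rotation system (combinatorial map) for G + an extra vertex "star"  *)
(* (= None) joined to every node, whose rotation visits the nodes in the  *)
(* cyclic order 1,2,...,2n.  Darts: D; tail d : option V; alpha: edge      *)
(* reversal; sigma: rotation around vertices.                             *)
Definition is_star_rotation_system (V : finType) (E : {set V * V}) (n : nat)
    (node : 'I_(n.*2) -> V) (D : finType) (tail : D -> option V)
    (alpha sigma : {perm D}) : Prop :=
  (forall d, alpha d != d /\ alpha (alpha d) = d) /\
      (forall d, tail (sigma d) = tail d) /\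
      (forall d d', tail d = tail d' -> fconnect sigma d d') /\
      (forall d,
         (exists2 e, e \in E &
            ((tail d, tail (alpha d)) = (Some e.1, Some e.2) \/
             (tail d, tail (alpha d)) = (Some e.2, Some e.1))) \/
         (exists k, (tail d, tail (alpha d)) = (None, Some (node k)) \/
                    (tail d, tail (alpha d)) = (Some (node k), None))) /\
      (forall e, e \in E -> exists! d, (tail d, tail (alpha d)) = (Some e.1, Some e.2)) /\
      (forall k, exists! d, (tail d, tail (alpha d)) = (None, Some (node k))) /\
      (forall d k, (tail d, tail (alpha d)) = (None, Some (node k)) ->
                   tail (alpha (sigma d)) = Some (node (ordS k))).

(* Genus zero (Euler's formula V - E + F = 2C, summed over components). *)
Definition genus0 (D : finType) (alpha sigma : {perm D}) : Prop :=
  (2 * (nclasses (frel (fun d => sigma d)) +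
        nclasses (frel (fun d => sigma (alpha d)))) =
   #|D| + 4 * nclasses (fun x y => (y == alpha x) || (y == sigma x)))%N.

Definition planar_nodes_on_outer_face (V : finType) (E : {set V * V}) (n : nat)
    (node : 'I_(n.*2) -> V) : Prop :=
  exists (D : finType) (tail : D -> option V) (alpha sigma : {perm D}),
    is_star_rotation_system E node tail alpha sigma /\ genus0 alpha sigma.

Definition perfect_matching (V : finType) (E : {set V * V}) (S : {set V})
    (M : {set V * V}) : bool :=
  [&& M \subset E,
      [forall e in M, (e.1 \in S) && (e.2 \in S)] &
      [forall v in S, #|[set e in M | (e.1 == v) || (e.2 == v)]| == 1%N]].

Definition ZD (R : numFieldType) (V : finType) (E : {set V * V})
    (wt : V * V -> R) (S : {set V}) : R :=
  \sum_(M : {set V * V} | perfect_matching E S M) \prod_(e in M) wt e.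

Definition Y (R : numFieldType) (V : finType) (E : {set V * V})
    (wt : V * V -> R) (i j : V) : R :=
  ZD E wt (setT :\ i :\ j) / ZD E wt setT.

Definition is_node (V : finType) (n : nat) (node : 'I_(n.*2) -> V) (v : V) : bool :=
  [exists k, node k == v].

Definition ddeg (V : finType) (E : {set V * V}) (m : {ffun V * V -> 'I_3}) (v : V) : nat :=
  (\sum_(e in E | (e.1 == v) || (e.2 == v)) (m e : nat))%N.

Definition is_dd_config (V : finType) (E : {set V * V}) (n : nat)
    (node : 'I_(n.*2) -> V) (m : {ffun V * V -> 'I_3}) : bool :=
  [&& [forall e, (e \notin E) ==> ((m e : nat) == 0%N)] &
      [forall v, ddeg E m v == (if is_node node v then 1 else 2)%N]].

Definition dd_rel (V : finType) (m : {ffun V * V -> 'I_3}) : rel V :=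
  fun x y => (0 < (m (x, y) : nat))%N || (0 < (m (y, x) : nat))%N.

(* loops = components without nodes of length > 2 (not doubled edges) *)
Definition nloops (V : finType) (n : nat) (node : 'I_(n.*2) -> V)
    (m : {ffun V * V -> 'I_3}) : nat :=
  #|[set C in [set [set y | connect (dd_rel m) x y] | x : V] |
       [forall v in C, ~~ is_node node v] && (2 < #|C|)%N]|.

Definition dd_weight (R : numFieldType) (V : finType) (E : {set V * V})
    (wt : V * V -> R) (n : nat) (node : 'I_(n.*2) -> V)
    (m : {ffun V * V -> 'I_3}) : R :=
  (\prod_(e in E) wt e ^+ m e) * 2 ^+ nloops node m.

Definition connects_as (V : finType) (n : nat) (node : 'I_(n.*2) -> V)
    (m : {ffun V * V -> 'I_3}) (s : {perm 'I_(n.*2)}) : bool :=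
  [forall k, forall l, (k != l) ==>
     (connect (dd_rel m) (node k) (node l) == (s k == l))].

Definition ZDD (R : numFieldType) (V : finType) (E : {set V * V})
    (wt : V * V -> R) (n : nat) (node : 'I_(n.*2) -> V) (s : {perm 'I_(n.*2)}) : R :=
  \sum_(m : {ffun V * V -> 'I_3} | is_dd_config E node m && connects_as node m s)
     dd_weight E wt node m.

Definition is_pairing (n : nat) (s : {perm 'I_(n.*2)}) : Prop :=
  forall k, s k != k /\ s (s k) = k.

Definition planar_pairing (n : nat) (s : {perm 'I_(n.*2)}) : Prop :=
  is_pairing s /\
  forall a b c d : 'I_(n.*2), (a < b)%N -> (b < c)%N -> (c < d)%N ->
     ~ (s a = c /\ s b = d).

(* sign_OE: sign of k |-> sigma(2k-1)/2 (labels 1..2n); in 0-based indices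
   k' |-> (s (2k'))./2.  The sum has exactly one term when this map is a
   permutation (always the case for odd-even pairings). *)
Definition oe_map (n : nat) (s : {perm 'I_(n.*2)}) (k : 'I_n) : 'I_n :=
  insubd k ((val (s (insubd (widen_ord (n_le_double n) k) (k.*2)%N))) ./2)%N.

Definition signOE (R : numFieldType) (n : nat) (s : {perm 'I_(n.*2)}) : R :=
  \sum_(p : 'S_n | [forall k, p k == oe_map s k]) (-1) ^+ p.

Definition circ_contiguous (n : nat) (rgb : 'I_(n.*2) -> 'I_3) : Prop :=
  forall c : 'I_3, exists s l : nat,
    forall k : 'I_(n.*2), (rgb k == c) = [exists t : 'I_l, ((s + t) %% n.*2)%N == k].


Definition black_label (V : finType) (black : pred V) (n : nat)
    (node : 'I_(n.*2) -> V) (i : 'I_n) : 'I_(n.*2) :=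
  nth (widen_ord (n_le_double n) i) [seq k <- enum 'I_(n.*2) | black (node k)] i.
Definition white_label (V : finType) (black : pred V) (n : nat)
    (node : 'I_(n.*2) -> V) (i : 'I_n) : 'I_(n.*2) :=
  nth (widen_ord (n_le_double n) i) [seq k <- enum 'I_(n.*2) | ~~ black (node k)] i.

Definition KW_matrix (R : numFieldType) (V : finType) (black : pred V)
    (E : {set V * V}) (wt : V * V -> R) (n : nat) (node : 'I_(n.*2) -> V)
    (rgb : 'I_(n.*2) -> 'I_3) : 'M[R]_n :=
  \matrix_(i < n, j < n)
    (let b := black_label black node i in
     let w := white_label black node j in
     if rgb b != rgb w then Y E wt (node b) (node w) else 0).

(* Main.v *)
Require Import Defs.
From HB Require Import structures.
From mathcomp Require Import all_boot all_order all_algebra all_fingroup.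
From mathcomp Require Import zify ring.
Import Order.TTheory GRing.Theory Num.Theory.
Local Open Scope ring_scope.

Set Implicit Arguments. Unset Strict Implicit. Unset Printing Implicit Defensive.

(** Write Z(G\S) for the dimer partition function of G with the nodes of S deleted. Superposing
    matchings of G\S and G\S' with S, S' disjoint gives the configurations in which every path is
    compatible with S, a loop being split in two ways. Planarity is used only to see that the paths
    joining the nodes do not cross: over F_2, Euler's formula says that the faces span the cycle
    space, so a cycle through the star vertex separates the nodes on its two sides. Non-crossing
    pairings join nodes of opposite position parity, whence a condensation formula expanding
    Z(G\T) Z(G) along a black node of T. Iterated on S and its complement, it turns
    Z(G\S) Z(G\S^c) / Z(G)^2 into a signed determinant of the Y_{b,w} restricted to the pairs
    with both or neither of b, w in S.

    Encode S by a sign vector x that must take opposite values at the two ends of each path. Take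
    the alternating sum over the x that are + on the first RGB colour, - on the second and free on
    the third. On the double-dimer side, switching x on a monochromatic pair cancels every pairing
    but sigma. On the determinant side, the same cancellation removes the monochromatic entries.
    The remaining sign is found by applying the determinant formula to the indicator function of
    the sigma-stable sets of labels. *)

(** * Cycles in genus zero *)

(** A label belongs to S when x takes there the value of the predicate black; this twist makes
    compatibility independent of the colouring. The weight of x in the alternating sum is (-1)^(sum
    of k x_k), chosen for two reasons. Paired labels have opposite parity, so exchanging the two
    values of x on a pair reverses the sign. Moreover, added to the inversion number that
    accompanies S in the signed determinant, the exponent leaves modulo 2 only a constant and the
    number of black labels where x is true. Thus, for a fixed permutation of the Leibniz expansion,
    the sum over x factors over the pairs formed by a black label and its white image, and each
    factor either vanishes or has a forced x. The forced sign also depends on the order of the two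
    labels; it is constant except for labels of the first colour, whose interval may wrap around
    from the last label to the first. If p1 of them lie at the beginning, a factor (-1)^p1 results,
    and the same factor reappears when sign_OE(sigma) is expressed by the one vector x that survives
    for sigma. *)

Lemma addF2 (a : 'F_2) : a + a = 0.
Proof. by case: a => [[|[|m]] i] //; apply: val_inj. Qed.

Lemma addF2_eq0 (a b : 'F_2) : (a + b == 0) = (a == b).
Proof. by case: a => [[|[|m]] i]; case: b => [[|[|p]] j]. Qed.

Lemma sum_pair (R : nmodType) (T : finType) (F : T -> R) (x y : T) : x != y ->
  \sum_(i | (i == x) || (i == y)) F i = F x + F y.
Proof.
move=> xy; rewrite (bigD1 x) ?eqxx //=; congr (_ + _).
rewrite (bigD1 y) ?eqxx ?orbT ?(eq_sym y) ?xy //= big1 ?addr0 // => i.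
by case/andP=> /andP[/orP[] -> //]; rewrite andbF.
Qed.

(** * Functions constant on the classes of a relation, as row spaces over F_2 *)

Section InvariantFunctions.
Variables (D : finType).
Implicit Types (r : rel D) (v : 'rV['F_2]_#|D|).

Definition row_fun v : D -> 'F_2 := fun d => v 0 (enum_rank d).

Definition rel_classes r : {set {set D}} := [set [set y | connect r x y] | x : D].

(** The row space is the space of functions constant on the classes, so the rank turns the numbers
    [nclasses] of Euler's formula into dimensions. *)
Definition class_mx r : 'M['F_2]_(#|rel_classes r|, #|D|) :=
  \matrix_(i, j) ((enum_val j : D) \in (enum_val i : {set D}))%:R.

Lemma sum_row_fun v (g : D -> 'F_2) :
  \sum_j v 0 j * g (enum_val j) = \sum_d row_fun v d * g d.
Proof.
rewrite [RHS](reindex (@enum_val D D)) /=.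
  by apply: eq_bigr => j _; rewrite /row_fun enum_valK.
exact: onW_bij (enum_val_bij D).
Qed.

Section Classes.
Variables (r : rel D) (rC : connect_sym r).

Lemma rel_class_eq C x : C \in rel_classes r -> x \in C ->
  C = [set y | connect r x y].
Proof.
case/imsetP=> z _ ->; rewrite inE => zx; apply/setP=> y.
by rewrite !inE (same_connect rC zx).
Qed.

Lemma sub_class_mxP v :
  reflect (forall x y, r x y -> row_fun v x = row_fun v y) (v <= class_mx r)%MS.
Proof.
apply: (iffP idP) => [/submxP[w ->] x y rxy | inv].
  rewrite /row_fun !mxE; apply: eq_bigr => i _; congr (_ * _).
  rewrite !mxE !enum_rankK; have := enum_valP i => /imsetP[z _ ->]; rewrite !inE.
  by rewrite (same_connect_r rC (connect1 rxy)).
have invc x y : connect r x y -> row_fun v x = row_fun v y.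
  by case/connectP=> p; elim: p x => [|z p IH] x /= => [_ -> //|/andP[/inv-> /IH] IHp /IHp].
(* The coefficient of a class is the common value of [v] on it; classes are nonempty, so the default
   0 is never taken. *)
pose g (C : {set D}) := if [pick x in C] is Some x then row_fun v x else 0.
apply/submxP; exists (\row_i g (enum_val i)); apply/rowP=> j; rewrite mxE.
have xC : [set y | connect r (enum_val j) y] \in rel_classes r by apply: imset_f.
rewrite (bigD1 (enum_rank_in xC [set y | connect r (enum_val j) y])) //= big1.
  rewrite !mxE enum_rankK_in // inE connect0 mulr1 addr0 /g.
  case: pickP => [x|/(_ (enum_val j))]; rewrite inE ?connect0 //.
  by move/invc; rewrite /row_fun enum_valK.
move=> i neqi; rewrite !mxE; case: (boolP (_ \in _)) => [ji|]; last by rewrite mulr0.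
case/eqP: neqi; apply: enum_val_inj; rewrite enum_rankK_in //.
exact: rel_class_eq (enum_valP i) ji.
Qed.

(** Choosing one representative in each class gives a right inverse, so the rows are independent. *)
Lemma rank_class_mx : \rank (class_mx r) = nclasses r.
Proof.
apply/eqP; apply/row_freeP.
exists (\matrix_(j, i) (Some (enum_val j) == [pick x in (enum_val i : {set D})])%:R).
apply/matrixP=> i i'; rewrite !mxE.
have [x xi' x_i'] : exists2 x, [pick x in (enum_val i' : {set D})] = Some x &
    x \in (enum_val i' : {set D}).
  case: pickP => [x xi|]; first by exists x.
  have /imsetP[z _ ->] := enum_valP i'.
  by move/(_ z); rewrite inE connect0.
rewrite (bigD1 (enum_rank x)) //= big1 => [|j neqj].
  rewrite !mxE enum_rankK xi' eqxx addr0 mulr1; congr (_%:R : 'F_2); congr nat_of_bool.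
  apply/idP/eqP=> [xi|-> //]; apply: enum_val_inj.
  by rewrite (rel_class_eq (enum_valP i) xi) (rel_class_eq (enum_valP i') x_i').
rewrite !mxE xi'; case: eqP => [[jx]|]; last by rewrite mulr0.
by case/eqP: neqj; rewrite -jx enum_valK.
Qed.

End Classes.

Lemma fperm_connect_sym (p : {perm D}) : connect_sym (frel (fun d => p d)).
Proof. exact: fconnect_sym (@perm_inj _ p). Qed.

(** On a finite set the inverse of a permutation is one of its iterates, so each step can be walked
    back. *)
Lemma union_connect_sym (p q : {perm D}) :
  connect_sym (fun x y => (y == p x) || (y == q x)).
Proof.
pose r := fun x y => (y == p x) || (y == q x).
suff sub x y : connect r x y -> connect r y x by move=> x y; apply/idP/idP; apply: sub.
have back (z : {perm D}) : (forall a b, frel z a b -> r a b) -> forall a b, frel z a b ->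
  connect r b a.
  move=> zr a b ab; apply: (@connect_sub _ (frel z)) => [c d /zr /connect1 //|].
  by rewrite fperm_connect_sym connect1.
case/connectP=> s; elim: s x => [|z s IH] x /= => [_ ->//|/andP[xz /IH] IHs /IHs yz].
apply: connect_trans yz _; case/orP: xz => /eqP ->.
  by apply: (back p) => [a b /eqP<-|]; rewrite /r ?eqxx //=.
by apply: (back q) => [a b /eqP<-|]; rewrite /r ?eqxx ?orbT //=.
Qed.

End InvariantFunctions.

(** * The cycle space and the face boundaries of a genus-zero map *)

Section CyclesAreBoundaries.
Variables (D : finType) (alpha sigma : {perm D}).
Hypothesis alphaK : forall d, alpha d != d /\ alpha (alpha d) = d.
Hypothesis g0 : genus0 alpha sigma.

Let ra := frel (fun d => alpha d).
Let rs := frel (fun d => sigma d).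
Let rf := frel (fun d => sigma (alpha d)).
Let rc := fun x y => (y == alpha x) || (y == sigma x).

Let raC : connect_sym ra. Proof. exact: fperm_connect_sym. Qed.
Let rsC : connect_sym rs. Proof. exact: fperm_connect_sym. Qed.
Let rfC : connect_sym rf.
Proof. by apply: fconnect_sym => x y /perm_inj/perm_inj. Qed.
Let rcC : connect_sym rc. Proof. exact: union_connect_sym. Qed.

Lemma card_le_involution_classes : (#|D| <= 2 * nclasses ra)%N.
Proof.
have -> : #|D| = #|cover (rel_classes ra)|.
  rewrite -cardsT; congr #|pred_of_set _|; apply/setP=> x; rewrite inE; apply/esym/bigcupP.
  by exists [set y | connect ra x y]; rewrite ?imset_f // inE connect0.
apply: leq_trans (leq_card_cover _) _; rewrite mulnC -sum_nat_const.
apply: leq_sum => C /imsetP[x _ ->].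
apply: leq_trans (_ : #|[set x; alpha x]| <= 2)%N; last by rewrite cards2; case: (_ != _).
apply: subset_leq_card; apply/subsetP=> y; rewrite inE => /connectP[p].
elim: p x => [|z p IH] x /= => [_ ->|/andP[/eqP<- /IH] IHp /IHp]; rewrite !inE ?eqxx //.
by rewrite (proj2 (alphaK x)) orbC.
Qed.

(** The boundary map modulo 2: on a function of the faces, it adds the values on the two sides of
    each edge. *)
Definition edge_sum_mx : 'M['F_2]_#|D| :=
  \matrix_(i, j) ((i == j)%:R + (enum_val i == alpha (enum_val j))%:R).

Lemma row_fun_edge_sum (v : 'rV['F_2]_#|D|) d :
  row_fun (v *m edge_sum_mx) d = row_fun v d + row_fun v (alpha d).
Proof.
rewrite /row_fun mxE; under eq_bigr => i _ do rewrite mxE mulrDr.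
rewrite big_split /=; congr (_ + _).
  rewrite (bigD1 (enum_rank d)) //= big1 ?addr0 ?eqxx ?mulr1 // => i /negPf->.
  by rewrite mulr0.
rewrite (bigD1 (enum_rank (alpha d))) //= big1 ?addr0 ?enum_rankK ?eqxx ?mulr1 // => i ne.
case: eqP => [e|]; last by rewrite mulr0.
by case/eqP: ne; rewrite -e enum_valK.
Qed.

(* Euler's formula makes the space of face boundaries (B) and the space of cycles (Z) equal in
   dimension; phi is the set of faces on one side of the cycle chi. *)
Lemma genus0_cycle_boundary (chi : D -> 'F_2) :
    (forall d, chi (alpha d) = chi d) ->
    (forall d, \sum_(d' | connect rs d d') chi d' = 0) ->
  exists phi : D -> 'F_2, forall d,
    phi (sigma d) = phi d + chi d /\ phi (alpha d) = phi d + chi d.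
Proof.
move=> chia chis.
(* Orthogonality to an edge class says that the two darts carry the same value; orthogonality to a
   vertex class says that the degree is even there. *)
pose Z := kermx (col_mx (class_mx ra) (class_mx rs))^T.
pose B := class_mx rf *m edge_sum_mx.
have rcP v : reflect (forall d, row_fun v (alpha d) = row_fun v d /\
    row_fun v (sigma d) = row_fun v d) (v <= class_mx rc)%MS.
  apply: (iffP (sub_class_mxP rcC v)) => [inv d | inv x y].
    by split; apply/esym/inv; rewrite /rc eqxx ?orbT.
  by case/orP=> /eqP ->; rewrite ?(proj1 (inv x)) ?(proj2 (inv x)).
have raP v : reflect (forall d, row_fun v (alpha d) = row_fun v d) (v <= class_mx ra)%MS.
  apply: (iffP (sub_class_mxP raC v)) => [inv d | inv x _ /eqP<- //].
  by apply/esym/inv; rewrite /ra /=.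
have rsP v : reflect (forall d, row_fun v (sigma d) = row_fun v d) (v <= class_mx rs)%MS.
  apply: (iffP (sub_class_mxP rsC v)) => [inv d | inv x _ /eqP<- //].
  by apply/esym/inv; rewrite /rs /=.
have rfP v : reflect (forall d, row_fun v (sigma d) = row_fun v (alpha d)) (v <= class_mx rf)%MS.
  apply: (iffP (sub_class_mxP rfC v)) => [inv d | inv x _ /eqP<- /=].
    by apply/esym/inv; rewrite /rf /= (proj2 (alphaK d)).
  by rewrite inv (proj2 (alphaK x)).
have kerP v : reflect (forall d, row_fun v (alpha d) = row_fun v d) (v <= kermx edge_sum_mx)%MS.
  apply: (iffP sub_kermxP) => [v0 d|inv].
    have := row_fun_edge_sum v d; rewrite v0 /row_fun mxE => /esym/eqP.
    by rewrite addF2_eq0 => /eqP.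
  apply/rowP=> j; have := row_fun_edge_sum v (enum_val j); rewrite inv addF2.
  by move=> e; rewrite [RHS]mxE -e /row_fun enum_valK.
have cap_as : \rank (class_mx ra :&: class_mx rs)%MS = nclasses rc.
  rewrite -(rank_class_mx rcC); apply/eqmx_rank/rV_eqP=> v; rewrite sub_capmx.
  apply/andP/rcP => [[/raP a /rsP s] d | inv]; first by split.
  by split; [apply/raP=> d; case: (inv d) | apply/rsP=> d; case: (inv d)].
have cap_f : \rank (class_mx rf :&: kermx edge_sum_mx)%MS = nclasses rc.
  rewrite -(rank_class_mx rcC); apply/eqmx_rank/rV_eqP=> v; rewrite sub_capmx.
  apply/andP/rcP => [[/rfP f /kerP a] d | inv]; first by rewrite f a.
  split; [apply/rfP=> d | apply/kerP=> d]; case: (inv d) => // -> ->//.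
(* The face functions with zero boundary are those constant on connected components. *)
have rkB : (\rank B + nclasses rc = nclasses rf)%N.
  by rewrite -cap_f mxrank_mul_ker rank_class_mx.
(* The edge and vertex conditions defining [Z] have one linear dependency per connected
   component. *)
have rkZ : (\rank Z + (nclasses ra + nclasses rs) = #|D| + nclasses rc)%N.
  rewrite mxrank_ker mxrank_tr -addsmxE -cap_as -(rank_class_mx raC) -(rank_class_mx rsC).
  rewrite -mxrank_sum_cap addnA subnK //.
  exact: rank_leq_col.
have ZP (v : 'rV_#|D|) :
    reflect ((forall d, \sum_(d' | connect ra d d') row_fun v d' = 0) /\
             (forall d, \sum_(d' | connect rs d d') row_fun v d' = 0)) (v <= Z)%MS.
  have orthP r : (v *m (class_mx r)^T == 0) =
      [forall d, \sum_(d' | connect r d d') row_fun v d' == 0].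
    have sumE i (d : D) : enum_val i = [set d' | connect r d d'] ->
        (v *m (class_mx r)^T) 0 i = \sum_(d' | connect r d d') row_fun v d'.
      move=> id; rewrite mxE; under eq_bigr => j _ do rewrite !mxE id inE.
      rewrite (sum_row_fun v (fun e => (connect r d e)%:R)) [RHS]big_mkcond.
      by apply: eq_bigr => e _; case: connect; rewrite ?mulr1 ?mulr0.
    apply/eqP/forallP=> [v0 d | inv].
      have dr : [set d' | connect r d d'] \in rel_classes r by apply: imset_f.
      by rewrite -(sumE (enum_rank_in dr [set d' | connect r d d'])) ?v0 ?mxE // enum_rankK_in.
    apply/rowP=> i; have /imsetP[d _ id] := enum_valP i.
    by rewrite (sumE _ _ id) mxE; apply/eqP/inv.
  rewrite /Z sub_kermx tr_col_mx mul_mx_row row_mx_eq0 !orthP.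
  apply: (iffP andP) => [[/forallP a /forallP s]|[a s]].
    by split=> d; apply/eqP.
  by split; apply/forallP=> d; apply/eqP.
have invol_class d F : \sum_(d' | connect ra d d') F d' = F d + F (alpha d) :> 'F_2.
  rewrite -sum_pair; last by rewrite eq_sym; case: (alphaK d).
  apply: eq_bigl => e; apply/idP/orP=> [|[]/eqP->];
    [| exact: connect0 | exact/connect1/eqxx].
  case/connectP=> p; elim: p d => [|z p IH] x /= => [_ ->|/andP[/eqP<- /IH] IHp /IHp].
    by left.
  by rewrite (proj2 (alphaK x)) => -[]; [right|left].
have sBZ : (B <= Z)%MS.
  apply/rV_subP=> w /submxP[w' ->]; rewrite mulmxA; set v := w' *m _.
  have /rfP vf : (v <= class_mx rf)%MS by apply: submxMl.
  apply/ZP; split=> d; under eq_bigr => d' _ do rewrite row_fun_edge_sum.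
    by rewrite invol_class (proj2 (alphaK d)) [X in _ + X]addrC addF2.
  rewrite big_split /=; under [X in _ + X]eq_bigr => d' _ do rewrite -vf.
  have -> : \sum_(d' | connect rs d d') row_fun v (sigma d') = \sum_(d' | connect rs d d')
    row_fun v d'.
    rewrite [RHS](reindex_inj (@perm_inj _ sigma)); apply: eq_bigl => e /=.
    exact/(same_connect_r rsC)/connect1/eqxx.
  exact: addF2.
have [_ eqBZ] := mxrank_leqif_sup sBZ.
have {eqBZ sBZ} sZB : (Z <= B)%MS.
  rewrite -eqBZ eqn_leq mxrankS //=.
  (* Here n counts darts and a, s, f, c count edges, vertices, faces and components. Since n <= 2a,
     twice the rank of [Z] is at most n + 2c - 2s, which by Euler's formula equals 2(f - c), twice
     the rank of [B]. *)
  have arith (a s f c z b n : nat) : (2 * (s + f) = n + 4 * c)%N -> (n <= 2 * a)%N ->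
    (b + c = f)%N -> (z + (a + s) = n + c)%N -> (z <= b)%N by lia.
  exact: arith g0 card_le_involution_classes rkB rkZ.
have chiE d : row_fun (\row_j chi (enum_val j)) d = chi d by rewrite /row_fun mxE enum_rankK.
have : (\row_j chi (enum_val j) <= B)%MS.
  apply: submx_trans sZB; apply/ZP; split=> d; under eq_bigr => d' _ do rewrite chiE.
    by rewrite invol_class chia addF2.
  exact: chis.
case/submxP=> w; rewrite mulmxA; set v := w *m _ => vE.
have /rfP vf : (v <= class_mx rf)%MS by apply: submxMl.
exists (row_fun v) => d; rewrite vf; have := chiE d; rewrite vE row_fun_edge_sum => <-.
by rewrite addrA addF2 add0r.
Qed.
End CyclesAreBoundaries.

(** * Disjoint connected sets joining nodes of a planar graph do not cross *)

Section NonCrossing.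
Variables (V : finType) (E : {set V * V}) (n : nat) (node : 'I_(n.*2) -> V).
Variables (D : finType) (tail : D -> option V) (alpha sigma : {perm D}).
Hypothesis rot : is_star_rotation_system E node tail alpha sigma.
Hypothesis g0 : genus0 alpha sigma.
Hypothesis node_inj : injective node.
Variable (e : rel V).
Hypothesis eE : forall x y, e x y -> (x, y) \in E \/ (y, x) \in E.
Hypothesis eC : connect_sym e.

Lemma edge_dart x y : e x y -> exists d, tail d = Some x /\ tail (alpha d) = Some y.
Proof.
case: rot => aK [_ [_ [_ [Ed _]]]] /eE[] /Ed[d [[t1 t2] _]]; first by exists d.
by exists (alpha d); rewrite (proj2 (aK d)).
Qed.

Definition edge_chain (d0 d : D) : 'F_2 := ((d == d0) || (d == alpha d0))%:R.

Lemma edge_chain_alpha d0 d : edge_chain d0 (alpha d) = edge_chain d0 d.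
Proof.
case: rot => aK _; rewrite /edge_chain (inj_eq perm_inj) orbC; congr (_ || _)%:R.
by rewrite -(inj_eq (@perm_inj _ alpha)) (proj2 (aK d)).
Qed.

Lemma edge_chain_boundary d0 v :
  \sum_(d | tail d == v) edge_chain d0 d = (tail d0 == v)%:R + (tail (alpha d0) == v)%:R.
Proof.
case: rot => aK _; rewrite big_mkcond /=.
rewrite (bigID (fun d => (d == d0) || (d == alpha d0))) /= [X in _ + X]big1 ?addr0.
  rewrite sum_pair /edge_chain ?eqxx ?orbT; last by rewrite eq_sym; case: (aK d0).
  by congr (_ + _); case: (_ == v).
by move=> d /negPf nd; rewrite /edge_chain nd if_same.
Qed.

(** The edges of a walk are added modulo 2: each new edge moves one end of the boundary forward, and
    the support stays in the component of [x]. *)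
Lemma path_chain x y : connect e x y -> exists chi : D -> 'F_2,
  [/\ forall d, chi (alpha d) = chi d,
      forall d, chi d != 0 -> exists2 u, tail d = Some u & connect e x u &
      forall v, \sum_(d | tail d == v) chi d = (v == Some x)%:R + (v == Some y)%:R].
Proof.
case/connectP=> p; elim/last_ind: p y => [|p z IH] y /=.
  by move=> _ ->; exists (fun=> 0); split=> // v; rewrite big1 // addF2.
rewrite rcons_path last_rcons => /andP[xp lz] ->{y}.
have [chi [chia chis chib]] := IH _ xp erefl.
have [d0 [td0 tad0]] := edge_dart lz.
have xl : connect e x (last x p) by apply/connectP; exists p.
exists (fun d => chi d + edge_chain d0 d); split.
- by move=> d; rewrite chia edge_chain_alpha.
- move=> d; have [->|/chis//] := eqVneq (chi d) 0; rewrite add0r /edge_chain.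
  have [->|_] := eqVneq d d0; first by exists (last x p).
  have [->|_ //] := eqVneq d (alpha d0); exists z => //.
  exact: connect_trans xl (connect1 lz).
- move=> v; rewrite big_split /= chib edge_chain_boundary td0 tad0.
  rewrite [Some _ == v]eq_sym [Some z == v]eq_sym addrA; congr (_ + _).
  by rewrite -addrA addF2 addr0.
Qed.

(* Close the path from a to c through the star. The faces on one side of this cycle are constant
   around the component of b, but change between b and d when turning around the star. *)
Lemma disjoint_connected_noncrossing (a b c d : 'I_(n.*2)) :
  (a < b)%N -> (b < c)%N -> (c < d)%N ->
  connect e (node a) (node c) -> connect e (node b) (node d) ->
  connect e (node a) (node b).
Proof.
move=> ab bc cd ac bd; apply/idPn => nab.
have [aK [sT [sO [_ [_ [starU starN]]]]]] := rot.
have /fin_all_exists[dk dkP] : forall k, exists d0, (tail d0, tail (alpha d0)) = (None, Some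
  (node k)).
  by move=> k; have [d0 [d0P _]] := starU k; exists d0.
have dkT k : tail (dk k) = None by case: (dkP k).
have dkA k : tail (alpha (dk k)) = Some (node k) by case: (dkP k).
have dkS k : sigma (dk k) = dk (ordS k).
  have [d0 [_ d0U]] := starU (ordS k).
  rewrite -(d0U (dk (ordS k)) (dkP _)); apply/esym/d0U.
  by rewrite sT dkT (starN _ _ (dkP k)).
have dk_inj : injective dk.
  by move=> k l kl; apply: node_inj; have := dkA k; rewrite kl dkA => -[].
have [chi0 [chi0a chi0s chi0b]] := path_chain ac.
pose chi d0 := chi0 d0 + edge_chain (dk a) d0 + edge_chain (dk c) d0.
have chiA d0 : chi (alpha d0) = chi d0 by rewrite /chi chi0a !edge_chain_alpha.
have chiB d0 : \sum_(d' | connect (frel (fun d => sigma d)) d0 d') chi d' = 0.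
  rewrite (eq_bigl (fun d' => tail d' == tail d0)); last first.
    move=> d'; apply/idP/eqP=> [|/esym/sO//].
    case/connectP=> p; elim: p d0 => [|z p IH] x /= => [_ ->//|/andP[/eqP<- /IH] IHp /IHp->].
    exact: sT.
  rewrite !big_split /= chi0b !edge_chain_boundary !dkA !dkT.
  rewrite !(eq_sym _ (tail d0)).
  case: (tail d0 == Some (node a)) (tail d0 == Some (node c)) (tail d0 == None) => [] [] [];
    exact: val_inj.
have [phi phiP] := genus0_cycle_boundary aK g0 chiA chiB.
have chi_star k : chi (dk k) = (k == a)%:R + (k == c)%:R.
  have neA l : (dk k == alpha (dk l)) = false.
    by apply/eqP => kl; have := dkT k; rewrite kl dkA.
  rewrite /chi /edge_chain !neA !orbF !(inj_eq dk_inj).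
  have -> : chi0 (dk k) = 0 by apply/eqP; apply/idPn=> /chi0s[u]; rewrite dkT.
  by rewrite add0r.
have chi_b v d0 : connect e (node b) v -> tail d0 = Some v -> chi d0 = 0.
  move=> bv d0v.
  have nav : ~~ connect e (node a) v.
    by apply: contra nab => av; apply: connect_trans av _; rewrite eC.
  rewrite /chi /edge_chain.
  have -> : chi0 d0 = 0.
    by apply/eqP; apply/idPn=> /chi0s[u]; rewrite d0v => -[<-]; apply/negP.
  have ne l : connect e (node a) (node l) -> ((d0 == dk l) || (d0 == alpha (dk l))) = false.
    move=> al; apply/norP; split; apply/eqP=> d0l; move: d0v; rewrite d0l ?dkT // dkA => -[lv].
    by rewrite -lv al in nav.
  by rewrite !ne ?connect0 // !addr0.
have phi_vertex v d1 d2 : connect e (node b) v -> tail d1 = Some v -> tail d2 = Some v ->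
    phi d1 = phi d2.
  move=> bv d1v d2v; have : fconnect sigma d1 d2 by apply: sO; rewrite d1v d2v.
  case/connectP=> p; elim: p d1 d1v => [|z p IH] x xv /= => [_ ->//|/andP[/eqP xz zp] d2E].
  rewrite -(IH z _ zp d2E) -?xz ?sT //.
  by have [-> _] := phiP x; rewrite (chi_b v) // addr0.
have phi_path v d1 d2 : connect e (node b) v -> tail d1 = Some (node b) -> tail d2 = Some v ->
    phi d1 = phi d2.
  case/connectP=> p; elim/last_ind: p v d2 => [|p z IH] v d2 /=.
    by move=> _ -> d1b d2b; apply: phi_vertex d1b d2b; apply: connect0.
  rewrite rcons_path last_rcons => /andP[bp lz] ->{v} d1b d2z.
  have bl : connect e (node b) (last (node b) p) by apply/connectP; exists p.
  have [d0 [td0 tad0]] := edge_dart lz.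
  rewrite (IH _ d0 bp erefl d1b td0).
  have <- : phi (alpha d0) = phi d0.
    by have [_ ->] := phiP d0; rewrite (chi_b _ _ bl td0) addr0.
  exact: phi_vertex (connect_trans bl (connect1 lz)) tad0 d2z.
have phi_bd : phi (dk b) = phi (dk d).
  have phiN k : k != a -> k != c -> phi (alpha (dk k)) = phi (dk k).
    by move=> /negPf ka /negPf kc; have [_ ->] := phiP (dk k); rewrite chi_star ka kc !addr0.
  rewrite -!phiN; try by apply/eqP => /(congr1 val) /=; lia.
  exact: phi_path bd (dkA b) (dkA d).
(* Turning around the star from b, the only dart of the cycle that is met is the one towards c,
   because a < b. *)
have phi_run j (jN : (j < n.*2)%N) : (b <= j)%N -> phi (dk (Ordinal jN)) = phi (dk b) + (c <
  j)%N%:R.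
  elim: j jN => [|j IH] jN; first by rewrite leqn0 => /eqP b0; lia.
  rewrite leq_eqVlt => /orP[/eqP bj|]; last rewrite ltnS => bj.
    have -> : Ordinal jN = b by apply: val_inj.
    by rewrite (_ : (c < j.+1)%N = false) ?addr0 //; lia.
  have -> : Ordinal jN = ordS (Ordinal (ltnW jN)) by apply: val_inj; rewrite /= modn_small.
  rewrite -dkS; have [-> _] := phiP (dk (Ordinal (ltnW jN))); rewrite IH // chi_star.
  rewrite -addrA; congr (_ + _); rewrite -!val_eqE /=.
  rewrite (_ : (j == a) = false); last by lia.
  rewrite add0r ltnS [in RHS]leq_eqVlt eq_sym; case: eqP => [->|_]; first by rewrite ltnn add0r.
  by rewrite addr0.
have := phi_run d (ltn_ord d) (ltnW (ltn_trans bc cd)).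
have -> : Ordinal (ltn_ord d) = d by apply: val_inj.
by rewrite -phi_bd cd -{1}[phi (dk b)]addr0 => /addrI.
Qed.

End NonCrossing.

(** * Superposition of two matchings *)

Section PartialInjection.
Variables (V : finType) (nx r : rel V).
Hypothesis nx_fun : forall x y y', nx x y -> nx x y' -> y = y'.
Hypothesis nx_inj : forall x x' y, nx x y -> nx x' y -> x = x'.
Hypothesis rE : forall x y, r x y = nx x y || nx y x.

Lemma nx_last x y : connect nx x y -> x != y -> exists2 z, connect nx x z & nx z y.
Proof.
case/connectP=> p; case/lastP: p => [_ ->|p z]; rewrite ?eqxx //.
rewrite rcons_path last_rcons => /andP[xp lz] -> _; exists (last x p) => //.
by apply/connectP; exists p.
Qed.

Lemma nx_first x y : connect nx x y -> x != y -> exists2 z, nx x z & connect nx z y.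
Proof.
case/connectP=> [[_ ->|z p]]; rewrite ?eqxx //= => /andP[xz zp] -> _.
by exists z => //; apply/connectP; exists p.
Qed.

(** A walk that reverses its direction must retrace its last step, by functionality or injectivity;
    up to such detours it runs in one direction. *)
Lemma pinj_connect x y : connect r x y -> connect nx x y \/ connect nx y x.
Proof.
case/connectP=> p; elim/last_ind: p y => [|p z IH] y; first by move=> _ ->; left.
rewrite rcons_path last_rcons => /andP[xp]; rewrite rE => lz ->{y}.
have {IH xp}[xl|lx] := IH _ xp erefl; case/orP: lz => lz.
- by left; apply: connect_trans xl (connect1 lz).
- have [xe|/(nx_last xl)[w xw wl]] := eqVneq x (last x p).
    by right; apply: connect1; rewrite xe.
  by left; rewrite (nx_inj lz wl).
- have [xe|] := eqVneq (last x p) x; first by left; apply: connect1; rewrite -xe.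
  by case/(nx_first lx)=> w lw wx; right; rewrite (nx_fun lz lw).
- by right; apply: connect_trans (connect1 lz) lx.
Qed.

Lemma pinj_connectC : connect_sym r.
Proof. by apply: sym_connect_sym => x y; rewrite !rE orbC. Qed.

Lemma pinj_sub x y : connect nx x y -> connect r x y.
Proof. by apply: connect_sub => a b ab; apply: connect1; rewrite rE ab. Qed.

Lemma start_unique x y : (forall z, ~~ nx z x) -> (forall z, ~~ nx z y) ->
  connect r x y -> x = y.
Proof.
move=> sx sy /pinj_connect[]; have [//|] := eqVneq x y.
  by move=> xy /nx_last/(_ xy)[z _]; rewrite (negPf (sy z)).
by rewrite eq_sym => yx /nx_last/(_ yx)[z _]; rewrite (negPf (sx z)).
Qed.

Lemma stop_unique x y : (forall z, ~~ nx x z) -> (forall z, ~~ nx y z) ->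
  connect r x y -> x = y.
Proof.
move=> sx sy /pinj_connect[]; have [//|] := eqVneq x y.
  by move=> xy /nx_first/(_ xy)[z]; rewrite (negPf (sx z)).
by rewrite eq_sym => yx /nx_first/(_ yx)[z]; rewrite (negPf (sy z)).
Qed.

(** Otherwise [nx] would map the finite set of points reachable from [x] injectively into itself
    minus [x]. *)
Lemma stop_exists x : (forall z, ~~ nx z x) ->
  exists y, connect nx x y && [forall z, ~~ nx y z].
Proof.
move=> sx; apply/existsP; apply: contraT; rewrite negb_exists => /forallP nostop.
pose Q := [set y | connect nx x y]; pose g y := odflt y [pick z | nx y z].
have gP y : y \in Q -> nx y (g y).
  rewrite inE => xy; have := nostop y; rewrite xy /= negb_forall => /existsP[z].
  by rewrite negbK /g; case: pickP => [//|/(_ z)->].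
have : (#|g @: Q| <= #|Q :\ x|)%N.
  apply/subset_leq_card/subsetP=> _ /imsetP[y yQ ->]; rewrite !inE.
  apply/andP; split; first by apply: contraNneq (sx y) => <-; apply: gP.
  by apply: connect_trans (connect1 (gP _ yQ)); rewrite inE in yQ.
rewrite card_in_imset; last first.
  by move=> y z yQ zQ gyz; have := gP _ zQ; rewrite -gyz; apply/nx_inj/gP.
by rewrite [X in (X <= _)%N](cardsD1 x) inE connect0 ltnn.
Qed.

End PartialInjection.

(** * Matchings of a bipartite graph and the oriented paths of two of them *)

Section Matchings.
Variables (V : finType) (black : pred V) (E : {set V * V}).
Hypothesis bip : bipartite_edges black E.
Implicit Types (M : {set V * V}) (P : {set V * V} * {set V * V}).

Definition matching M := (M \subset E) &&
  [forall e in M, forall e' in M, ((e.1 == e'.1) || (e.2 == e'.2)) ==> (e == e')].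

Definition covered M := [set v | [exists e in M, (e.1 == v) || (e.2 == v)]].

Lemma matchingP M : reflect ({subset M <= E} /\
  forall e e', e \in M -> e' \in M -> (e.1 = e'.1 \/ e.2 = e'.2) -> e = e') (matching M).
Proof.
apply: (iffP andP) => [[/subsetP sM /forall_inP mM]|[sM mM]].
  split=> // e e' eM e'M ee'; have /forall_inP/(_ e' e'M) := mM e eM.
  by case: ee' => ->; rewrite eqxx ?orbT => /eqP.
split; first exact/subsetP.
apply/forall_inP=> e eM; apply/forall_inP=> e' e'M; apply/implyP=> ee'.
by apply/eqP/mM => //; case/orP: ee' => /eqP; [left|right].
Qed.

Lemma black_edge x y : (x, y) \in E -> black x.
Proof. by case/bip. Qed.

Lemma white_edge x y : (x, y) \in E -> ~~ black y.
Proof. by case/bip. Qed.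

Lemma coveredP M v : matching M ->
  reflect (exists y, ((v, y) \in M) || ((y, v) \in M)) (v \in covered M).
Proof.
move=> mM; rewrite inE; apply: (iffP exists_inP) => [[[a b] abM]|[y]] /=.
  by case/orP=> /eqP<-; [exists b; rewrite abM | exists a; rewrite abM orbT].
by case/orP; [exists (v, y) | exists (y, v)]; rewrite //= eqxx ?orbT.
Qed.

Lemma matching_edge M e e' : matching M -> e \in M -> e' \in M ->
  (e.1 == e'.1) || (e.2 == e'.2) || (e.1 == e'.2) || (e.2 == e'.1) -> e = e'.
Proof.
case/matchingP=> sM mM eM e'M; have [b1 w1] := bip (sM _ eM); have [b2 w2] := bip (sM _ e'M).
case/orP=> [/orP[/orP[]|]|] /eqP h; try by apply: mM => //; auto.
  by rewrite h (negPf w2) in b1.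
by rewrite h b2 in w1.
Qed.

Lemma card_incident M v : matching M ->
  #|[set e in M | (e.1 == v) || (e.2 == v)]| = (v \in covered M).
Proof.
move=> mM; case: (boolP (v \in covered M)) => [|vM].
  rewrite inE => /exists_inP[e eM ev]; apply/eqP/cards1P; exists e.
  apply/setP=> e'; rewrite !inE; apply/andP/eqP=> [[e'M e'v]|-> //].
  apply: (matching_edge mM) => //.
  by case/orP: ev => /eqP->; case/orP: e'v => /eqP->; rewrite eqxx ?orbT.
apply: eq_card0 => e; rewrite !inE; apply: contraNF vM => /andP[eM ev].
by rewrite inE; apply/exists_inP; exists e.
Qed.

Lemma perfect_matchingE S M : perfect_matching E S M = matching M && (covered M == S).
Proof.
apply/and3P/andP=> [[sM /forall_inP MS /forall_inP M1]|[mM /eqP<-]].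
  have uniq v e e' : v \in S -> e \in M -> e' \in M -> (e.1 == v) || (e.2 == v) ->
      (e'.1 == v) || (e'.2 == v) -> e = e'.
    move=> /M1/cards1P[f fE] eM e'M ev e'v.
    have : e \in [set e in M | (e.1 == v) || (e.2 == v)] by rewrite inE eM.
    have : e' \in [set e in M | (e.1 == v) || (e.2 == v)] by rewrite inE e'M.
    by rewrite fE !inE => /eqP-> /eqP.
  split.
    apply/matchingP; split; first exact/subsetP.
    move=> e e' eM e'M; have /andP[e1 e2] := MS _ eM.
    by case=> h; [apply: (uniq e.1)|apply: (uniq e.2)]; rewrite // ?h eqxx ?orbT.
  apply/eqP/setP=> v; rewrite inE; apply/exists_inP/idP=> [[e eM]|vS].
    by have /andP[e1 e2] := MS _ eM => /orP[] /eqP<-.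
  have /cards1P[f fE] := M1 _ vS; have : f \in [set f] by rewrite inE.
  by rewrite -fE inE => /andP[fM fv]; exists f.
have [sM _] := matchingP _ mM; split; first exact/subsetP.
  apply/forall_inP=> e eM; rewrite !inE; apply/andP; split; apply/exists_inP; exists e => //.
    by rewrite eqxx.
  by rewrite eqxx orbT.
by apply/forall_inP=> v vM; rewrite card_incident // vM.
Qed.

Lemma matchingU1 M x y : matching M -> (x, y) \in E -> x \notin covered M ->
  y \notin covered M -> matching ((x, y) |: M).
Proof.
move=> mM xyE xM yM; have [sM uM] := matchingP _ mM; apply/matchingP; split.
  by move=> e; rewrite inE => /orP[/set1P->|/sM].
have new e : e \in M -> e.1 = x \/ e.2 = y -> False.
  case: e => a b abM /= []h; [move/negP: xM; apply | move/negP: yM; apply];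
    apply/coveredP => //; [exists b | exists a]; rewrite -h abM ?orbT //.
move=> e e'; rewrite !inE => /orP[/eqP->|eM] /orP[/eqP->|e'M] //= ee'.
- by case: (new e' e'M); case: ee' => <-; auto.
- by case: (new e eM); case: ee' => <-; auto.
- exact: uM.
Qed.

Lemma in_covered M x y : matching M -> (x, y) \in M -> x \in covered M /\ y \in covered M.
Proof.
by move=> mM xyM; split; apply/coveredP => //; [exists y|exists x]; rewrite xyM ?orbT.
Qed.

(* The M1-edges are oriented from black to white and the M2-edges from white to black. *)
Definition succ P : rel V := fun x y => ((x, y) \in P.1) || ((y, x) \in P.2).

Definition adj P : rel V := fun x y =>
  [|| (x, y) \in P.1, (x, y) \in P.2, (y, x) \in P.1 | (y, x) \in P.2].

Definition matchings P := matching P.1 && matching P.2.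

Section Pair.
Variables (P : {set V * V} * {set V * V}) (mP : matchings P).
Let m1 : matching P.1. Proof. by case/andP: mP. Qed.
Let m2 : matching P.2. Proof. by case/andP: mP. Qed.
Let s1 : {subset P.1 <= E}. Proof. by case/matchingP: m1. Qed.
Let s2 : {subset P.2 <= E}. Proof. by case/matchingP: m2. Qed.

Lemma succ_fun x y y' : succ P x y -> succ P x y' -> y = y'.
Proof.
rewrite /succ => /orP[]h /orP[]h'.
- by have := matching_edge m1 h h'; rewrite /= eqxx ?orbT /= => /(_ isT)[].
- by have := black_edge (s1 h); rewrite (negPf (white_edge (s2 h'))).
- by have := black_edge (s1 h'); rewrite (negPf (white_edge (s2 h))).
- by have := matching_edge m2 h h'; rewrite /= eqxx ?orbT /= => /(_ isT)[].
Qed.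

Lemma succ_inj x x' y : succ P x y -> succ P x' y -> x = x'.
Proof.
rewrite /succ => /orP[]h /orP[]h'.
- by have := matching_edge m1 h h'; rewrite /= eqxx ?orbT /= => /(_ isT)[].
- by have := black_edge (s2 h'); rewrite (negPf (white_edge (s1 h))).
- by have := black_edge (s2 h); rewrite (negPf (white_edge (s1 h'))).
- by have := matching_edge m2 h h'; rewrite /= eqxx ?orbT /= => /(_ isT)[].
Qed.

Lemma adj_succ x y : adj P x y = succ P x y || succ P y x.
Proof. by rewrite /adj /succ; do 4!case: (_ \in _). Qed.

Lemma adjC : connect_sym (adj P).
Proof. exact: pinj_connectC adj_succ. Qed.

(** In the orientation of [succ] a black vertex can be left only along [P.1] and a white one only
    along [P.2]. *)
Lemma no_succP x :
  reflect (forall z, ~~ succ P x z) (x \notin covered (if black x then P.1 else P.2)).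
Proof.
apply: (iffP idP) => [xM z|nos].
  apply: contra xM => /orP[]h.
    by rewrite (black_edge (s1 h)); case: (in_covered m1 h).
  by rewrite (negPf (white_edge (s2 h))); case: (in_covered m2 h).
case: (boolP (black x)) => bx; apply/negP.
  case/(coveredP _ m1)=> y /orP[]h; first by have := nos y; rewrite /succ h.
  by rewrite (negPf (white_edge (s1 h))) in bx.
case/(coveredP _ m2)=> y /orP[]h; last by have := nos y; rewrite /succ h orbT.
by rewrite (black_edge (s2 h)) in bx.
Qed.

Lemma no_predP x :
  reflect (forall z, ~~ succ P z x) (x \notin covered (if black x then P.2 else P.1)).
Proof.
apply: (iffP idP) => [xM z|nos].
  apply: contra xM => /orP[]h.
    by rewrite (negPf (white_edge (s1 h))); case: (in_covered m1 h).
  by rewrite (black_edge (s2 h)); case: (in_covered m2 h).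
case: (boolP (black x)) => bx; apply/negP.
  case/(coveredP _ m2)=> y /orP[]h; first by have := nos y; rewrite /succ h orbT.
  by rewrite (negPf (white_edge (s2 h))) in bx.
case/(coveredP _ m1)=> y /orP[]h; last by have := nos y; rewrite /succ h.
by rewrite (black_edge (s1 h)) in bx.
Qed.

Lemma no_succ_unique x y : connect (adj P) x y ->
  x \notin covered (if black x then P.1 else P.2) ->
  y \notin covered (if black y then P.1 else P.2) -> x = y.
Proof.
by move=> xy /no_succP sx /no_succP sy;
  apply: stop_unique succ_fun succ_inj adj_succ _ _ sx sy xy.
Qed.

Lemma no_pred_unique x y : connect (adj P) x y ->
  x \notin covered (if black x then P.2 else P.1) ->
  y \notin covered (if black y then P.2 else P.1) -> x = y.
Proof.
by move=> xy /no_predP sx /no_predP sy;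
  apply: start_unique succ_fun succ_inj adj_succ _ _ sx sy xy.
Qed.

Lemma no_succ_exists x : x \notin covered (if black x then P.2 else P.1) ->
  exists2 y, connect (adj P) x y & y \notin covered (if black y then P.1 else P.2).
Proof.
case/no_predP/(stop_exists succ_inj)=> y /andP[xy /forallP ny]; exists y; last exact/no_succP.
exact: pinj_sub adj_succ _ _ xy.
Qed.

End Pair.

(** Kempe exchange of the two matchings on [U]. An edge is located by its black end, which is
    unambiguous once [U] is a union of components. *)
Definition swap (U : {set V}) P :=
  ([set e in P.1 | e.1 \notin U] :|: [set e in P.2 | e.1 \in U],
   [set e in P.2 | e.1 \notin U] :|: [set e in P.1 | e.1 \in U]).

End Matchings.

(** * Kempe exchanges and splitting a multigraph into two matchings *)

Section Superposition.
Variables (V : finType) (black : pred V) (E : {set V * V}).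
Hypothesis bip : bipartite_edges black E.
Implicit Types (M : {set V * V}) (P Q : {set V * V} * {set V * V}) (S A U : {set V}).

Lemma mem_swap1 U P e : (e \in (swap U P).1) = if e.1 \in U then e \in P.2 else e \in P.1.
Proof. by rewrite !inE; case: (_ \in U); rewrite ?andbT ?andbF ?orbF. Qed.

Lemma mem_swap2 U P e : (e \in (swap U P).2) = if e.1 \in U then e \in P.1 else e \in P.2.
Proof. exact: (mem_swap1 U (P.2, P.1)). Qed.

Lemma swap_sum U P e :
  ((e \in (swap U P).1) + (e \in (swap U P).2) = (e \in P.1) + (e \in P.2))%N.
Proof. by rewrite mem_swap1 mem_swap2; case: ifP => // _; rewrite addnC. Qed.

Definition adj_closed P U := forall x y, adj P x y -> (x \in U) = (y \in U).

Lemma adj_closed_sym P U : adj_closed P U -> adj_closed (P.2, P.1) U.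
Proof. by move=> Uc x y h; apply: Uc; move: h; rewrite /adj /=; do 4!case: (_ \in _). Qed.

Lemma matchings_sym P : matchings E P -> matchings E (P.2, P.1).
Proof. by rewrite /matchings andbC. Qed.

Lemma swap_matching1 U P : matchings E P -> adj_closed P U -> matching E (swap U P).1.
Proof.
case/andP=> /matchingP[s1 u1] /matchingP[s2 u2] Uc; apply/matchingP; split.
  by move=> e; rewrite mem_swap1; case: ifP => _; [apply: s2 | apply: s1].
have eU e : (e \in P.1) || (e \in P.2) -> (e.1 \in U) = (e.2 \in U).
  by case: e => a b h; apply: Uc; rewrite /adj /= orbA h.
move=> e e'; rewrite !mem_swap1 => eP e'P ee'.
have UU : (e.1 \in U) = (e'.1 \in U).
  case: ee' => [-> //|h]; rewrite (eU e) ?(eU e') ?h //.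
    by move: e'P; case: ifP => _ ->; rewrite ?orbT.
  by move: eP; case: ifP => _ ->; rewrite ?orbT.
move: eP e'P; rewrite UU; case: ifP => _ eP e'P; [exact: u2 | exact: u1].
Qed.

Lemma swap_matchings U P : matchings E P -> adj_closed P U -> matchings E (swap U P).
Proof.
move=> mP Uc; rewrite /matchings swap_matching1 //.
exact: (swap_matching1 (matchings_sym mP) (adj_closed_sym Uc)).
Qed.

Lemma swap_covered1 U P v : matchings E P -> adj_closed P U ->
  (v \in covered (swap U P).1) = (v \in covered (if v \in U then P.2 else P.1)).
Proof.
move=> mP Uc; have ms := swap_matching1 mP Uc; have /andP[m1 m2] := mP.
have mif : matching E (if v \in U then P.2 else P.1) by case: ifP.
have eU e : (e \in P.1) || (e \in P.2) -> (e.1 \in U) = (e.2 \in U).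
  by case: e => a b h; apply: Uc; rewrite /adj /= orbA h.
apply/(coveredP _ ms)/(coveredP _ mif) => -[y yP]; exists y; move: yP.
  rewrite !mem_swap1 /= => /orP[h|h].
    by move: h; case: (v \in U) => ->.
  have -> : (v \in U) = (y \in U).
    by apply/esym/(eU (y, v)); move: h; case: ifP => _ ->; rewrite ?orbT.
  by move: h; case: (y \in U) => ->; rewrite orbT.
rewrite !mem_swap1 /= => /orP[h|h].
  by move: h; case: (v \in U) => ->.
have <- : (v \in U) = (y \in U).
  by apply/esym/(eU (y, v)); move: h; case: ifP => _ ->; rewrite ?orbT.
by move: h; case: (v \in U) => ->; rewrite orbT.
Qed.

Lemma swap_covered2 U P v : matchings E P -> adj_closed P U ->
  (v \in covered (swap U P).2) = (v \in covered (if v \in U then P.1 else P.2)).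
Proof.
by move=> mP Uc; have := swap_covered1 v (matchings_sym mP) (adj_closed_sym Uc).
Qed.

Lemma component_closed P x : adj_closed P [set y | connect (adj P) x y].
Proof.
by move=> y z yz; rewrite !inE (same_connect_r (adjC P) (connect1 yz)).
Qed.

Lemma matchings_add P x y : matchings E P -> (x, y) \in E ->
    x \notin covered P.1 -> y \notin covered P.1 ->
  exists2 Q, matchings E Q & forall e,
    ((e \in Q.1) + (e \in Q.2) = (e \in P.1) + (e \in P.2) + (e == (x, y)))%N.
Proof.
move=> mP xyE xP yP; have /andP[m1 m2] := mP; exists ((x, y) |: P.1, P.2).
  by rewrite /matchings /= matchingU1.
move=> e; rewrite /= !inE; case: eqP => [->|_] /=; last by rewrite addn0.
case: (boolP ((x, y) \in P.1)) => [/(in_covered m1)[h]|]; last by rewrite addn1.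
by rewrite h in xP.
Qed.

(* A Kempe switch frees one of the two matchings at both ends of the new edge. *)
Lemma matchings_augment P x y : matchings E P -> (x, y) \in E ->
    x \notin covered P.2 -> y \notin covered P.1 ->
  exists2 Q, matchings E Q & forall e,
    ((e \in Q.1) + (e \in Q.2) = (e \in P.1) + (e \in P.2) + (e == (x, y)))%N.
Proof.
move=> mP xyE x2 y1; have /andP[m1 m2] := mP.
pose U := [set z | connect (adj P) x z].
have Uc : adj_closed P U by apply: component_closed.
have [x1|x1] := boolP (x \in covered P.1); last exact: matchings_add.
have [y2|y2] := boolP (y \in covered P.2); last first.
  have [||||Q mQ QE] := @matchings_add (P.2, P.1) x y => //; first exact: matchings_sym.
  by exists Q => // e; rewrite QE /= [X in (X + _)%N]addnC.
have xU : x \in U by rewrite inE connect0.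
(* Neither [x], black and free in [P.2], nor [y], white and free in [P.1], has a predecessor. In one
   component they would both be the start of the path, hence equal, against their colours. *)
have yU : y \notin U.
  rewrite inE; apply/negP=> xy; have bx := black_edge bip xyE; have wy := white_edge bip xyE.
  have := no_pred_unique bip mP xy; rewrite bx (negPf wy) => /(_ x2 y1) xEy.
  by rewrite xEy (negPf wy) in bx.
have [||||Q mQ QE] := @matchings_add (swap U P) x y => //.
- exact: swap_matchings.
- by rewrite swap_covered1 // xU.
- by rewrite swap_covered1 // (negPf yU).
by exists Q => // e; rewrite QE swap_sum.
Qed.

Definition edge_mult P : {ffun V * V -> 'I_3} := [ffun e => inord ((e \in P.1) + (e \in P.2))].

Lemma edge_multE P e : edge_mult P e = ((e \in P.1) + (e \in P.2))%N :> nat.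
Proof. by rewrite ffunE inordK //; case: (_ \in _); case: (_ \in _). Qed.

Lemma dd_rel_mult P : dd_rel (edge_mult P) =2 adj P.
Proof. by move=> x y; rewrite /dd_rel !edge_multE /adj; do 4!case: (_ \in _). Qed.

Lemma connect_mult P : connect (dd_rel (edge_mult P)) =2 connect (adj P).
Proof. exact: eq_connect (dd_rel_mult P). Qed.

Lemma sum_incident P v : matchings E P ->
  (\sum_(e in E | (e.1 == v) || (e.2 == v)) ((e \in P.1) + (e \in P.2))
   = (v \in covered P.1) + (v \in covered P.2))%N.
Proof.
case/andP=> m1 m2; rewrite big_split /= -(card_incident bip v m1) -(card_incident bip v m2)
  -!sum1_card.
by congr (_ + _)%N; rewrite [RHS]big_mkcond [LHS]big_mkcond /=; apply: eq_bigr => e _;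
  rewrite !inE; [case/matchingP: m1 => /(_ e) s _|case/matchingP: m2 => /(_ e) s _];
  case: (boolP (e \in E)) => [|/(contra s)/negPf->] //= _; case: (_ || _); case: (_ \in _).
Qed.

Lemma ddeg_mult P v : matchings E P ->
  ddeg E (edge_mult P) v = ((v \in covered P.1) + (v \in covered P.2))%N.
Proof. by move=> mP; rewrite -sum_incident //; apply: eq_bigr => e _; rewrite edge_multE. Qed.

(** König's edge-colouring theorem for bipartite multigraphs of degree at most 2. The pair of
    matchings grows by one edge at a time; [k] bounds the total multiplicity still missing. *)
Lemma dd_decompose (m : {ffun V * V -> 'I_3}) :
    (forall e, e \notin E -> m e = 0%N :> nat) -> (forall v, (ddeg E m v <= 2)%N) ->
  exists2 P, matchings E P & edge_mult P = m.
Proof.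
move=> m0 m2; suff grow k P : matchings E P ->
    (forall e, ((e \in P.1) + (e \in P.2) <= m e)%N) ->
    (\sum_e (m e : nat) <= \sum_e ((e \in P.1) + (e \in P.2)) + k)%N ->
    exists2 Q, matchings E Q & edge_mult Q = m.
  apply: (grow (\sum_e (m e : nat))%N (set0, set0)) => [|e|]; rewrite ?inE ?leq_addl //.
  by apply/andP; split; apply/matchingP; split=> e; rewrite inE.
elim: k P => [|k IH] P mP Pm Pk; have /andP[m1 m2'] := mP.
  exists P => //; apply/ffunP=> e; apply: ord_inj; rewrite edge_multE; apply/eqP.
  rewrite eqn_leq Pm /= leqNgt; apply/negP=> lt_e.
  move: Pk; rewrite addn0 leqNgt => /negP[]; rewrite (bigD1 e) //= [ltnRHS](bigD1 e) //=.
  by rewrite -addSn leq_add // leq_sum.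
have [/forallP all_eq|] := boolP [forall e, ((e \in P.1) + (e \in P.2) == m e)%N].
  by exists P => //; apply/ffunP=> e; apply: ord_inj; rewrite edge_multE; apply/eqP.
rewrite negb_forall => /existsP[[x y] xy_ne].
have lt_xy : (((x, y) \in P.1) + ((x, y) \in P.2) < m (x, y))%N by rewrite ltn_neqAle xy_ne Pm.
have xyE : (x, y) \in E by apply: contraLR lt_xy => /m0->; rewrite -leqNgt.
(* An end of an edge that lacks multiplicity cannot be covered twice already, as its degree in [m]
   would exceed 2. *)
have free v : (x == v) || (y == v) -> (v \notin covered P.1) || (v \notin covered P.2).
  move=> xyv; rewrite -negb_and; apply/negP=> /andP[v1 v2].
  suff : (2 < ddeg E m v)%N by rewrite ltnNge m2.
  have -> : 2%N = ((v \in covered P.1) + (v \in covered P.2))%N by rewrite v1 v2.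
  rewrite -sum_incident // /ddeg (bigD1 (x, y)) ?xyE //= [ltnRHS](bigD1 (x, y)) ?xyE //=.
  by rewrite -addSn leq_add // leq_sum.
have fx := free x; rewrite eqxx /= in fx; have fy := free y; rewrite eqxx orbT in fy.
suff [Q mQ QE] : exists2 Q, matchings E Q & forall e,
    ((e \in Q.1) + (e \in Q.2) = (e \in P.1) + (e \in P.2) + (e == (x, y)))%N.
  apply: (IH Q mQ) => [e|].
    by rewrite QE; case: eqP => [->|_]; rewrite ?addn1 ?addn0.
  under [X in (_ <= X + _)%N]eq_bigr => e _ do rewrite QE.
  rewrite big_split /= -addnA; apply: leq_trans Pk _; rewrite leq_add2l.
  by rewrite (bigD1 (x, y)) //= eqxx addnAC -addn1 addnC leq_add2l leq_addr.
have [mP' P'E] := (matchings_sym mP, fun e => addnC (e \in P.1) (e \in P.2)).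
case/orP: (fx isT) => hx; case/orP: (fy isT) => hy.
- exact: matchings_add.
- by have [Q mQ QE] := matchings_augment mP' xyE hx hy; exists Q => // e; rewrite QE P'E.
- exact: matchings_augment.
- by have [Q mQ QE] := matchings_add mP' xyE hx hy; exists Q => // e; rewrite QE P'E.
Qed.

End Superposition.

(** * The number of ways to split a double-dimer configuration *)

Section CountDecompositions.
Variables (V : finType) (black : pred V) (E : {set V * V}).
Hypothesis bip : bipartite_edges black E.
Implicit Types (M : {set V * V}) (P Q : {set V * V} * {set V * V}) (S A U : {set V}).
Implicit Types (m : {ffun V * V -> 'I_3}).

Definition dd_config S m : bool :=
  [&& [forall e, (e \notin E) ==> ((m e : nat) == 0%N)] &
      [forall v, ddeg E m v == (if v \in S then 1 else 2)%N]].

Definition components m : {set {set V}} := [set [set y | connect (dd_rel m) x y] | x : V].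

Definition loops S m : {set {set V}} :=
  [set C in components m | [forall v in C, v \notin S] && (2 < #|C|)%N].

(* The M1-edge at a node is missing on A, the M2-edge on S minus A; with M1-edges oriented from
   black to white and M2-edges from white to black, the boolean says that the path starts at x. *)
Definition compatible S A m := [forall x in S, forall y in S,
  (x != y) && connect (dd_rel m) x y ==> ((x \in A) (+) black x != (y \in A) (+) black y)].

Definition decompositions S A m := [set P | [&& matchings E P,
  covered P.1 == ~: A, covered P.2 == ~: (S :\: A) & edge_mult P == m]].

Lemma decomp_start S A m P x : P \in decompositions S A m -> x \in S ->
  (x \notin covered (if black x then P.2 else P.1)) = (x \in A) (+) black x.
Proof.
rewrite inE => /and4P[_ /eqP c1 /eqP c2 _] xS.
by case: (black x); rewrite ?c1 ?c2 !inE ?xS; case: (x \in A).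
Qed.

Lemma decomp_stop S A m P x : P \in decompositions S A m -> x \in S ->
  (x \notin covered (if black x then P.1 else P.2)) = ~~ ((x \in A) (+) black x).
Proof.
rewrite inE => /and4P[_ /eqP c1 /eqP c2 _] xS.
by case: (black x); rewrite ?c1 ?c2 !inE ?xS; case: (x \in A).
Qed.

(** Two nodes of one component with equal booleans would both be the start, or both the end, of the
    same oriented path. *)
Lemma decomp_compatible S A m P : P \in decompositions S A m -> compatible S A m.
Proof.
move=> Pd; have := Pd; rewrite inE => /and4P[mP _ _ /eqP Pm].
apply/forall_inP=> x xS; apply/forall_inP=> y yS; apply/implyP=> /andP[xy].
rewrite -Pm connect_mult => cxy; apply: contra xy => /eqP eqA.
case: (boolP ((x \in A) (+) black x)) => h.
  by apply/eqP/(no_pred_unique bip mP cxy); rewrite (decomp_start Pd) // -?eqA.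
by apply/eqP/(no_succ_unique bip mP cxy); rewrite (decomp_stop Pd) // -?eqA.
Qed.

Lemma decomp_dd_config S A m P : A \subset S -> P \in decompositions S A m -> dd_config S m.
Proof.
move=> AS; rewrite inE => /and4P[mP /eqP c1 /eqP c2 /eqP <-]; apply/andP; split.
  apply/forallP=> e; apply/implyP=> eE; rewrite edge_multE.
  case/andP: mP => /matchingP[s1 _] /matchingP[s2 _].
  by rewrite (contraNF (s1 e)) // (contraNF (s2 e)).
apply/forallP=> v; rewrite (ddeg_mult bip) // c1 c2 !inE.
by have := subsetP AS v; case: (v \in A) => [->|_]; case: (v \in S).
Qed.

Lemma dd_decompose_config S m : dd_config S m ->
  exists P, P \in decompositions S (S :\: covered P.1) m.
Proof.
case/andP=> /forallP mE /forallP mS.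
have [|v|P mP Pm] := @dd_decompose _ _ _ bip m.
- by move=> e eE; apply/eqP; move/implyP: (mE e); apply.
- by rewrite (eqP (mS v)); case: ifP.
have cov v : (v \in covered P.1) && (v \in covered P.2) = (v \notin S) /\
     (v \in covered P.1) || (v \in covered P.2).
  have := mS v; rewrite -Pm (ddeg_mult bip) //.
  by case: (v \in S); case: (v \in covered P.1); case: (v \in covered P.2).
exists P; rewrite inE mP Pm eqxx andbT /=; apply/andP; split; apply/eqP/setP=> v;
  rewrite !(in_setC, in_setD); move: (cov v);
  by case: (v \in S); case: (v \in covered P.1); case: (v \in covered P.2) => -[].
Qed.

(** Edge colouring gives a decomposition for some subset [A0]. Two compatible subsets agree at both
    ends of a path or at neither, so exchanging the matchings on the paths of disagreement turns
    [A0] into [A]. *)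
Lemma decomposition_exists S A m : A \subset S -> dd_config S m -> compatible S A m ->
  exists P, P \in decompositions S A m.
Proof.
move=> AS mS Acomp; have [P Pd] := dd_decompose_config mS.
set A0 := S :\: _ in Pd; have Pcomp := decomp_compatible Pd.
have := Pd; rewrite inE => /and4P[mP /eqP c1 /eqP c2 /eqP Pm].
have A0S : A0 \subset S by apply: subsetDl.
clearbody A0.
pose U := [set v | [exists x in S, connect (adj P) v x && ((x \in A) (+) (x \in A0))]].
have Uc : adj_closed P U.
  move=> v w vw; rewrite !inE; apply: eq_existsb => x.
  by rewrite (same_connect (adjC P) (connect1 vw)).
have US x : x \in S -> (x \in U) = (x \in A) (+) (x \in A0).
  move=> xS; rewrite inE; apply/exists_inP/idP=> [[y yS /andP[xy yA]]|h]; last first.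
    by exists x; rewrite ?connect0.
  have [->//|nxy] := eqVneq x y.
  have := forall_inP (forall_inP Acomp x xS) y yS.
  have := forall_inP (forall_inP Pcomp x xS) y yS.
  rewrite -Pm connect_mult xy nxy /=; move: yA.
  by do 2!case: (x \in _); do 2!case: (y \in _); do 2!case: (black _).
have UnS v : v \notin S -> v \in covered P.1 /\ v \in covered P.2.
  move=> vS; rewrite c1 c2 !in_setC in_setD (negPf vS) andbF; split=> //.
  by apply/negP=> /(subsetP A0S) vS'; rewrite vS' in vS.
exists (swap U P); rewrite inE; apply/and4P; split.
- exact: swap_matchings.
- apply/eqP/setP=> v; rewrite (swap_covered1 _ mP Uc) in_setC.
  have [vS|vS] := boolP (v \in S); last first.
    have [h1 h2] := UnS v vS; rewrite (contraNN (subsetP AS v)) //.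
    by case: ifP.
  rewrite US //; case: ifP; rewrite ?c1 ?c2 !inE ?vS;
  by case: (v \in A); case: (v \in A0).
- apply/eqP/setP=> v; rewrite (swap_covered2 _ mP Uc) in_setC.
  have [vS|vS] := boolP (v \in S); last first.
    have [h1 h2] := UnS v vS; rewrite in_setD (negPf vS) andbF.
    by case: ifP.
  rewrite US //; case: ifP; rewrite ?c1 ?c2 !inE ?vS;
  by case: (v \in A); case: (v \in A0).
- by rewrite -Pm; apply/eqP/ffunP=> e; apply: ord_inj; rewrite !edge_multE swap_sum.
Qed.

Section Fibre.
Variables (S A : {set V}) (m : {ffun V * V -> 'I_3}) (P : {set V * V} * {set V * V}).
Hypothesis AS : A \subset S.
Hypothesis Pd : P \in decompositions S A m.

Let mP : matchings E P. Proof. by move: Pd; rewrite inE => /and4P[]. Qed.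
Let m1 : matching E P.1. Proof. by case/andP: mP. Qed.
Let m2 : matching E P.2. Proof. by case/andP: mP. Qed.
Let c1 v : (v \in covered P.1) = (v \notin A).
Proof. by move: Pd; rewrite inE => /and4P[_ /eqP-> _ _]; rewrite inE. Qed.
Let c2 v : (v \in covered P.2) = (v \notin S :\: A).
Proof. by move: Pd; rewrite inE => /and4P[_ _ /eqP-> _]; rewrite inE. Qed.
Let Pm : edge_mult P = m. Proof. by move: Pd; rewrite inE => /and4P[_ _ _ /eqP]. Qed.

Let componentsE : components m = [set [set y | connect (adj P) x y] | x : V].
Proof.
by apply: eq_imset => x; apply/setP=> y; rewrite !inE -Pm connect_mult.
Qed.

Lemma component_eq C v : C \in components m -> v \in C -> C = [set y | connect (adj P) v y].
Proof.
rewrite componentsE => /imsetP[x _ ->]; rewrite inE => xv; apply/setP=> y; rewrite !inE.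
exact: same_connect (adjC P) _ _ xv y.
Qed.

Lemma cover_components_closed (L : {set {set V}}) : L \subset components m ->
  adj_closed P (cover L).
Proof.
move=> LC x y xy; have yx : adj P y x by rewrite adj_succ orbC -adj_succ.
have sub u v : adj P u v -> u \in cover L -> v \in cover L.
  move=> uv /bigcupP[C CL uC]; apply/bigcupP; exists C => //.
  by rewrite (component_eq (subsetP LC _ CL) uC) inE connect1.
by apply/idP/idP; apply: sub.
Qed.

Lemma doubled_component x y C : (x, y) \in P.1 -> (x, y) \in P.2 -> C \in components m ->
  x \in C -> (#|C| <= 2)%N.
Proof.
move=> xy1 xy2 CC xC; rewrite (component_eq CC xC).
suff sub : [set z | connect (adj P) x z] \subset [set x; y].
  by apply: leq_trans (subset_leq_card sub) _; rewrite cards2; case: (_ != _).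
have step u v : u \in [set x; y] -> adj P u v -> v \in [set x; y].
  rewrite !inE => uxy; case/or4P=> uv.
  - by have := matching_edge bip m1 uv xy1; case/orP: uxy => /eqP->;
    rewrite /= !eqxx ?orbT => /(_ isT)/(congr1 snd)/= ->; rewrite eqxx orbT.
  - by have := matching_edge bip m2 uv xy2; case/orP: uxy => /eqP->;
    rewrite /= !eqxx ?orbT => /(_ isT)/(congr1 snd)/= ->; rewrite eqxx orbT.
  - by have := matching_edge bip m1 uv xy1; case/orP: uxy => /eqP->;
    rewrite /= !eqxx ?orbT => /(_ isT)/(congr1 fst)/= ->; rewrite eqxx.
  - by have := matching_edge bip m2 uv xy2; case/orP: uxy => /eqP->;
    rewrite /= !eqxx ?orbT => /(_ isT)/(congr1 fst)/= ->; rewrite eqxx.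
apply/subsetP=> z; rewrite inE => /connectP[p].
have : x \in [set x; y] by rewrite !inE eqxx.
move: {1 3 4}x => u; elim: p u => [|w p IH] u uxy /= => [_ -> //|/andP[uw wp]].
exact: IH (step _ _ uxy uw) wp.
Qed.

(** An edge lying in both matchings fills its component, which is then too small for a loop. The
    edge found here reveals whether the loop has been exchanged; this makes [swap_loops_inj]
    true. *)
Lemma loop_edge C : C \in loops S m ->
  exists e, [/\ e \in P.1, e \notin P.2 & e.1 \in C].
Proof.
rewrite inE => /and3P[CC /forall_inP CS C2].
have [v vC] : exists v, v \in C by apply/set0Pn; rewrite -card_gt0; apply: leq_trans C2.
have CE := component_eq CC vC.
suff [x [y [xy1 xC]]] : exists x y, (x, y) \in P.1 /\ x \in C.
  exists (x, y); split=> //; apply: contraL C2 => xy2.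
  by rewrite -leqNgt (doubled_component xy1 xy2 CC).
have /(coveredP _ m1)[y /orP[]vy] : v \in covered P.1.
- by rewrite c1; apply: contra (CS v vC); apply/subsetP.
- by exists v, y.
- by exists y, v; rewrite CE inE connect1 // /adj vy !orbT.
Qed.

(** Away from the nodes [v] has an edge in each matching. If these edges differ, so do their other
    ends, which gives three vertices. *)
Lemma component_loop v : (v \notin S) ->
    (forall e, e \in P.1 -> (e.1 == v) || (e.2 == v) -> e \notin P.2) ->
    (forall w, connect (adj P) v w -> w \notin S) ->
  [set y | connect (adj P) v y] \in loops S m.
Proof.
move=> vS single nodeless; rewrite inE componentsE imset_f //=.
apply/andP; split; first by apply/forall_inP=> w; rewrite inE; apply: nodeless.
have v1 : v \in covered P.1 by rewrite c1; apply: contra vS; apply/subsetP.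
have v2 : v \in covered P.2 by rewrite c2 inE (negPf vS) andbF.
have [s1 _] := matchingP _ _ m1; have [s2 _] := matchingP _ _ m2.
have [y vy] := coveredP _ m1 v1; have [z vz] := coveredP _ m2 v2.
have ay : adj P v y by move: vy; rewrite /adj => /orP[] ->; rewrite ?orbT.
have az : adj P v z by move: vz; rewrite /adj => /orP[] ->; rewrite ?orbT.
have ne u w : (u, w) \in E -> u != w.
  by move=> /bip[/= bu bw]; apply: contraNneq bw => <-.
have neE u : adj P v u -> u != v.
  by case/or4P=> [/s1|/s2|/s1|/s2]/ne; rewrite // eq_sym.
have yz : y != z.
  apply/eqP=> yz; subst z; case/orP: vy => vy; have := single _ vy;
    rewrite /= eqxx ?orbT => /(_ isT);
  case/orP: vz => vz; rewrite ?vz //.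
    by have := black_edge bip (s1 _ vy); rewrite (negPf (white_edge bip (s2 _ vz))).
  by have := black_edge bip (s2 _ vz); rewrite (negPf (white_edge bip (s1 _ vy))).
have <- : #|[set v; y; z]| = 3%N.
  by rewrite -setUA !cardsU1 cards1 !inE (eq_sym v y) (eq_sym v z) (negPf (neE _ ay)) (negPf
    (neE _ az)) yz.
apply/subset_leq_card/subsetP=> u; rewrite !inE => /orP[/orP[]|] /eqP->;
  by rewrite ?connect0 // connect1.
Qed.

Lemma swap_cover_mem (L : {set {set V}}) C e : L \subset components m -> C \in components m ->
  e.1 \in C -> (e \in (swap (cover L) P).1) = if C \in L then e \in P.2 else e \in P.1.
Proof.
move=> LC CC eC; rewrite mem_swap1; suff -> : (e.1 \in cover L) = (C \in L) by [].
apply/bigcupP/idP=> [[C' C'L eC']|CL]; last by exists C.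
by rewrite (component_eq CC eC) -(component_eq (subsetP LC _ C'L) eC').
Qed.

Lemma loops_sub_components : loops S m \subset components m.
Proof. by apply/subsetP=> C; rewrite inE => /andP[]. Qed.

Lemma swap_loops_decomposition (L : {set {set V}}) : L \subset loops S m ->
  swap (cover L) P \in decompositions S A m.
Proof.
move=> LL; have LC := subset_trans LL loops_sub_components.
have Uc := cover_components_closed LC.
have US v : v \in cover L -> v \notin S.
  case/bigcupP=> C /(subsetP LL); rewrite inE => /and3P[_ /forall_inP CS _]; exact: CS.
rewrite inE; apply/and4P; split; first exact: swap_matchings.
- apply/eqP/setP=> v; rewrite (swap_covered1 v mP Uc) in_setC.
  case: ifP => [/US vS|_]; last exact: c1.
  by rewrite c2 in_setD (negPf vS) andbF (contraNN (subsetP AS v)).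
- apply/eqP/setP=> v; rewrite (swap_covered2 v mP Uc) in_setC.
  case: ifP => [/US vS|_]; last exact: c2.
  by rewrite c1 in_setD (negPf vS) andbF (contraNN (subsetP AS v)).
- by rewrite -Pm; apply/eqP/ffunP=> e; apply: ord_inj; rewrite !edge_multE swap_sum.
Qed.

Lemma swap_loops_inj : {in powerset (loops S m) &, injective (fun L => swap (cover L) P)}.
Proof.
have sub (L L' : {set {set V}}) : L \subset loops S m -> L' \subset loops S m ->
    swap (cover L) P = swap (cover L') P -> L \subset L'.
  move=> LL LL' eqL; apply/subsetP=> C CL; have Cl := subsetP LL _ CL.
  have [e [e1 e2 eC]] := loop_edge Cl; have CC := subsetP loops_sub_components _ Cl.
  have LC := subset_trans LL loops_sub_components.
  have LC' := subset_trans LL' loops_sub_components.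
  apply/idPn => CL'; have := swap_cover_mem LC CC eC.
  by rewrite eqL (swap_cover_mem LC' CC eC) CL (negPf CL') e1 (negPf e2).
move=> L L'; rewrite !powersetE => LL LL' eqL; apply/eqP; rewrite eqEsubset.
by apply/andP; split; apply: sub.
Qed.

Section OtherDecomposition.
Variables (Q : {set V * V} * {set V * V}).
Hypothesis Qd : Q \in decompositions S A m.

Let agree v := [forall e, ((e.1 == v) || (e.2 == v)) ==> ((e \in Q.1) == (e \in P.1))].

Let mQ : matchings E Q. Proof. by move: Qd; rewrite inE => /and4P[]. Qed.
Let q1 : matching E Q.1. Proof. by case/andP: mQ. Qed.
Let q2 : matching E Q.2. Proof. by case/andP: mQ. Qed.

Let sumQ e : ((e \in Q.1) + (e \in Q.2) = (e \in P.1) + (e \in P.2))%N.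
Proof.
rewrite -!edge_multE; move: Qd Pd; rewrite !inE => /and4P[_ _ _ /eqP->].
by case/and4P=> _ _ _ /eqP->.
Qed.

Let same_end M e e' v : matching E M -> e \in M -> (e.1 == v) || (e.2 == v) ->
  (e'.1 == v) || (e'.2 == v) -> (e' \in M) = (e' == e).
Proof.
move=> mM eM ev e'v; apply/idP/eqP=> [e'M|-> //]; apply: (matching_edge bip mM e'M eM).
by case/orP: ev => /eqP->; case/orP: e'v => /eqP->; rewrite eqxx ?orbT.
Qed.

Let agree1 e v : e \in Q.1 -> e \in P.1 -> (e.1 == v) || (e.2 == v) -> agree v.
Proof.
move=> eQ eP ev; apply/forallP=> e'; apply/implyP=> e'v.
by rewrite (same_end q1 eQ ev e'v) (same_end m1 eP ev e'v).
Qed.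

Let agree2 e v : e \in Q.2 -> e \in P.2 -> (e.1 == v) || (e.2 == v) -> agree v.
Proof.
move=> eQ eP ev; apply/forallP=> e'; apply/implyP=> e'v.
have := sumQ e'; rewrite (same_end q2 eQ ev e'v) (same_end m2 eP ev e'v).
by move/addIn; case: (_ \in _); case: (_ \in _).
Qed.

Let agree_adj v w : adj P v w -> agree v -> agree w.
Proof.
move=> vw av.
have [e eP [ev ew]] : exists2 e, (e \in P.1) || (e \in P.2) &
    ((e.1 == v) || (e.2 == v)) /\ ((e.1 == w) || (e.2 == w)).
  by case/or4P: vw => h; [exists (v, w)|exists (v, w)|exists (w, v)|exists (w, v)];
    rewrite /= ?h ?eqxx ?orbT.
have := forallP av e; rewrite ev /= => /eqP eQ.
case: (boolP (e \in P.1)) eP eQ => [e1 _ eQ|e1 /= e2 eQ]; first exact: (agree1 eQ e1).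
by apply: (agree2 _ e2 ew); have := sumQ e; rewrite eQ (negPf e1) e2 => /eqP; case: (_ \in _).
Qed.

Let agree_closed v w : adj P v w -> agree v = agree w.
Proof.
move=> vw; have wv : adj P w v by rewrite adj_succ orbC -adj_succ.
by apply/idP/idP; apply: agree_adj.
Qed.

Let agree_node v : v \in S -> agree v.
Proof.
move=> vS; move: Qd; rewrite inE => /and4P[_ /eqP Q1 /eqP Q2 _].
have [vA|vA] := boolP (v \in A).
  have : v \in covered Q.2 by rewrite Q2 !inE vA.
  rewrite inE => /exists_inP[e eQ ev]; apply: (agree2 eQ _ ev).
  have : v \notin covered P.1 by rewrite c1 vA.
  apply: contraR => e2; rewrite inE; apply/exists_inP; exists e => //.
  by have := sumQ e; rewrite eQ (negPf e2); case: (_ \in _); case: (_ \in _).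
have : v \in covered Q.1 by rewrite Q1 !inE vA.
rewrite inE => /exists_inP[e eQ ev]; apply: (agree1 eQ _ ev).
have : v \notin covered P.2 by rewrite c2 !inE vA vS.
apply: contraR => e2; rewrite inE; apply/exists_inP; exists e => //.
by have := sumQ e; rewrite eQ (negPf e2); case: (_ \in _); case: (_ \in _).
Qed.

(** Agreement of [Q] with [P] at a vertex propagates along edges, and it holds at a node, where the
    only edge is assigned by [A]. The vertices of disagreement therefore form components without
    nodes, and not doubled edges: these are loops, on which the matchings are exchanged. *)
Lemma decomposition_swap_loops :
  exists2 L : {set {set V}}, L \subset loops S m & Q = swap (cover L) P.
Proof.
pose U := [set v | ~~ agree v].
pose L := [set C in loops S m | C \subset U].
have LL : L \subset loops S m by apply/subsetP=> C; rewrite inE => /andP[].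
have conn v w : connect (adj P) v w -> agree v = agree w.
  case/connectP=> p; elim: p v => [|z p IH] v /=; first by move=> _ ->.
  by move=> /andP[/agree_closed-> /IH] h /h.
have UL : cover L = U.
  apply/setP=> v; apply/bigcupP/idP=> [[C]|vU].
    by rewrite inE => /andP[_ /subsetP h] /h.
  have nv : ~~ agree v by rewrite inE in vU.
  exists [set y | connect (adj P) v y]; last by rewrite inE connect0.
  rewrite inE; apply/andP; split; last first.
    by apply/subsetP=> w; rewrite !inE => /conn<-.
  apply: component_loop.
  - by apply: contra nv; apply: agree_node.
  - move=> e e1 ev; apply: contra nv => e2; apply: (@agree1 e _ _ e1 ev).
    by have := sumQ e; rewrite e1 e2; case: (_ \in _); case: (_ \in _).
  - by move=> w vw; apply: contra nv => /agree_node; rewrite (conn _ _ vw).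
exists L => //; rewrite UL.
have eqs e : (e \in Q.1) = (e \in (swap U P).1) /\ (e \in Q.2) = (e \in (swap U P).2).
  rewrite mem_swap1 mem_swap2 inE; have := sumQ e.
  case: (boolP (agree e.1)) => /= [/forallP/(_ e)|ne].
    by rewrite eqxx /= => /eqP->; case: (_ \in P.1); case: (_ \in P.2); case: (_ \in Q.2).
  have n1 : ~~ ((e \in Q.1) && (e \in P.1)).
    by apply: contra ne => /andP[h1 h2]; apply: agree1 h1 h2 _; rewrite eqxx.
  have n2 : ~~ ((e \in Q.2) && (e \in P.2)).
    by apply: contra ne => /andP[h1 h2]; apply: agree2 h1 h2 _; rewrite eqxx.
  by move: n1 n2; do 4!case: (e \in _).
rewrite [Q]surjective_pairing [swap U P]surjective_pairing; congr pair; apply/setP=> e.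
  by case: (eqs e).
by case: (eqs e).
Qed.

End OtherDecomposition.

Lemma card_decompositions_of : #|decompositions S A m| = (2 ^ #|loops S m|)%N.
Proof.
rewrite -card_powerset -(card_in_imset swap_loops_inj); congr #|pred_of_set _|.
apply/setP=> Q; apply/idP/imsetP=> [/decomposition_swap_loops[L LL ->]|[L]].
  by exists L; rewrite ?powersetE.
by rewrite powersetE => LL ->; apply: swap_loops_decomposition.
Qed.

End Fibre.

Lemma card_decompositions S A m : A \subset S ->
  #|decompositions S A m| = if dd_config S m && compatible S A m then (2 ^ #|loops S m|)%N else
    0%N.
Proof.
move=> AS; case: ifP => [/andP[mS mA]|no].
  by have [P Pd] := decomposition_exists AS mS mA; apply: card_decompositions_of Pd.
apply/eqP; rewrite cards_eq0; apply/eqP/setP=> P; rewrite in_set0; apply: contraFF no => Pd.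
by rewrite (decomp_dd_config AS Pd) (decomp_compatible Pd).
Qed.

Definition config_weight (R : numFieldType) (wt : V * V -> R) S m : R :=
  (\prod_(e in E) wt e ^+ m e) * 2 ^+ #|loops S m|.

(** Pairs of matchings are grouped by the multigraph that they form; the size of a fibre is the
    power of 2 in the weight. *)
Lemma superposition (R : numFieldType) (wt : V * V -> R) S A : A \subset S ->
  ZD E wt (~: A) * ZD E wt (~: (S :\: A)) =
  \sum_(m | dd_config S m && compatible S A m) config_weight wt S m.
Proof.
move=> AS; rewrite /ZD big_distrlr /= pair_big /=.
rewrite (partition_big (@edge_mult V) xpredT) //= [RHS]big_mkcond; apply: eq_bigr => m _.
transitivity (\sum_(P in decompositions S A m) \prod_(e in E) wt e ^+ m e).
  apply: eq_big => [P|P /andP[/andP[]]].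
    by rewrite inE /matchings !(perfect_matchingE bip) -!andbA; do !bool_congr.
  rewrite !(perfect_matchingE bip) => /andP[/matchingP[s1 _] _] /andP[/matchingP[s2 _] _] /eqP <-.
  have prodE M : {subset M <= E} -> \prod_(e in M) wt e = \prod_(e in E) wt e ^+ (e \in M).
    move=> sM; rewrite big_mkcond [RHS]big_mkcond; apply: eq_bigr => e _.
    by case: (boolP (e \in M)) => [/sM->|_]; case: (e \in E).
  rewrite (prodE _ s1) (prodE _ s2) -big_split; apply: eq_bigr => e _ /=.
  by rewrite edge_multE exprD.
rewrite big_const iter_addr addr0 (card_decompositions _ AS) /config_weight.
case: ifP => _; last by rewrite mulr0n.
by rewrite -natrX mulr_natr.
Qed.

End CountDecompositions.

(** * Condensation *)

Section NoncrossingPairings.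
Variable N : nat.
Implicit Types (T K : {set 'I_N}) (p : 'I_N -> 'I_N) (i j : 'I_N).

Definition pairing_on T p := forall i, i \in T -> [/\ p i \in T, p i != i & p (p i) = i].

Definition noncrossing_on T p := forall a b, a \in T -> b \in T ->
  (a < b)%N -> (b < p a)%N -> (p a < p b)%N -> False.

Definition pos T i := #|[set j in T | (j < i)%N]|.

Lemma pairing_card_even K p : pairing_on K p -> ~~ odd #|K|.
Proof.
move=> pK; pose up := [set i in K | (i < p i)%N].
have -> : #|K| = (#|up| + #|p @: up|)%N.
  rewrite -cardsUI [X in (_ + X)%N](_ : _ = 0%N) ?addn0; last first.
    apply/eqP; rewrite cards_eq0; apply/eqP/setP=> i; rewrite !inE.
    apply/negP=> /andP[/andP[_ ip] /imsetP[j]]; rewrite inE => /andP[jK jp] ij.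
    by move: ip; rewrite ij; case: (pK _ jK) => _ _ ->; lia.
  congr #|pred_of_set _|; apply/setP=> i; rewrite !inE.
  apply/idP/orP=> [iK|[/andP[]//|/imsetP[j]]]; last first.
    by rewrite inE => /andP[/pK[]] ? _ _ _ ->.
  rewrite iK; have [pi ne pp] := pK _ iK; case: (ltngtP i (p i)) => h; first by left.
    by right; apply/imsetP; exists (p i); rewrite ?pp // inE pi pp.
  by case/eqP: ne; apply: ord_inj.
rewrite card_in_imset ?addnn ?odd_double // => i j; rewrite !inE => /andP[iK _] /andP[jK _] ij.
by case: (pK _ iK) => _ _ <-; case: (pK _ jK) => _ _ <-; rewrite ij.
Qed.

Lemma pos_between T i j : i \in T -> (i < j)%N ->
  pos T j = (pos T i + #|[set k in T | (i < k < j)%N]|).+1.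
Proof.
move=> iT ij; rewrite /pos (cardsD1 i) inE iT ij add1n; congr _.+1.
rewrite -(cardsID [set k : 'I_N | (k < i)%N]); congr (_ + _)%N; congr #|pred_of_set _|;
  apply/setP=> k; rewrite !inE -val_eqE /=; case: (k \in T); rewrite ?andbF //=; lia.
Qed.

Lemma between_closed T p k j : pairing_on T p -> noncrossing_on T p -> k \in T -> j \in T ->
  (k < j < p k)%N -> (k < p j < p k)%N.
Proof.
move=> pT nc kT jT /andP[kj jp]; have [pkT kne ppk] := pT _ kT; have [pjT ne pp] := pT _ jT.
apply/andP; split.
  rewrite ltnNge leq_eqVlt; apply/norP; split.
    by apply/eqP => /ord_inj e; move: jp; rewrite -e pp ltnn.
  by apply/negP=> pjk; apply: (nc (p j) k); rewrite ?pp.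
rewrite ltnNge leq_eqVlt; apply/norP; split.
  by apply/eqP => /ord_inj e; move: kj; rewrite -pp -e ppk ltnn.
by apply/negP=> pjk; apply: (nc k j).
Qed.

(** The elements of [T] strictly between the two ends of a pair are paired among themselves, so
    their number is even. *)
Lemma noncrossing_odd_even T p i : pairing_on T p -> noncrossing_on T p -> i \in T ->
  odd (pos T (p i)) = ~~ odd (pos T i).
Proof.
move=> pT nc; suff up k : k \in T -> (k < p k)%N -> odd (pos T (p k)) = ~~ odd (pos T k).
  move=> iT; have [piT ne pp] := pT _ iT; case: (ltngtP i (p i)) => h; first exact: up.
    by have := up _ piT; rewrite pp => /(_ h) ->; rewrite negbK.
  by case/eqP: ne; apply: ord_inj.
move=> kT kp; rewrite (pos_between kT kp) /= oddD.
suff /negPf-> : ~~ odd #|[set j in T | (k < j < p k)%N]| by rewrite addbF.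
apply: (@pairing_card_even _ p) => j; rewrite inE => /and3P[jT kj jp].
have [pjT ne pp] := pT _ jT; split=> //; rewrite inE pjT /=.
by apply: (between_closed pT nc kT jT); rewrite kj.
Qed.

End NoncrossingPairings.

(** * The noncrossing pairing of the nodes given by a configuration *)

Section ConfigPairing.
Variables (V : finType) (black : pred V) (E : {set V * V}) (n : nat) (node : 'I_(n.*2) -> V).
Hypothesis bip : bipartite_edges black E.
Hypothesis node_inj : injective node.
Hypothesis planar : planar_nodes_on_outer_face E node.
Variables (T : {set 'I_(n.*2)}) (m : {ffun V * V -> 'I_3}).
Hypothesis mT : dd_config E (node @: T) m.

Definition partner i := odflt i
  [pick j in T | (j != i) && connect (dd_rel m) (node i) (node j)].

Lemma dd_relC : connect_sym (dd_rel m).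
Proof. by apply: sym_connect_sym => x y; rewrite /dd_rel orbC. Qed.

(** Whether a node starts or ends its path, read off one chosen decomposition. With only two types,
    a component cannot contain three nodes. *)
Let typ := let P := sval (sigW (dd_decompose_config bip mT)) in
  fun x => (x \in node @: T :\: covered P.1) (+) black x.

Lemma two_types x y : x \in node @: T -> y \in node @: T -> x != y ->
  connect (dd_rel m) x y -> typ x != typ y.
Proof.
rewrite /typ; case: sigW => P Pd /= xT yT xy cxy; have := decomp_compatible bip Pd.
by move/forall_inP/(_ _ xT)/forall_inP/(_ _ yT); rewrite xy cxy.
Qed.

(** A path is followed from its start to its end; when [x] is the end, the two matchings change
    roles and the orientation is reversed. *)
Lemma other_end x : x \in node @: T -> exists y,
  [/\ y \in node @: T, y != x & connect (dd_rel m) x y].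
Proof.
move=> xT; have [P Pd] := dd_decompose_config bip mT.
set A := _ :\: _ in Pd; have AT : A \subset node @: T by apply: subsetDl.
clearbody A; have := Pd; rewrite inE => /and4P[mP /eqP c1 /eqP c2 /eqP Pm].
have out y : y \notin node @: T -> y \in covered P.1 /\ y \in covered P.2.
  by move=> yT; rewrite c1 c2 !inE (negPf yT) andbF (contraNN (subsetP AT y)).
have st := decomp_start black Pd; have sp := decomp_stop black Pd.
have [sx|] := boolP (x \notin covered (if black x then P.2 else P.1)).
  have [y xy sy] := no_succ_exists bip mP sx.
  have yT : y \in node @: T by apply: contraR sy => /out[]; case: ifP.
  exists y; split; rewrite -?Pm ?connect_mult //.
  by apply: contraL sx => /eqP<-; rewrite (st _ yT) -(sp _ yT).
rewrite (st _ xT) -(sp _ xT) => sx.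
have [y xy sy] := no_succ_exists bip (matchings_sym mP) (x := x) sx.
have yT : y \in node @: T by apply: contraR sy => /out[]; case: ifP.
exists y; split=> //.
  by apply: contraL sx => /eqP<-; rewrite (sp _ yT) negbK -(st _ yT).
rewrite -Pm connect_mult; rewrite (eq_connect (e' := adj P)) // in xy => u v.
by rewrite /adj /=; do 4!case: (_ \in _).
Qed.

Lemma partnerP i : i \in T ->
  [/\ partner i \in T, partner i != i & connect (dd_rel m) (node i) (node (partner i))].
Proof.
move=> iT; rewrite /partner; case: pickP => [j /and3P[]//|no].
have [_ [/imsetP[j jT ->] ji ij]] := other_end (imset_f node iT).
by have := no j; rewrite jT ij -(inj_eq node_inj) ji.
Qed.

Lemma partner_unique i j : i \in T -> j \in T -> j != i ->
  connect (dd_rel m) (node i) (node j) -> partner i = j.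
Proof.
move=> iT jT ji ij; have [pT pi ip] := partnerP iT; apply/eqP; apply: contraT => pj.
have pjc : connect (dd_rel m) (node (partner i)) (node j).
  by apply: connect_trans ij; rewrite dd_relC.
have := two_types (imset_f node pT) (imset_f node jT); rewrite (inj_eq node_inj) => /(_ pj pjc).
have := two_types (imset_f node iT) (imset_f node jT);
  rewrite (inj_eq node_inj) eq_sym => /(_ ji ij).
have := two_types (imset_f node iT) (imset_f node pT);
  rewrite (inj_eq node_inj) eq_sym => /(_ pi ip).
by do 3!case: (typ _).
Qed.

Lemma partner_pairing : pairing_on T partner.
Proof.
move=> i iT; have [pT pi ip] := partnerP iT; split=> //.
by apply: partner_unique; rewrite // 1?eq_sym // dd_relC.
Qed.

Lemma partner_noncrossing : noncrossing_on T partner.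
Proof.
move=> a b aT bT ab bpa papb; have [pa ane ac] := partnerP aT; have [pb bne bd] := partnerP bT.
have [D [tail [alpha [sigma [rot g0]]]]] := planar.
have eE x y : dd_rel m x y -> (x, y) \in E \/ (y, x) \in E.
  case/andP: mT => /forallP mE _; rewrite /dd_rel.
  by case/orP=> h; [left|right]; apply: contraLR h => /(implyP (mE _))/eqP->.
have := disjoint_connected_noncrossing rot g0 node_inj eE dd_relC ab bpa papb ac bd.
have ba : b != a by apply: contraTneq ab => ->; rewrite ltnn.
move/(partner_unique aT bT ba) => e.
by move: bpa; rewrite e ltnn.
Qed.

Lemma compatible_partner (A : {set 'I_(n.*2)}) :
  compatible black (node @: T) (node @: A) m =
  [forall i in T, (i \in A) (+) black (node i) != (partner i \in A) (+) black (node (partner i))].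
Proof.
apply/forall_inP/forall_inP=> [comp i iT|comp _ /imsetP[i iT ->]].
  have [pT pi ip] := partnerP iT.
  have /forall_inP/(_ _ (imset_f node pT)) := comp _ (imset_f node iT).
  by rewrite (inj_eq node_inj) eq_sym pi ip /= !(mem_imset _ _ node_inj).
apply/forall_inP=> _ /imsetP[j jT ->]; apply/implyP;
  rewrite (inj_eq node_inj) eq_sym => /andP[ji ij].
by rewrite !(mem_imset _ _ node_inj) -(partner_unique iT jT ji ij); apply: comp.
Qed.

End ConfigPairing.

(** * The condensation formula for deleted nodes *)

Lemma signr_eq (R : pzRingType) a b : odd a = odd b -> (-1) ^+ a = (-1) ^+ b :> R.
Proof. by move=> e; rewrite -signr_odd e signr_odd. Qed.

(** If [p b] is white, compatibility of the pair of [b] leaves only [w = p b], with sign +1 because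
    the two positions have opposite parity. If [p b] is black, a compatible [w] must have a white
    partner, and [w] and [p w] contribute with opposite signs. *)
Lemma condensation_coefficient (R : numFieldType) N (T : {set 'I_N}) p (c : pred 'I_N) b :
  pairing_on T p -> noncrossing_on T p -> b \in T -> c b ->
  \sum_(w in T | ~~ c w) (-1) ^+ (pos T b + pos T w).+1 *
     [forall i in T, (i \in [set b; w]) (+) c i != (p i \in [set b; w]) (+) c (p i)]%:R
  = [forall i in T, c i != c (p i)]%:R :> R.
Proof.
move=> pT nc bT cb; have [pbT pbne ppb] := pT _ bT.
have par i : i \in T -> odd (pos T (p i)) = ~~ odd (pos T i) := noncrossing_odd_even pT nc.
have [cpb|cpb] := boolP (c (p b)); last first.
  rewrite (bigD1 (p b)) ?pbT //= big1 => [|w /andP[/andP[wT cw] wpb]]; last first.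
    rewrite (_ : [forall i in T, _] = false) ?mulr0 //; apply/negP=> /forall_inP/(_ _ bT).
    by rewrite !inE eqxx (negPf pbne) [p b == w]eq_sym (negPf wpb) cb (negPf cpb).
  rewrite addr0 -signr_odd /= oddD par // addbN addbb expr0 mul1r.
  congr (_%:R : R); congr nat_of_bool; apply: eq_forallb_in => i iT.
  have [piT pine ppi] := pT _ iT.
  have -> : (p i \in [set b; p b]) = (i \in [set b; p b]).
    rewrite !inE orbC; congr (_ || _); apply/eqP/eqP => [e|-> //].
      by rewrite -ppi e.
    by rewrite -ppi e.
  by case: (i \in _); case: (c i); case: (c (p i)).
have -> : [forall i in T, c i != c (p i)] = false.
  by apply/negP=> /forall_inP/(_ _ bT); rewrite cb cpb.
pose comp w := [forall i in T, (i \in [set b; w]) (+) c i != (p i \in [set b; w]) (+) c (p i)].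
(* Extension by 0 to the black labels, so that [p] permutes the index set of the sum. *)
pose F w : R := if c w then 0 else (-1) ^+ (pos T b + pos T w).+1 * (comp w)%:R.
have -> : \sum_(w in T | ~~ c w) (-1) ^+ (pos T b + pos T w).+1 * (comp w)%:R = \sum_(w in T) F w.
  by rewrite big_mkcondr; apply: eq_bigr => w _; rewrite /F; case: (c w).
have Fp w : w \in T -> F (p w) = - F w.
  move=> wT; have [pwT pwne ppw] := pT _ wT; rewrite /F.
  case: (boolP (c w)) (boolP (c (p w))) => cw [] cpw; rewrite ?oppr0 //.
  - have wb : (w == b) = false by apply: contraNF cpw => /eqP->.
    rewrite (_ : comp _ = false) ?mulr0 //; apply/negP=> /forall_inP/(_ _ wT).
    by rewrite !inE wb [w == p w]eq_sym (negPf pwne) eqxx orbT cw (negPf cpw).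
  - have pwb : (p w == b) = false.
      by apply: contraNF cw => /eqP pwb; rewrite -ppw pwb.
    rewrite (_ : comp _ = false) ?mulr0 ?oppr0 //; apply/negP=> /forall_inP/(_ _ wT).
    by rewrite !inE pwb (negPf pwne) eqxx orbT cpw (negPf cw).
  have wb : (w == b) = false by apply: contraNF cw => /eqP->.
  have pwb : (p w == b) = false by apply: contraNF cpw => /eqP->.
  have -> : comp (p w) = comp w.
    apply: eq_forallb_in => i iT; rewrite !inE.
    have [piT pine ppi] := pT _ iT.
    have [->|iw] := eqVneq i w.
      by rewrite !eqxx wb pwb [w == p w]eq_sym (negPf pwne) (negPf cw) (negPf cpw).
    have [->|ipw] := eqVneq i (p w).
      by rewrite ppw !eqxx wb pwb [w == p w]eq_sym (negPf pwne) (negPf cw) (negPf cpw).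
    have -> : (p i == p w) = false.
      by apply: contraNF iw => /eqP e; rewrite -ppi e ppw.
    have -> // : (p i == w) = false.
    by apply: contraNF ipw => /eqP e; rewrite -ppi e.
  rewrite -mulNr [in RHS]exprS mulN1r opprK; congr (_ * _); apply: signr_eq.
  by rewrite /= !oddD par //; case: (odd _); case: (odd _).
apply/eqP; rewrite -eqNr -sumrN; apply/eqP.
rewrite [RHS](reindex_onto p p) /=; last by move=> i /pT[].
apply: eq_big => [i|i iT]; last by rewrite Fp.
apply/idP/andP=> [/pT[-> _ ->]|[piT /eqP ppi]]; first by rewrite eqxx.
by rewrite -ppi; case: (pT _ piT).
Qed.

Section Condensation.
Variables (R : numFieldType) (V : finType) (black : pred V) (E : {set V * V}) (wt : V * V -> R).
Variables (n : nat) (node : 'I_(n.*2) -> V).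
Hypothesis bip : bipartite_edges black E.
Hypothesis node_inj : injective node.
Hypothesis planar : planar_nodes_on_outer_face E node.

Definition ZDdel (T : {set 'I_(n.*2)}) : R := ZD E wt (~: (node @: T)).

Lemma node_superposition (T A : {set 'I_(n.*2)}) : A \subset T ->
  ZDdel A * ZDdel (T :\: A) = \sum_(m | dd_config E (node @: T) m)
    config_weight E wt (node @: T) m * (compatible black (node @: T) (node @: A) m)%:R.
Proof.
move=> AT; rewrite /ZDdel.
have -> : node @: (T :\: A) = node @: T :\: node @: A.
  apply/setP=> v; rewrite inE; apply/imsetP/andP=> [[i]|[vA /imsetP[i iT vi]]].
    by rewrite inE => /andP[iA iT] ->; rewrite !(mem_imset _ _ node_inj).
  by exists i => //; rewrite inE iT andbT; apply: contra vA => iA; rewrite vi imset_f.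
rewrite (superposition bip) ?imsetS // big_mkcondr; apply: eq_bigr => m _.
by case: ifP; rewrite ?mulr1 ?mulr0.
Qed.

(** By superposition each product is a sum over the same configurations with node set [T]; the
    coefficients of one configuration are compared through its pairing. *)
Lemma condensation (T : {set 'I_(n.*2)}) b : b \in T -> black (node b) ->
  ZDdel T * ZDdel set0 = \sum_(w in T | ~~ black (node w))
    (-1) ^+ (pos T b + pos T w).+1 * (ZDdel [set b; w] * ZDdel (T :\: [set b; w])).
Proof.
move=> bT bb; rewrite -(setDv T) node_superposition //.
have sub w : w \in T -> [set b; w] \subset T.
  by move=> wT; apply/subsetP=> i; rewrite !inE => /orP[]/eqP->.
under [RHS]eq_bigr => w /andP[wT _] do rewrite (node_superposition (sub _ wT)) mulr_sumr.
rewrite [RHS]exchange_big /=; apply: eq_bigr => m mT.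
under [RHS]eq_bigr => w _ do rewrite mulrCA (compatible_partner bip node_inj mT).
rewrite -mulr_sumr; congr (_ * _).
rewrite (condensation_coefficient _ (c := fun i => black (node i))
  (partner_pairing bip node_inj mT) (partner_noncrossing bip node_inj planar mT)) //.
congr (_%:R : R); congr nat_of_bool; rewrite (compatible_partner bip node_inj mT).
apply: eq_forallb_in => i iT; have [-> _ _] := partner_pairing bip node_inj mT iT; rewrite iT.
by case: (black _); case: (black _).
Qed.
End Condensation.

(** * Masked determinants *)

Section IncreasingLabels.
Variable N : nat.

Definition increasing k (f : 'I_k -> 'I_N) := forall i j : 'I_k, (i < j)%N -> (f i < f j)%N.

Lemma increasing_inj k (f : 'I_k -> 'I_N) : increasing f -> injective f.
Proof.
move=> fI i j fij; apply: ord_inj; case: (ltngtP i j) => // /fI; rewrite fij ltnn //.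
Qed.

Lemma increasing_lt k (f : 'I_k -> 'I_N) i j : increasing f -> (f i < f j)%N = (i < j)%N.
Proof.
move=> fI; case: (ltngtP i j) => [/fI-> //|/fI h|/ord_inj->]; last exact: ltnn.
by apply/negbTE; rewrite -leqNgt ltnW.
Qed.

Lemma increasing_lift k (f : 'I_k.+1 -> 'I_N) (h : 'I_k.+1) : increasing f ->
  increasing (fun i : 'I_k => f (lift h i)).
Proof. by move=> fI i j ij; apply: fI; rewrite /= ltnNge leq_bump2 -ltnNge. Qed.

Definition crossings k (f g : 'I_k -> 'I_N) := (\sum_i \sum_j (g j < f i)%N)%N.

Definition labels k (f g : 'I_k -> 'I_N) : {set 'I_N} := [set f i | i : 'I_k] :|: [set g i | i :
  'I_k].

Lemma sum_labels k (f g : 'I_k -> 'I_N) (F : 'I_N -> nat) : injective f -> injective g ->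
  (forall i j, f i != g j) ->
  (\sum_(a in labels f g) F a = \sum_i F (f i) + \sum_i F (g i))%N.
Proof.
move=> fI gI fg.
rewrite (eq_bigl [predU [set f i | i : 'I_k] & [set g i | i : 'I_k]]) => [|a];
  last by rewrite !inE.
rewrite bigU /=; last first.
  apply/pred0P=> a /=; apply/andP=> -[/imsetP[i _ ->] /imsetP[j _ /eqP]].
  by rewrite (negPf (fg i j)).
rewrite !big_imset /=; try by move=> ? ? _ _; auto.
by congr (_ + _)%N; apply: eq_bigr.
Qed.

Lemma pos_labels k (f g : 'I_k -> 'I_N) x : injective f -> injective g ->
  (forall i j, f i != g j) ->
  (pos (labels f g) x = \sum_i (f i < x)%N + \sum_i (g i < x)%N)%N.
Proof.
move=> fI gI fg; rewrite -(sum_labels (fun a => (a < x)%N : nat)) // /pos -sum1_card.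
rewrite (eq_bigl (fun a => (a \in labels f g) && (a < x)%N)) => [|a]; last by rewrite !inE.
by rewrite big_mkcondr.
Qed.

Lemma sum_ord_lt k (j : 'I_k) : (\sum_(i < k) (i < j)%N = j)%N.
Proof.
transitivity (\sum_(i < j) 1)%N; last by rewrite sum_nat_const card_ord muln1.
by rewrite (big_ord_widen k (fun=> 1%N)) ?[RHS]big_mkcond // ltnW.
Qed.

Lemma labels_lift k (f g : 'I_k.+1 -> 'I_N) i j : injective f -> injective g ->
  (forall i j, f i != g j) ->
  labels f g :\: [set f i; g j] =
    labels (fun i' : 'I_k => f (lift i i')) (fun j' : 'I_k => g (lift j j')).
Proof.
move=> fI gI fg; apply/setP=> x; rewrite !inE; apply/andP/orP=> [[/norP[xi xj]]|].
  case/orP=> /imsetP[l _ xl]; [left|right]; apply/imsetP; rewrite {x}xl in xi xj *.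
    by case: (unliftP i l) xi => [l' ->|->]; [exists l'|rewrite eqxx].
  by case: (unliftP j l) xj => [l' ->|->]; [exists l'|rewrite eqxx].
case=> /imsetP[l _ ->].
  by rewrite (negPf (fg _ _)) (inj_eq fI) orbF eq_sym neq_lift imset_f.
by rewrite [_ == f _]eq_sym (negPf (fg _ _)) (inj_eq gI) [_ == j]eq_sym neq_lift imset_f ?orbT.
Qed.

(** Signs in one step of a Laplace expansion along the first row: [j] comes from the cofactor, [k]
    from the growth of the binomial coefficient in [masked_det], and the positions from
    condensation. *)
Lemma crossings_parity k (f g : 'I_k.+1 -> 'I_N) (j : 'I_k.+1) : increasing f -> increasing g ->
  (forall i j, f i != g j) ->
  odd (crossings f g + crossings (fun i' => f (lift ord0 i')) (fun j' => g (lift j j'))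
       + (g j < f ord0)%N + k) =
  odd (j + (pos (labels f g) (f ord0) + pos (labels f g) (g j)).+1).
Proof.
move=> fI gI fg.
have fJ := increasing_inj fI; have gJ := increasing_inj gI.
rewrite !(pos_labels _ fJ gJ fg).
have -> : (\sum_i (f i < f ord0) = 0)%N by rewrite big1 // => i _; rewrite increasing_lt // ltn0.
have -> : (\sum_i (g i < g j) = j)%N.
  by rewrite -[RHS]sum_ord_lt; apply: eq_bigr => i _; rewrite increasing_lt.
have -> : (crossings f g = \sum_i (g i < f ord0) + (\sum_i (g j < f (lift ord0 i))) +
    crossings (fun i' => f (lift ord0 i')) (fun j' => g (lift j j')))%N.
  rewrite /crossings (bigD1_ord ord0) //= -addnA; congr (_ + _)%N.
  rewrite -big_split; apply: eq_bigr => i _ /=.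
  by rewrite (bigD1_ord j).
have : (\sum_i (f i < g j) + ((g j < f ord0) + \sum_i (g j < f (lift ord0 i))) = k.+1)%N.
  have -> : ((g j < f ord0) + \sum_i (g j < f (lift ord0 i)) = \sum_i (g j < f i))%N.
    by rewrite [RHS](bigD1_ord ord0).
  rewrite -big_split /= -[RHS]card_ord -sum1_card; apply: eq_bigr => i _.
  by case: ltngtP => // /ord_inj /eqP; rewrite (negPf (fg i j)).
move/(congr1 odd); rewrite !oddD /= !oddD /=.
case: (odd (crossings _ _)); case: (odd (\sum_(i < k.+1) (f i < g j))); case: (odd k);
  case: (odd (\sum_i (g i < f ord0))); case: (odd (\sum_(i < k) (g j < f (lift ord0 i))));
  by case: (odd j); case: (g j < f ord0)%N.
Qed.

End IncreasingLabels.

(** * Determinants for any function that satisfies the condensation recursion *)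

Section MaskedDeterminant.
Variables (R : comNzRingType) (N : nat) (c : pred 'I_N) (H : {set 'I_N} -> R).
Hypothesis H0 : H set0 = 1.
Hypothesis Hrec : forall (T : {set 'I_N}) b, b \in T -> c b ->
  H T = \sum_(w in T | ~~ c w)
    (-1) ^+ (pos T b + pos T w).+1 * (H [set b; w] * H (T :\: [set b; w])).
Implicit Types (T A : {set 'I_N}).

(** The exponent of the sign of the shuffle that sorts [T] into its parts inside and outside [A]. *)
Definition inversions T A := (\sum_(a in T :&: A) pos (T :\: A) a)%N.

Lemma pos_split T A x : (pos T x = pos (T :&: A) x + pos (T :\: A) x)%N.
Proof.
rewrite /pos -(cardsID A); congr (_ + _)%N; congr #|pred_of_set _|; apply/setP=> i;
  by rewrite !inE; case: (i \in T); case: (i \in A); rewrite ?andbF ?andbT.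
Qed.

Lemma pos_compl T x : x \notin T -> (pos T x + #|[set a in T | (x < a)%N]| = #|T|)%N.
Proof.
move=> xT; rewrite -[in RHS](cardsID [set i : 'I_N | (i < x)%N] T) /pos; congr (_ + _)%N;
  congr #|pred_of_set _|; apply/setP=> i; rewrite !inE; case: (boolP (i \in T));
    rewrite ?andbF //= => iT.
by have : (x : nat) != i by [apply: contraNneq xT => /ord_inj->]; lia.
Qed.

Lemma posU2 T b w x : b \in T -> w \in T -> b != w ->
  (pos T x = pos (T :\: [set b; w]) x + (b < x) + (w < x))%N.
Proof.
move=> bT wT bw; rewrite /pos.
have -> : [set j in T :\: [set b; w] | (j < x)%N] = [set j in T | (j < x)%N] :\ b :\ w.
  by apply/setP=> i; rewrite !inE negb_or; case: (i == b); case: (i == w); rewrite ?andbF.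
rewrite (cardsD1 b) (cardsD1 w (_ :\ b)) !inE bT wT eq_sym bw /=; lia.
Qed.

(** For [b] and [w] in [A], exactly their own two terms disappear. Outside [A], each of them loses
    the elements of [A] above it; complementing twice in the same set replaces above by below modulo
    2. *)
Lemma inversions_parity T A b w : b \in T -> w \in T -> b != w -> (b \in A) = (w \in A) ->
  odd (inversions T A + inversions (T :\: [set b; w]) A) =
  odd (pos (if b \in A then T :\: A else T :&: A) b + pos (if b \in A then T :\: A else T :&: A)
    w).
Proof.
move=> bT wT bw; rewrite /inversions.
have TTA : (T :\: [set b; w]) :&: A = (T :&: A) :\: [set b; w].
  by apply/setP=> i; rewrite !inE; case: (i \in A); rewrite ?andbF ?andbT.
have TTD : (T :\: [set b; w]) :\: A = (T :\: A) :\: [set b; w].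
  by apply/setP=> i; rewrite !inE; case: (i \in A); rewrite ?andbF ?andbT.
case: (boolP (b \in A)) => bA /esym wA.
  have -> : (T :\: [set b; w]) :\: A = T :\: A.
    apply/setP=> i; rewrite !inE; case: (boolP (i \in A)) => //= iA.
    by case: eqP => [ib|_]; [rewrite ib bA in iA|case: eqP => // iw; rewrite iw wA in iA].
  rewrite TTA (bigD1 b) ?inE ?bT //= (bigD1 w) ?inE ?wT ?wA 1?eq_sym //=.
  rewrite (eq_bigl (mem ((T :&: A) :\: [set b; w]))) => [|i]; last first.
    by rewrite !inE negb_or; do 2!case: (_ == _); rewrite ?andbF ?andbT.
  by rewrite addnA -addnA addnn oddD odd_double addbF.
have -> : (T :\: [set b; w]) :&: A = T :&: A.
  apply/setP=> i; rewrite !inE; case: (boolP (i \in A)) => iA; rewrite ?andbF ?andbT //.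
  by case: eqP => [ib|_]; [rewrite -ib iA in bA|case: eqP => // iw; rewrite -iw iA in wA].
rewrite TTD -big_split /=.
have bTA : b \notin T :&: A by rewrite inE negb_and bA orbT.
have wTA : w \notin T :&: A by rewrite inE negb_and wA orbT.
have sumlt x : (\sum_(a in T :&: A) (x < a)%N = #|[set a in T :&: A | (x < a)%N]|)%N.
  by rewrite -sum1_card [RHS](eq_bigl (fun a => (a \in T :&: A) && (x < a)%N)) ?[RHS]big_mkcondr
    // => a; rewrite !inE.
transitivity (odd (\sum_(a in T :&: A) ((b < a) + (w < a)))).
  rewrite !(big_morph odd oddD (erefl _)); apply: eq_bigr => a _.
  have pU := @posU2 (T :\: A) b w a; rewrite !inE bA wA in pU.
  by rewrite (pU bT wT bw) !oddD; case: (odd (pos _ _)); case: (b < a)%N; case: (w < a)%N.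
rewrite big_split /= !sumlt.
have := congr1 odd (pos_compl bTA); have := congr1 odd (pos_compl wTA); rewrite !oddD.
by do 5!case: (odd _).
Qed.

(** The recursion is applied to the factor whose set contains [b], so only the [w] on the same side
    of [A] occur: this is the mask. Inversions convert positions within that side into positions
    within [T]. *)
Lemma masked_step T A b : b \in T -> c b ->
  H (T :&: A) * H (T :\: A) = \sum_(w in T | ~~ c w)
    (-1) ^+ ((pos T b + pos T w).+1 + (inversions T A + inversions (T :\: [set b; w]) A)) *
    ((b \in A) == (w \in A))%:R * H [set b; w] *
    (H ((T :\: [set b; w]) :&: A) * H ((T :\: [set b; w]) :\: A)).
Proof.
move=> bT cb.
have TTA w : (T :\: [set b; w]) :&: A = (T :&: A) :\: [set b; w].
  by apply/setP=> i; rewrite !inE; case: (i \in A); rewrite ?andbF ?andbT.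
have TTD w : (T :\: [set b; w]) :\: A = (T :\: A) :\: [set b; w].
  by apply/setP=> i; rewrite !inE; case: (i \in A); rewrite ?andbF ?andbT.
have bw w : ~~ c w -> b != w by apply: contraNneq => <-.
have [bA|bA] := boolP (b \in A).
  rewrite (Hrec (T := T :&: A) (b := b)) ?inE ?bT //.
  rewrite mulr_suml [RHS](bigID (mem A)) /= [X in _ = _ + X]big1 ?addr0; last first.
    by move=> w /andP[_ /negPf->]; rewrite mulr0 !mul0r.
  apply: eq_big => [w|w]; first by rewrite inE andbAC.
  rewrite inE => /andP[/andP[wT wA] cw]; rewrite wA eqxx mulr1.
  have -> : T :\: [set b; w] :\: A = T :\: A.
    apply/setP=> i; rewrite !inE; case: (boolP (i \in A)) => //= iA.
    by case: eqP => [ib|_]; [rewrite ib bA in iA|case: eqP => // iw; rewrite iw wA in iA].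
  rewrite TTA !mulrA; congr (_ * _ * _ * _); apply: signr_eq.
  rewrite [in RHS]oddD inversions_parity // ?wA ?bw // bA !(pos_split T A) /= !oddD.
  by do 4!case: (odd _).
rewrite (Hrec (T := T :\: A) (b := b)) ?inE ?bT ?bA //.
rewrite mulr_sumr [RHS](bigID (mem (~: A))) /= [X in _ = _ + X]big1 ?addr0; last first.
  by move=> w /andP[_]; rewrite inE negbK => ->; rewrite mulr0 !mul0r.
apply: eq_big => [w|w]; first by rewrite !inE; case: (w \in A); case: (w \in T); case: (c w).
rewrite inE => /andP[/andP[wA wT] cw]; rewrite (negPf wA) eqxx mulr1.
have -> : (T :\: [set b; w]) :&: A = T :&: A.
  apply/setP=> i; rewrite !inE; case: (boolP (i \in A)) => iA; rewrite ?andbF ?andbT //.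
  by case: eqP => [ib|_]; [rewrite -ib iA in bA|case: eqP => // iw; rewrite -iw iA in wA].
rewrite TTD mulrCA -!mulrA; congr (_ * _); last by rewrite mulrCA.
apply: signr_eq.
rewrite [in RHS]oddD inversions_parity // ?(negPf wA) ?(negPf bA) ?bw // !(pos_split T A) /=
  !oddD.
by do 4!case: (odd _).
Qed.

(** Laplace expansion along the first row is [masked_step] at [f ord0]. The sign in an entry is the
    part of the position signs that neither the cofactor nor the change of the global sign accounts
    for. *)
Lemma masked_det k (f g : 'I_k -> 'I_N) (A : {set 'I_N}) :
  increasing f -> increasing g -> (forall i, c (f i)) -> (forall i, ~~ c (g i)) ->
  H (labels f g :&: A) * H (labels f g :\: A) =
  (-1) ^+ (crossings f g + 'C(k, 2) + inversions (labels f g) A) *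
  \det (\matrix_(i < k, j < k)
    ((-1) ^+ (g j < f i)%N * ((f i \in A) == (g j \in A))%:R * H [set f i; g j])).
Proof.
elim: k f g => [|k IH] f g fI gI cf cg.
  have l0 : labels f g = set0.
    by apply/setP=> x; rewrite !inE; apply/orP=> -[] /imsetP[[]].
  rewrite /inversions l0 set0I set0D H0 det_mx00 /crossings big_set0 big_ord0.
  by rewrite !mulr1.
have fg i j : f i != g j by apply: contraNneq (cg j) => <-.
have fJ := increasing_inj fI; have gJ := increasing_inj gI.
have f0T : f ord0 \in labels f g by rewrite inE imset_f.
set M := \matrix_(i < k.+1, j < k.+1) _.
rewrite (masked_step A f0T (cf _)) (expand_det_row M ord0) mulr_sumr.
rewrite (eq_bigl (mem [set g i | i : 'I_k.+1])) => [|w]; last first.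
  rewrite !inE; apply/andP/imsetP=> [[/orP[]/imsetP[i _ ->]]|[i _ ->]].
  - by rewrite cf.
  - by exists i.
  - by rewrite imset_f ?orbT.
rewrite big_imset /=; last by move=> ? ? _ _; apply: gJ.
apply: eq_bigr => j _; rewrite labels_lift //.
rewrite (IH (fun i' => f (lift ord0 i')) (fun j' => g (lift j j'))) //;
  try exact: increasing_lift.
rewrite [M ord0 j]mxE /cofactor.
set M' := \matrix_(i, j) _; have -> : row' ord0 (col' j M) = M'.
  by apply/matrixP=> i' j'; rewrite !mxE.
rewrite !mulrA; congr (_ * _).
have regroup (s1 s2 s3 s4 s5 x y : R) : s1 * s2 = s3 * s4 * s5 ->
    s1 * x * y * s2 = s3 * s4 * x * y * s5.
  by move=> e; transitivity (s1 * s2 * (x * y)); [|rewrite e]; ring.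
apply: regroup; rewrite -!exprD; apply: signr_eq; rewrite binS bin1.
have := crossings_parity j fI gI fg.
rewrite !oddD /= !oddD /=.
case: (odd 'C(k, 2)); case: (odd (inversions _ _)); case: (odd (inversions _ _));
  case: (odd k); case: (odd j); case: (odd (pos _ _)); case: (odd (pos _ _));
  by case: (odd (crossings _ _)); case: (odd (crossings _ _)); case: (g j < f ord0)%N.
Qed.

End MaskedDeterminant.

(** * Tripartite pairings *)

Lemma card_ord_interval N a b : (b <= N)%N -> #|[set k : 'I_N | (a <= k < b)%N]| = (b - a)%N.
Proof.
move=> bN; elim: b bN => [|b IH] bN.
  by rewrite sub0n; apply: eq_card0 => k; rewrite !inE ltn0 andbF.
have [ba|ab] := ltnP b a.
  rewrite (eqP (_ : b.+1 - a == 0)%N) ?subn_eq0 //.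
  by apply: eq_card0 => k; rewrite !inE; lia.
rewrite subSn // -IH 1?ltnW // (cardsD1 (Ordinal bN)) inE /= ab leqnn add1n; congr _.+1.
by congr #|pred_of_set _|; apply/setP=> k; rewrite !inE -val_eqE /=; lia.
Qed.

Lemma pairing_balanced N (K : {set 'I_N}) p (X : pred 'I_N) : pairing_on K p ->
  (forall i, i \in K -> X (p i) = ~~ X i) ->
  #|[set i in K | X i]| = #|[set i in K | ~~ X i]|.
Proof.
move=> pK Xp; rewrite -(card_in_imset (f := p)); last first.
  move=> i j; rewrite !inE => /andP[/pK[_ _ pi] _] /andP[/pK[_ _ pj] _] ij.
  by rewrite -pi ij pj.
congr #|pred_of_set _|; apply/setP=> i; rewrite inE; apply/imsetP/andP=> [[j]|[iK Xi]].
  by rewrite inE => /andP[jK Xj] ->; rewrite Xp // Xj; case: (pK _ jK).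
have [piK _ pi] := pK _ iK; exists (p i); rewrite ?pi // inE piK Xp //.
Qed.

(** * Uniqueness of the noncrossing pairing without monochromatic pairs *)

Section Tripartite.
Variables (N p1 p2 p3 : nat).
Hypotheses (p12 : (p1 <= p2)%N) (p23 : (p2 <= p3)%N) (p3N : (p3 <= N)%N).

(* Zone 0 is [0, p1) together with [p3, N): it is the interval of labels that may wrap around. *)
Definition zone (k : nat) : nat := if (p1 <= k < p2)%N then 1%N else if (p2 <= k < p3)%N then
  2%N else 0%N.

Lemma zone_spec (k : nat) : (zone k = 1%N /\ (p1 <= k < p2)%N) \/
  (zone k = 2%N /\ (p2 <= k < p3)%N) \/ (zone k = 0%N /\ ((k < p1)%N \/ (p3 <= k)%N)).
Proof.
rewrite /zone; case: ifP => [|h1]; first by left.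
case: ifP => [|h2]; [by right; left|right; right; split=> //].
by clear -h1 h2; lia.
Qed.

Section OnePairing.
Variable p : 'I_N -> 'I_N.
Hypothesis pP : pairing_on setT p.
Hypothesis pnc : noncrossing_on setT p.
Hypothesis pz : forall i, zone (p i) != zone i.

Let pK i : p (p i) = i. Proof. by case: (pP (in_setT i)). Qed.
Let pne i : p i != i. Proof. by case: (pP (in_setT i)). Qed.

Let inside (i j : 'I_N) : (i < j < p i)%N -> (i < p j < p i)%N.
Proof. by apply: (between_closed pP pnc); rewrite inE. Qed.

Let outside (i j : 'I_N) : (i < p i)%N -> (j < i)%N || (p i < j)%N ->
  (p j < i)%N || (p i < p j)%N.
Proof.
move=> ip jo; case: (ltngtP (p j) i) => //= [ipj|/ord_inj e]; last first.
  by move: jo; rewrite -e pK !ltnn orbF; move: ip; rewrite -e pK; lia.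
case: (ltngtP (p i) (p j)) => //= [pji|/ord_inj e].
  by have := @inside i (p j); rewrite ipj pji pK => /(_ isT); lia.
by move: jo; rewrite -[j]pK -e pK ltnn /=; lia.
Qed.

Let inside_balanced (i : 'I_N) (X : pred nat) :
    (forall j : 'I_N, (i < j < p i)%N -> X (p j) = ~~ X j) ->
  #|[set j in [set j : 'I_N | (i < j < p i)%N] | X j]| =
  #|[set j in [set j : 'I_N | (i < j < p i)%N] | ~~ X j]|.
Proof.
move=> Xp; apply: (@pairing_balanced _ _ p (fun j => X j)) => j; rewrite inE => h; last exact: Xp.
by rewrite inE; split; [apply: inside | apply: pne | apply: pK].
Qed.

Let outside_balanced (i : 'I_N) (X : pred nat) : (i < p i)%N ->
    (forall j : 'I_N, (j < i)%N || (p i < j)%N -> X (p j) = ~~ X j) ->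
  #|[set j in [set j : 'I_N | (j < i)%N || (p i < j)%N] | X j]| =
  #|[set j in [set j : 'I_N | (j < i)%N || (p i < j)%N] | ~~ X j]|.
Proof.
move=> ip Xp; apply: (@pairing_balanced _ _ p (fun j => X j)) => j; rewrite inE => h;
  last exact: Xp.
by rewrite inE; split; [apply: outside | apply: pne | apply: pK].
Qed.

Let card_interval (A : {set 'I_N}) a b : (b <= N)%N ->
  (forall j : 'I_N, (j \in A) = (a <= j < b)%N) -> #|A| = (b - a)%N.
Proof.
move=> bN AE; rewrite -(card_ord_interval a bN); congr #|pred_of_set _|.
by apply/setP=> j; rewrite AE inE.
Qed.

Let card_cointerval (A : {set 'I_N}) a b : (a <= b)%N -> (b <= N)%N ->
  (forall j : 'I_N, (j \in A) = (j < a)%N || (b <= j)%N) -> #|A| = (a + (N - b))%N.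
Proof.
move=> ab bN AE; have := cardsC [set j : 'I_N | (a <= j < b)%N].
rewrite card_ord_interval // card_ord (_ : ~: _ = A).
  have arith x : (b - a + x = N -> x = a + (N - b))%N by lia.
  exact: arith.
by apply/setP=> j; rewrite AE !inE; lia.
Qed.

(* The labels strictly inside (or strictly outside) the pair {i, p i} have only the two colours of
   that pair and are paired among themselves, so each colour occurs equally often. *)
Lemma zone_sum_lt (i : 'I_N) : (i < p i)%N ->
  let t := (i + p i).+1 in let z := (zone i + zone (p i))%N in
  (z = 1%N -> t = p1.*2 \/ t = (p1.*2 + N)%N) /\
  (z = 3%N -> t = p2.*2) /\ (z = 2%N -> t = p3.*2 \/ (t + N = p3.*2)%N).
Proof.
move=> ip t z; have pz' j := pz j; have := pz i; rewrite /t /z.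
have := zone_spec i; have := zone_spec (p i).
have iN := ltn_ord i; have piN := ltn_ord (p i).
have [i1|i1] := ltnP i p1.
  have [|pi1] := ltnP (p i) p1; first by lia.
  have [pi2|pi2] := ltnP (p i) p2.
    have := @inside_balanced i (fun k => (k < p1)%N).
    rewrite (@card_interval _ i.+1 p1) ?(@card_interval _ p1 (p i)).
    - move=> bal; have : (p1 - i.+1 = p i - p1)%N.
        by apply: bal => j ij; have := inside ij; have := pz' j; have := zone_spec j;
          have := zone_spec (p j); lia.
      by lia.
    - lia.
    - by move=> j; rewrite !inE; lia.
    - lia.
    - by move=> j; rewrite !inE; lia.
  have [pi3|pi3] := ltnP (p i) p3; last by lia.
  have := @outside_balanced i (fun k => (p2 <= k < p3)%N) ip.
  rewrite (@card_interval _ (p i).+1 p3) ?(@card_cointerval _ i p3) //.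
  - move=> bal; have : (p3 - (p i).+1 = i + (N - p3))%N.
      by apply: bal => j ij; have := outside ip ij; have := pz' j; have := zone_spec j;
        have := zone_spec (p j); lia.
    by lia.
  - lia.
  - by move=> j; rewrite !inE; lia.
  - by move=> j; rewrite !inE; lia.
have [i2|i2] := ltnP i p2.
  have [pi2|pi2] := ltnP (p i) p2; first by lia.
  have [pi3|pi3] := ltnP (p i) p3.
    have := @inside_balanced i (fun k => (k < p2)%N).
    rewrite (@card_interval _ i.+1 p2) ?(@card_interval _ p2 (p i)).
    - move=> bal; have : (p2 - i.+1 = p i - p2)%N.
        by apply: bal => j ij; have := inside ij; have := pz' j; have := zone_spec j;
          have := zone_spec (p j); lia.
      by lia.
    - lia.
    - by move=> j; rewrite !inE; lia.
    - lia.
    - by move=> j; rewrite !inE; lia.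
  have := @outside_balanced i (fun k => (p1 <= k < p2)%N) ip.
  rewrite (@card_interval _ p1 i) ?(@card_cointerval _ p1 (p i).+1) //.
  - move=> bal; have : (i - p1 = p1 + (N - (p i).+1))%N.
      by apply: bal => j ij; have := outside ip ij; have := pz' j; have := zone_spec j;
        have := zone_spec (p j); lia.
    by lia.
  - lia.
  - by move=> j; rewrite !inE; lia.
  - lia.
  - by move=> j; rewrite !inE; lia.
have [i3|i3] := ltnP i p3; last by lia.
have [pi3|pi3] := ltnP (p i) p3; first by lia.
have := @inside_balanced i (fun k => (k < p3)%N).
rewrite (@card_interval _ i.+1 p3) ?(@card_interval _ p3 (p i)).
- move=> bal; have : (p3 - i.+1 = p i - p3)%N.
    by apply: bal => j ij; have := inside ij; have := pz' j; have := zone_spec j;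
      have := zone_spec (p j); lia.
  by lia.
- lia.
- by move=> j; rewrite !inE; lia.
- lia.
- by move=> j; rewrite !inE; lia.
Qed.

(** A pair is symmetric about the border between its two zones, which is p1, p2 or p3 according as
    the zone numbers add up to 1, 3 or 2; the terms in [N] account for wrapping. Hence a label and
    the zone of its partner determine the partner. *)
Lemma zone_sum (i : 'I_N) :
  let t := (i + p i).+1 in let z := (zone i + zone (p i))%N in
  (z = 1%N -> t = p1.*2 \/ t = (p1.*2 + N)%N) /\
  (z = 3%N -> t = p2.*2) /\ (z = 2%N -> t = p3.*2 \/ (t + N = p3.*2)%N).
Proof.
case: (ltngtP i (p i)) => [|h|/ord_inj e]; first exact: zone_sum_lt.
  by have := @zone_sum_lt (p i);
    rewrite pK [(p i + i)%N]addnC [(zone (p i) + _)%N]addnC => /(_ h).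
by have := pne i; rewrite -e eqxx.
Qed.

Definition linked21 : {set 'I_N} := [set i : 'I_N | (zone i == 2%N) && (zone (p i) == 1%N)].

(** The label [j] lies under the arc from [p i] to [i], and so does its partner; under this arc
    there are only zones 1 and 2. *)
Lemma linked21_down (i j : 'I_N) : i \in linked21 -> zone j = 2%N -> (j < i)%N -> j \in linked21.
Proof.
rewrite !inE => /andP[/eqP zi /eqP zpi] zj ji; rewrite zj /=; apply/eqP.
have := @inside (p i) j; rewrite pK; have := pz j; have := zone_spec i; have := zone_spec j;
  have := zone_spec (p i); have := zone_spec (p j); lia.
Qed.

(** Each zone splits according to the zone of the partner. Pairs between zones 0 and 1 and between
    zones 0 and 2 occur on both sides of the equation. *)
Lemma card_linked21 : (#|[set i : 'I_N | zone i == 2%N]| + #|[set i : 'I_N | zone i == 1%N]| =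
  #|[set i : 'I_N | zone i == 0%N]| + #|linked21|.*2)%N.
Proof.
pose t a b := #|[set i : 'I_N | (zone i == a) && (zone (p i) == b)]|.
have tC a b : t a b = t b a.
  rewrite /t -(card_imset _ (can_inj pK)); congr #|pred_of_set _|; apply/setP=> i.
  rewrite [RHS]inE; apply/imsetP/andP => [[j]|[h1 h2]]; first by rewrite inE => /andP[h1 h2] ->;
    rewrite pK h1 h2.
  by exists (p i); rewrite ?pK // inE pK h1 h2.
have split a b c : (forall k, zone k != a -> zone k = b \/ zone k = c) -> b <> c -> a <> b -> a
  <> c ->
    #|[set i : 'I_N | zone i == a]| = (t a b + t a c)%N.
  move=> abc bc ab ac; rewrite /t -(cardsID [set i : 'I_N | zone (p i) == b]); congr (_ + _)%N;
  congr #|pred_of_set _|; apply/setP=> i; rewrite !inE; first by [].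
  rewrite andbC; case: eqP => //= zi; have := pz i; rewrite zi => /abc[] ->.
    by rewrite eqxx; apply/esym/eqP.
  by rewrite eqxx; apply/eqP=> /esym.
have z3 k : [\/ zone k = 0%N, zone k = 1%N | zone k = 2%N].
  by rewrite /zone; case: ifP => _; [apply: Or32|case: ifP => _; [apply: Or33|apply: Or31]].
rewrite (split 2 1 0)%N // ?(split 1 2 0)%N // ?(split 0 1 2)%N //; try by move=> k;
  case: (z3 k) => ->; auto.
rewrite (tC 1%N 2%N) (tC 0%N 1%N) (tC 0%N 2%N) -/(t 2%N 1%N); lia.
Qed.

End OnePairing.

Lemma linked21_sub (p q : 'I_N -> 'I_N) :
  pairing_on setT p -> noncrossing_on setT p -> (forall i, zone (p i) != zone i) ->
  #|linked21 p| = #|linked21 q| -> 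
  (forall i j : 'I_N, i \in linked21 q -> zone j = 2%N -> (j < i)%N -> j \in linked21 q) ->
    linked21 p \subset linked21 q.
Proof.
move=> aP anc az cE bd; apply/subsetP=> i ia; apply: contraT => ib.
suff : linked21 q \proper linked21 p by move/proper_card; rewrite cE ltnn.
apply/properP; split; last by exists i.
apply/subsetP=> j jb; have zj : zone j = 2%N by move: jb; rewrite inE => /andP[/eqP].
case: (ltngtP j i) => [ji|ij|/ord_inj->//]; first exact: (linked21_down aP anc az ia zj ji).
case/negP: ib; apply: bd jb _ ij.
by move: ia; rewrite inE => /andP[/eqP].
Qed.

Lemma zone_partner_eq (p q : 'I_N -> 'I_N) (j : 'I_N) :
  pairing_on setT p -> noncrossing_on setT p -> (forall i, zone (p i) != zone i) ->
  pairing_on setT q -> noncrossing_on setT q -> (forall i, zone (q i) != zone i) ->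
  zone (p j) = zone (q j) -> p j = q j.
Proof.
move=> pP pnc pz qP qnc qz zE; apply: ord_inj.
have [p1s [p2s p3s]] := zone_sum pP pnc pz j; have [q1s [q2s q3s]] := zone_sum qP qnc qz j.
have pN := ltn_ord (p j); have qN := ltn_ord (q j); rewrite zE in p1s p2s p3s.
have : (zone j + zone (q j) = 1 \/ zone j + zone (q j) = 3 \/ zone j + zone (q j) = 2)%N.
  have := qz j; have := zone_spec j; have := zone_spec (q j).
  by move: (zone j) (zone (q j)) => x y; clear; lia.
case=> [z|[]z].
- move: (p1s z) (q1s z) pN qN; move: (nat_of_ord (p j)) (nat_of_ord (q j)) => x y.
  by clear; lia.
- move: (p2s z) (q2s z); move: (nat_of_ord (p j)) (nat_of_ord (q j)) => x y.
  by clear; lia.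
- move: (p3s z) (q3s z) pN qN; move: (nat_of_ord (p j)) (nat_of_ord (q j)) => x y.
  by clear; lia.
Qed.

(** The labels of zone 2 linked to zone 1 form an initial segment of zone 2 whose length is fixed by
    the zone sizes. This determines the zone of every partner, and then the partner by
    reflection. *)
Lemma tripartite_unique (p q : 'I_N -> 'I_N) :
  pairing_on setT p -> noncrossing_on setT p -> (forall i, zone (p i) != zone i) ->
  pairing_on setT q -> noncrossing_on setT q -> (forall i, zone (q i) != zone i) ->
  p =1 q.
Proof.
move=> pP pnc pz qP qnc qz k.
have linkedE : linked21 p = linked21 q.
  have cE : #|linked21 p| = #|linked21 q|.
    by have := card_linked21 pP pz; rewrite (card_linked21 qP qz) => /addnI/double_inj.
  apply/eqP; rewrite eqEsubset; apply/andP; split; apply: linked21_sub => //.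
    exact: linked21_down qP qnc qz.
  exact: linked21_down pP pnc pz.
have pq (j : 'I_N) : zone (p j) = zone (q j) -> p j = q j by apply: zone_partner_eq.
have zE2 (j : 'I_N) : zone j = 2%N -> zone (p j) = zone (q j).
  move=> zj; have : (j \in linked21 p) = (j \in linked21 q) by rewrite linkedE.
  rewrite !inE zj /=; have := pz j; have := qz j; rewrite zj.
  have := zone_spec (p j); have := zone_spec (q j).
  move: (zone (p j)) (zone (q j)) => x y; clear; lia.
have qK j : q (q j) = j by case: (qP j (in_setT j)).
have pK j : p (p j) = j by case: (pP j (in_setT j)).
case: (zone k =P 2%N) => [/zE2/pq//|zi].
case: (zone (p k) =P 2%N) => [/zE2/pq|zpi]; first by rewrite pK => {2}->; rewrite qK.
case: (zone (q k) =P 2%N) => [/zE2/pq|zqi]; first by rewrite qK => {1}<-; rewrite pK.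
apply: pq; have := pz k; have := qz k.
have := zone_spec k; have := zone_spec (p k); have := zone_spec (q k).
move: zi zpi zqi; move: (zone k) (zone (p k)) (zone (q k)) => x y z; clear; lia.
Qed.

End Tripartite.

(** * From circular contiguity to three thresholds *)

Section Thresholds.
Variables (n : nat) (rgb : 'I_(n.*2) -> 'I_3).
Hypothesis contig : circ_contiguous rgb.

Lemma cyclic_interval_no_alternation (P : pred 'I_(n.*2)) (s l : nat) (a b c d : 'I_(n.*2)) :
  (forall k, P k = [exists t : 'I_l, ((s + t) %% n.*2)%N == k]) ->
  (a < b)%N -> (b < c)%N -> (c < d)%N -> P a = P c -> P b = P d -> P a = P b.
Proof.
move=> PE ab bc cd; have N0 : (0 < n.*2)%N by apply: leq_ltn_trans (ltn_ord a).
pose s0 := (s %% n.*2)%N; have s0N : (s0 < n.*2)%N by rewrite ltn_mod.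
(* The distance from the start [s0] to [k] along the circle; the interval consists of the labels at
   distance less than [l]. *)
pose t0 (k : nat) := (if s0 <= k then k - s0 else k + n.*2 - s0)%N.
have {}PE (k : 'I_(n.*2)) : P k = (t0 k < l)%N.
  have kN := ltn_ord k.
  have t0N : (t0 k < n.*2)%N by rewrite /t0; case: ifP; lia.
  have t0k : ((s0 + t0 k) %% n.*2 = k)%N.
    rewrite /t0; case: ifP => h; first by rewrite subnKC // modn_small.
    by rewrite subnKC; [rewrite modnDr modn_small|lia].
  rewrite PE; apply/existsP/idP => [[t /eqP tk]|tl]; last first.
    by exists (Ordinal tl); rewrite /= -modnDml t0k.
  apply: leq_ltn_trans (ltn_ord t); rewrite -(modn_small t0N).
  suff -> : (t0 k %% n.*2 = t %% n.*2)%N by apply: leq_mod.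
  by apply/eqP; rewrite -(eqn_modDl s0) t0k /s0 modnDml tk.
have := (ltn_ord a, ltn_ord b, ltn_ord c, ltn_ord d) => -[[[aN bN] cN] dN].
rewrite !PE /t0; clear -ab bc cd aN bN cN dN s0N.
by do !case: ifP; lia.
Qed.

Lemma color_no_alternation (x : 'I_3) (a b c d : 'I_(n.*2)) :
  (a < b)%N -> (b < c)%N -> (c < d)%N ->
  (rgb a == x) = (rgb c == x) -> (rgb b == x) = (rgb d == x) -> (rgb a == x) = (rgb b == x).
Proof.
have [s [l E]] := contig x => ab bc cd.
exact: (cyclic_interval_no_alternation (P := fun k => rgb k == x) E ab bc cd).
Qed.

Lemma first_failure (P : pred nat) a N : (a <= N)%N ->
  exists p, [/\ (a <= p <= N)%N, forall k, (a <= k < p)%N -> P k & (p < N)%N -> ~~ P p].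
Proof.
move=> aN; have [b bE] : exists b, b = (N - a)%N by exists (N - a)%N.
elim: b a aN bE => [|b IH] a aN bE.
  by exists a; split=> [|k|]; [lia|lia|lia].
have [Pa|Pa] := boolP (P a); last by exists a; split=> [|k|]; [lia|lia|].
have [||p [ap Pp nPp]] := IH a.+1; [lia|lia|].
exists p; split=> // [|k kp]; first lia.
by case: (ltngtP a k) => [ak|ka|<-//]; [apply: Pp; lia|lia].
Qed.

Lemma three_colors (x y : 'I_3) : x != y -> exists z, [/\ z != x, z != y &
  forall t, [|| t == x, t == y | t == z]].
Proof.
(* The three elements of Z/3 add up to 0. *)
move=> xy; exists (- (x + y)); move: xy.
case: x => [[|[|[|//]]] i]; case: y => [[|[|[|//]]] j] // _; split=> // t;
  by case: t => [[|[|[|//]]] k].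
Qed.

Definition zone_color (p1 p2 p3 : nat) (c1 c2 c3 : 'I_3) (k : nat) : 'I_3 :=
  if zone p1 p2 p3 k == 1%N then c2 else if zone p1 p2 p3 k == 2%N then c3 else c1.

(** Scanning from label 0, the thresholds end the runs of three successive colours. Any label from
    p3 on has the first colour again, since otherwise some colour would alternate around the circle.
    A missing colour gives an empty zone. *)
Lemma contiguous_zones : exists p1 p2 p3 c1 c2 c3,
  [/\ [&& p1 <= p2, p2 <= p3 & p3 <= n.*2]%N, [&& c1 != c2, c1 != c3 & c2 != c3] &
      forall k, rgb k = zone_color p1 p2 p3 c1 c2 c3 k].
Proof.
have [n0|n0] := posnP n.*2.
  exists 0%N, 0%N, 0%N, (inord 0 : 'I_3), (inord 1 : 'I_3), (inord 2 : 'I_3); split=> [||k].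
  - by rewrite !leq0n.
  - by rewrite -!val_eqE /= !inordK.
  - by have := ltn_ord k; rewrite {2}n0.
pose f (k : nat) := rgb (insubd (Ordinal n0) k).
have fE (k : 'I_(n.*2)) : f k = rgb k by rewrite /f valKd.
have alt x a b c d : (a < b)%N -> (b < c)%N -> (c < d)%N -> (d < n.*2)%N ->
    (f a == x) = (f c == x) -> (f b == x) = (f d == x) -> (f a == x) = (f b == x).
  move=> ab bc cd dN; have cN := ltn_trans cd dN; have bN := ltn_trans bc cN.
  have aN := ltn_trans ab bN.
  have := @color_no_alternation x (Ordinal aN) (Ordinal bN) (Ordinal cN) (Ordinal dN) ab bc cd.
  by rewrite -!fE.
pose c1 := f 0%N.
have [p1 [p1N in1 out1]] := first_failure (fun k => f k == c1) (leq0n n.*2).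
have [p1E|p1lt] : p1 = n.*2 \/ (p1 < n.*2)%N by lia.
  have [c2 c12] : exists c2 : 'I_3, c1 != c2.
    by case: (eqVneq c1 ord0) => [->|]; [exists (inord 1);
      rewrite -val_eqE /= inordK|exists ord0].
  have [c3 [c31 c32 _]] := three_colors c12.
  exists p1, p1, p1, c1, c2, c3; split; first by rewrite p1E !leqnn.
    by rewrite c12 eq_sym c31 eq_sym c32.
  move=> k; rewrite -fE /zone_color.
  have [[_ h]|[[_ h]|[-> _]]] /= := zone_spec p1 p1 p1 k; [lia|lia|].
  by apply/eqP/in1; rewrite p1E ltn_ord.
have c12 : c1 != f p1 by rewrite eq_sym; apply: out1.
set c2 := f p1 in c12.
have [c3 [c31 c32 c_all]] := three_colors c12.
have [p2 [p2N in2 out2]] := first_failure (fun k => f k == c2) (ltnW p1lt).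
have [|p3 [p3N in3 out3]] := @first_failure (fun k => f k == c3) p2 n.*2; first lia.
have p1p2 : (p1 < p2)%N.
  by case: (ltngtP p1 p2) => // [|e]; [lia|]; have := out2; rewrite -e p1lt eqxx => /(_ isT).
have p10 : (0 < p1)%N by case: (posnP p1) c12 => // e; rewrite /c2 e eqxx.
have tail k : (p3 <= k < n.*2)%N -> f k = c1.
  move=> /andP[p3k kN]; have := c_all (f k); case: eqP => //= _ /orP[]/eqP fk.
    have p2k : (p2 < k)%N.
      by case: (ltngtP p2 k) => // [|e]; [lia|]; have := out2; rewrite e fk kN eqxx => /(_ isT).
    have p2lt := ltn_trans p2k kN.
    have := @alt c2 0%N p1 p2 k p10 p1p2 p2k kN.
    by rewrite fk eqxx (negPf c12) (negPf (out2 p2lt)) => /(_ erefl erefl).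
  have p3lt := leq_ltn_trans p3k kN.
  have f3 : f p3 != c3 := out3 p3lt.
  have k3 : (p3 < k)%N.
    by case: (ltngtP p3 k) => // [|e]; [lia|]; rewrite e fk eqxx in f3.
  have [p23|p23] := ltnP p2 p3.
    have := @alt c3 0%N p2 p3 k (ltn_trans p10 p1p2) p23 k3 kN.
    have /eqP f2 : f p2 == c3 by apply: in3; rewrite leqnn.
    by rewrite f2 fk eqxx (negPf f3) [c1 == c3]eq_sym (negPf c31) => /(_ erefl erefl).
  have p2E : p3 = p2 by lia.
  have f2 : f p3 = c1.
    have n2 : f p3 != c2 by rewrite p2E; apply: out2; rewrite -p2E.
    by have := c_all (f p3); rewrite (negPf n2) (negPf f3) !orbF => /eqP.
  have := @alt c1 0%N p1 p3 k p10 _ k3 kN; rewrite p2E p1p2 -p2E f2 fk eqxx.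
  by rewrite (eq_sym _ c1) (negPf c12) (negPf c31) => /(_ isT erefl erefl).
exists p1, p2, p3, c1, c2, c3; split; first by lia.
  by rewrite c12 eq_sym c31 eq_sym c32.
move=> k; rewrite -fE /zone_color; have kN := ltn_ord k.
have [[-> h]|[[-> h]|[-> h]]] /= := zone_spec p1 p2 p3 k.
- by apply/eqP/in2.
- by apply/eqP/in3.
- by case: h => h; [apply/eqP/in1 | apply: tail; rewrite h].
Qed.

End Thresholds.

Lemma pos_setT N (i : 'I_N) : pos setT i = i.
Proof.
rewrite /pos -[RHS]subn0 -(card_ord_interval 0 (ltnW (ltn_ord i))).
by congr #|pred_of_set _|; apply/setP=> j; rewrite !inE.
Qed.

Lemma sum_ord_bin2 n : (\sum_(i < n) i = 'C(n, 2))%N.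
Proof. by rewrite -bin2_sum big_mkord. Qed.

Lemma planar_noncrossing n (s : {perm 'I_(n.*2)}) T : planar_pairing s -> noncrossing_on T s.
Proof. by case=> _ pl a b _ _ ab bc cd; apply: (pl a b (s a) (s b)). Qed.

Lemma planar_pairing_setT n (s : {perm 'I_(n.*2)}) : planar_pairing s -> pairing_on setT s.
Proof. by case=> sP _ i _; have [ne ss] := sP i; rewrite inE. Qed.

(** * The alternating sum *)

Section SignOE.
Variables (R : numFieldType) (n : nat) (s : {perm 'I_(n.*2)}).
Hypothesis s_planar : planar_pairing s.

Let sK i : s (s i) = i. Proof. by case: s_planar => sP _; case: (sP i). Qed.
Let sne i : s i != i. Proof. by case: s_planar => sP _; case: (sP i). Qed.

Lemma even_label_subproof (k : 'I_n) : (k.*2 < n.*2)%N.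
Proof. by rewrite ltn_double. Qed.
Lemma odd_label_subproof (k : 'I_n) : (k.*2.+1 < n.*2)%N.
Proof. by rewrite ltn_Sdouble. Qed.
Definition even_label (k : 'I_n) : 'I_(n.*2) := Ordinal (even_label_subproof k).
Definition odd_label (k : 'I_n) : 'I_(n.*2) := Ordinal (odd_label_subproof k).

Lemma planar_odd (i : 'I_(n.*2)) : odd (s i) = ~~ odd i.
Proof.
have := noncrossing_odd_even (planar_pairing_setT s_planar) (planar_noncrossing s_planar)
  (in_setT i).
by rewrite !pos_setT.
Qed.

Lemma even_odd_labels : labels even_label odd_label = setT.
Proof.
apply/setP=> i; rewrite !inE; apply/orP.
have iE := odd_double_half i; have iN := ltn_ord i.
have hN : (i./2 < n)%N by rewrite ltn_half_double.
case: (boolP (odd i)) iE => _ iE; [right|left]; apply/imsetP; exists (Ordinal hN) => //;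
  by apply: ord_inj; rewrite /= -[LHS]iE.
Qed.

(* closed_ind satisfies the recursion of the masked determinants, with the even labels black. *)
Let closed_ind (T : {set 'I_(n.*2)}) : R := [forall i in T, s i \in T]%:R.

Let closed_pair b w : b != w -> closed_ind [set b; w] = (s b == w)%:R.
Proof.
move=> bw; congr (_%:R : R); congr nat_of_bool; apply/forall_inP/eqP => [/(_ b)|<- i].
  by rewrite !inE eqxx (negPf (sne b)) => /(_ isT)/eqP.
by rewrite !inE => /orP[]/eqP->; rewrite ?sK eqxx ?orbT.
Qed.

(** Only [w = s b] contributes. If [T] is stable under [s], the positions of [b] and [s b] in it
    have opposite parity, so the sign is +1; otherwise both sides vanish. *)
Let closed_rec (T : {set 'I_(n.*2)}) (b : 'I_(n.*2)) : b \in T -> ~~ odd b ->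
  closed_ind T = \sum_(w in T | ~~ ~~ odd w)
    (-1) ^+ (pos T b + pos T w).+1 * (closed_ind [set b; w] * closed_ind (T :\: [set b; w])).
Proof.
move=> bT ob.
have neb (w : 'I_(n.*2)) : odd w -> b != w by apply: contraTneq => <-.
have term (w : 'I_(n.*2)) : s b != w -> odd w -> (-1) ^+ (pos T b + pos T w).+1 *
    (closed_ind [set b; w] * closed_ind (T :\: [set b; w])) = 0.
  by move=> sbw ow; rewrite closed_pair ?neb // (negPf sbw) mul0r mulr0.
have [sbT|sbT] := boolP (s b \in T); last first.
  rewrite big1 => [|w /andP[wT]]; last first.
    by rewrite negbK; apply: term; apply: contraNneq sbT => ->.
  rewrite /closed_ind (_ : [forall i in T, _] = false) //.
  by apply/negP=> /forall_inP/(_ b bT); rewrite (negPf sbT).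
have osb : odd (s b) by rewrite planar_odd.
rewrite (bigD1 (s b)) ?sbT ?osb //= big1 => [|w /andP[/andP[_]]]; last first.
  by rewrite negbK eq_sym => ow ne; apply: term.
rewrite addr0 closed_pair ?neb // eqxx mul1r.
have -> : closed_ind (T :\: [set b; s b]) = closed_ind T.
  congr (_%:R : R); congr nat_of_bool; apply/forall_inP/forall_inP=> cl i; last first.
    rewrite !inE => /andP[/norP[ib isb] iT]; rewrite cl // andbT negb_or.
    by rewrite -(inj_eq (@perm_inj _ s)) sK isb (inj_eq perm_inj).
  case: (eqVneq i b) => [->//|ib]; case: (eqVneq i (s b)) => [->|isb iT]; first by rewrite sK.
  by have := cl i; rewrite !inE negb_or ib isb iT => /(_ isT)/andP[].
have [/forall_inP cl|] := boolP [forall i in T, s i \in T]; last first.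
  by rewrite /closed_ind => /negPf->; rewrite mulr0.
have pT : pairing_on T s by move=> i iT; rewrite cl.
rewrite -signr_odd /= oddD (noncrossing_odd_even pT (planar_noncrossing s_planar) bT).
by rewrite addbN addbb mul1r.
Qed.

Lemma oe_mapP (k q : 'I_n) : (q == oe_map s k) = (s (even_label k) == odd_label q).
Proof.
rewrite /oe_map.
have -> : insubd (widen_ord (n_le_double n) k) k.*2 = even_label k.
  by apply: val_inj; rewrite val_insubd even_label_subproof.
have := planar_odd (even_label k); rewrite /= odd_double /= => os.
have := odd_double_half (s (even_label k)); rewrite os add1n => sE.
have hN : ((s (even_label k))./2 < n)%N by rewrite ltn_half_double ltn_ord.
rewrite -!val_eqE /= val_insubd hN -{2}sE eqSS eq_sym.
by apply/eqP/eqP => [->|/double_inj].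
Qed.

(** In [masked_det] for [closed_ind] with the full mask, the left side is 1 and the matrix is the
    permutation matrix of [oe_map s] with signed entries, whose determinant is [signOE] times the
    product of these signs. *)
Lemma signOE_planar :
  signOE R s = \prod_(k < n) (-1) ^+ (s (even_label k) < even_label k)%N.
Proof.
have evI : increasing even_label by move=> i j ij; rewrite /= ltn_double.
have odI : increasing odd_label by move=> i j ij; rewrite /= ltnS ltn_double.
have H0 : closed_ind set0 = 1.
  by rewrite /closed_ind (_ : [forall i in set0, _]) //; apply/forall_inP=> i; rewrite inE.
have HT : closed_ind setT = 1.
  by rewrite /closed_ind (_ : [forall i in setT, _]) //; apply/forall_inP=> i; rewrite !inE.
have := masked_det (c := fun i => ~~ odd i) H0 closed_rec setT evI odI.
rewrite even_odd_labels setTI setDT H0 HT mulr1.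
have -> : inversions [set: 'I_(n.*2)] setT = 0%N.
  rewrite /inversions big1 // => a _; rewrite setDT /pos; apply: eq_card0 => j.
  by rewrite !inE.
(* The label 2j+1 lies below 2i exactly when j < i, so the crossings cancel the binomial coefficient
   in the sign. *)
have -> : crossings even_label odd_label = 'C(n, 2).
  rewrite -sum_ord_bin2; apply: eq_bigr => i _; rewrite -[RHS]sum_ord_lt.
  by apply: eq_bigr => j _; rewrite /= ltn_Sdouble.
rewrite addn0 addnn -signr_odd odd_double mul1r; set M := \matrix_(i, j) _.
have ev i : ~~ odd (even_label i) by rewrite /= odd_double.
have od i : ~~ ~~ odd (odd_label i) by rewrite /= odd_double.
move/(_ ev od) => det1; set P := \prod_(k < n) _.
have PP : P * P = 1.
  by rewrite /P -big_split big1 // => k _ /=; rewrite -expr2 sqrr_sign.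
suff detP : \det M = signOE R s * P by rewrite -[LHS]mulr1 -PP mulrA -detP -det1 mul1r.
rewrite /signOE /determinant mulr_suml [RHS]big_mkcond; apply: eq_bigr => q _.
have ME i : M i (q i) = (-1) ^+ (s (even_label i) < even_label i)%N * (q i == oe_map s i)%:R.
  rewrite mxE !inE mulr1 closed_pair; last by rewrite -val_eqE /=; lia.
  by rewrite oe_mapP; case: eqP => [->//|_]; rewrite !mulr0.
under eq_bigr => i _ do rewrite ME.
case: ifP => [/forallP qo|/negbT].
  by congr (_ * _); apply: eq_bigr => i _; rewrite qo mulr1.
rewrite negb_forall => /existsP[i qi].
by rewrite (bigD1 i) //= (negPf qi) mulr0 mul0r mulr0.
Qed.

End SignOE.

(** * Sign vectors and their alternating sum over a pairing *)

Definition selected n (c : pred 'I_(n.*2)) (x : {ffun 'I_(n.*2) -> bool}) : {set 'I_(n.*2)} :=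
  [set i | x i == c i].

Section SignVectors.
Variables (R : numFieldType) (n p1 p2 p3 : nat).
Hypotheses (p12 : (p1 <= p2)%N) (p23 : (p2 <= p3)%N) (p3N : (p3 <= n.*2)%N).
Implicit Types (x : {ffun 'I_(n.*2) -> bool}) (i k : 'I_(n.*2)).

Definition allowed (k : nat) (b : bool) : bool :=
  if zone p1 p2 p3 k == 0%N then b else if zone p1 p2 p3 k == 1%N then ~~ b else true.

Definition allowed_vector x := [forall k : 'I_(n.*2), allowed k (x k)].

Definition vector_sign x : R := (-1) ^+ (\sum_(k < n.*2) k * x k).

(** For the subset [selected c x] this is compatibility along the pairs of [p], whatever the
    colouring [c]. *)
Definition alternates (p : 'I_(n.*2) -> 'I_(n.*2)) x := [forall i : 'I_(n.*2), x i != x (p i)].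

(** The only allowed alternating vector when no pair lies in one zone: true on zone 0, false on zone
    1, and on zone 2 opposite to the prescribed value of the partner. *)
Definition vector_of_pairing (p : 'I_(n.*2) -> 'I_(n.*2)) : {ffun 'I_(n.*2) -> bool} :=
  [ffun k : 'I_(n.*2) => (zone p1 p2 p3 k == 0%N) ||
             (zone p1 p2 p3 k == 2%N) && (zone p1 p2 p3 (p k) == 1%N)].

Lemma zone_cases (k : nat) : [\/ zone p1 p2 p3 k = 0%N, zone p1 p2 p3 k = 1%N | zone p1 p2 p3 k
  = 2%N].
Proof. by have [[-> _]|[[-> _]|[-> _]]] := zone_spec p1 p2 p3 k;
  [apply: Or32|apply: Or33|apply: Or31]. Qed.

Lemma vector_of_pairing_unique p x : pairing_on setT p ->
  (forall i : 'I_(n.*2), zone p1 p2 p3 (p i) != zone p1 p2 p3 i) ->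
  (allowed_vector x && alternates p x) = (x == vector_of_pairing p).
Proof.
move=> pP pz; have pK i : p (p i) = i by case: (pP i (in_setT i)).
apply/andP/eqP => [[/forallP ax /forallP px]|->].
  apply/ffunP=> k; rewrite ffunE; have := ax k; have := ax (p k); have := px k; have := pz k.
  rewrite /allowed; case: (zone_cases k) => ->; case: (zone_cases (p k)) => -> //=;
    by case: (x k); case: (x (p k)).
split; apply/forallP=> k; rewrite !ffunE ?pK; have := pz k; rewrite /allowed;
  by case: (zone_cases k) => ->; case: (zone_cases (p k)) => ->.
Qed.

(** A pair inside zone 0 or zone 1 has equal prescribed values, so no vector alternates. For a pair
    inside zone 2, flipping both values is an involution that changes the exponent by the odd
    difference of the two labels. *)
Lemma alternating_sum_monochromatic p i0 : pairing_on setT p -> noncrossing_on setT p ->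
  zone p1 p2 p3 (p i0) = zone p1 p2 p3 i0 ->
  \sum_(x | allowed_vector x) vector_sign x * (alternates p x)%:R = 0.
Proof.
move=> pP pnc z0; have [_ ne pp] := pP i0 (in_setT i0).
have podd : odd (p i0) = ~~ odd i0.
  by have := noncrossing_odd_even pP pnc (in_setT i0); rewrite !pos_setT.
case: (boolP (zone p1 p2 p3 i0 == 2%N)) => z2; last first.
  rewrite big1 // => x /forallP ax.
  rewrite (_ : alternates p x = false) ?mulr0 //; apply/negP=> /forallP/(_ i0).
  have := ax i0; have := ax (p i0); rewrite /allowed z0; move: z2.
  by case: (zone_cases i0) => -> //= _; case: (x i0); case: (x (p i0)).
pose tog x : {ffun 'I_(n.*2) -> bool} := [ffun k : 'I_(n.*2) => ((k == i0) || (k == p i0)) (+) x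
  k].
have togK : involutive tog.
  by move=> x; apply/ffunP=> k; rewrite !ffunE addbA addbb.
set S := \sum_(x | _) _; apply/eqP; rewrite -eqNr -sumrN; apply/eqP.
rewrite /S [RHS](reindex_inj (inv_inj togK)) /=; apply: eq_big => [x|x _].
  apply: eq_forallb => k; rewrite ffunE /allowed.
  have [-> /=|_] := eqVneq k i0; first by rewrite (eqP z2).
  by have [-> /=|_] := eqVneq k (p i0); first by rewrite z0 (eqP z2).
have -> : alternates p (tog x) = alternates p x.
  apply: eq_forallb => k; rewrite !ffunE; have [_ _ ppk] := pP k (in_setT k).
  have -> : (p k == i0) = (k == p i0) by apply/eqP/eqP => [<-|->].
  have -> : (p k == p i0) = (k == i0) by apply/eqP/eqP => [e|-> //]; rewrite -ppk e.
  rewrite orbC; case: (_ || _) => //=; by case: (x k); case: (x (p k)).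
case: (boolP (alternates p x)) => [/forallP/(_ i0) xi|]; last by rewrite !mulr0 oppr0.
rewrite !mulr1 /vector_sign -[LHS]mulN1r -exprS; apply: signr_eq.
rewrite (bigD1 i0) //= (bigD1 (p i0)) //= [in RHS](bigD1 i0) //= [in RHS](bigD1 (p i0)) //=.
rewrite !ffunE eqxx eqxx orbT /= !oddD /=.
rewrite [in RHS](eq_bigr (fun k => k * x k)%N) => [|k /andP[/negPf h1 /negPf h2]];
  last by rewrite ffunE h1 h2.
rewrite !oddM podd; move: xi; case: (odd (\sum_(k | _) _)); case: (odd i0);
  by case: (x i0); case: (x (p i0)).
Qed.

Variable s : {perm 'I_(n.*2)}.
Hypothesis s_planar : planar_pairing s.
Hypothesis s_zone : forall i : 'I_(n.*2), zone p1 p2 p3 (s i) != zone p1 p2 p3 i.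

Lemma alternating_sum p : pairing_on setT p -> noncrossing_on setT p ->
  \sum_(x | allowed_vector x) vector_sign x * (alternates p x)%:R =
  vector_sign (vector_of_pairing s) * [forall i, p i == s i]%:R.
Proof.
move=> pP pnc.
have [/forallP pz|] := boolP [forall i : 'I_(n.*2), zone p1 p2 p3 (p i) != zone p1 p2 p3 i];
  last first.
  rewrite negb_forall => /existsP[i0]; rewrite negbK => /eqP z0.
  rewrite (alternating_sum_monochromatic pP pnc z0) (_ : [forall i, _] = false) ?mulr0 //.
  by apply/negP=> /forallP/(_ i0)/eqP pi; have := s_zone i0; rewrite -pi z0 eqxx.
have ps := tripartite_unique p12 p23 p3N pP pnc pz (planar_pairing_setT s_planar)
  (planar_noncrossing s_planar) s_zone.
rewrite (_ : [forall i, _]) ?mulr1; last by apply/forallP=> i; rewrite ps.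
have -> : vector_of_pairing s = vector_of_pairing p.
  by apply/ffunP=> k; rewrite !ffunE ps.
transitivity (\sum_(x | x == vector_of_pairing p) vector_sign x); last by rewrite big_pred1_eq.
under [RHS]eq_bigl => x do rewrite -(vector_of_pairing_unique _ pP pz).
by rewrite [RHS]big_mkcondr; apply: eq_bigr => x _; case: (alternates p x); rewrite ?mulr1 ?mulr0.
Qed.

End SignVectors.

(** * The alternating sum over double-dimer configurations *)

Section DoubleDimerSide.
Variables (R : numFieldType) (V : finType) (black : pred V) (E : {set V * V}) (wt : V * V -> R).
Variables (n : nat) (node : 'I_(n.*2) -> V).
Hypothesis bip : bipartite_edges black E.
Hypothesis node_inj : injective node.
Hypothesis planar : planar_nodes_on_outer_face E node.
Variables (p1 p2 p3 : nat).
Hypotheses (p12 : (p1 <= p2)%N) (p23 : (p2 <= p3)%N) (p3N : (p3 <= n.*2)%N).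
Variable s : {perm 'I_(n.*2)}.
Hypothesis s_planar : planar_pairing s.
Hypothesis s_zone : forall i : 'I_(n.*2), zone p1 p2 p3 (s i) != zone p1 p2 p3 i.

Lemma is_node_imset v : is_node node v = (v \in node @: setT).
Proof.
by apply/existsP/imsetP => [[k /eqP<-]|[k _ ->]]; [exists k|exists k].
Qed.

Lemma is_dd_configE m : is_dd_config E node m = dd_config E (node @: setT) m.
Proof. by congr (_ && _); apply: eq_forallb => v; rewrite is_node_imset. Qed.

Lemma dd_weightE m : dd_weight E wt node m = config_weight E wt (node @: setT) m.
Proof.
congr (_ * _ ^+ _); congr #|pred_of_set _|; apply/setP=> C; rewrite !inE.
by congr [&& _, _ & _]; apply: eq_forallb => v; rewrite is_node_imset.
Qed.

Lemma connects_asE m : dd_config E (node @: setT) m ->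
  connects_as node m s = [forall i, partner node setT m i == s i].
Proof.
move=> mT; have sne i : s i != i by case: s_planar => sP _; case: (sP i).
apply/forallP/forallP=> [con i|par i].
  have := forallP (con i) (s i); rewrite eq_sym sne eqxx => /eqP ci.
  by apply/eqP/(partner_unique bip node_inj mT); rewrite ?inE.
apply/forallP=> j; apply/implyP=> ij; apply/eqP.
have [_ _ ci] := partnerP bip node_inj mT (in_setT i).
apply/idP/eqP=> [c|<-]; last by rewrite -(eqP (par i)).
rewrite -(eqP (par i)); apply: (partner_unique bip node_inj mT); rewrite ?inE //.
by rewrite eq_sym.
Qed.

(** After superposition the sum over [x] is taken first: for a fixed configuration it is the
    alternating sum of its partner map, nonzero only when that map is [s]. *)
Lemma double_dimer_side :
  \sum_(x | allowed_vector p1 p2 p3 x) vector_sign R x *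
    (ZDdel E wt node (selected (fun i => black (node i)) x) * ZDdel E wt node (~: selected (fun
      i => black (node i)) x)) =
  vector_sign R (vector_of_pairing p1 p2 p3 s) * ZDD E wt node s.
Proof.
under eq_bigr => x _.
  rewrite -setTD (node_superposition wt bip node_inj (subsetT _)) mulr_sumr.
  under eq_bigr => m mT.
    rewrite mulrCA (compatible_partner bip node_inj mT).
    rewrite (_ : [forall i in _, _] = alternates (partner node setT m) x); last first.
      apply: eq_forallb => i; rewrite inE /= !inE.
      by case: (x i); case: (x _); case: (black _); case: (black _).
    over.
  over.
rewrite /= exchange_big /= /ZDD mulr_sumr [RHS]big_mkcond [LHS]big_mkcond.
apply: eq_bigr => m _; rewrite is_dd_configE.
have [mT|] := boolP (dd_config E (node @: setT) m); last by rewrite andFb.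
rewrite -mulr_sumr (alternating_sum R p12 p23 p3N s_planar s_zone
  (partner_pairing bip node_inj mT) (partner_noncrossing bip node_inj planar mT)).
rewrite /= (connects_asE mT) dd_weightE mulrCA.
by case: ifP; rewrite ?mulr1 ?mulr0.
Qed.

End DoubleDimerSide.

(** * The alternating sum over masked determinants *)

Lemma sum_pos_self N (S : {set 'I_N}) : ((\sum_(a in S) pos S a).*2 + #|S| = #|S| * #|S|)%N.
Proof.
have posE a : pos S a = (\sum_(b in S) (b < a)%N)%N.
  rewrite /pos -sum1_card (eq_bigl (fun b => (b \in S) && (b < a)%N)) => [|b];
    last by rewrite inE.
  by rewrite big_mkcondr.
rewrite -addnn; under eq_bigr => a _ do rewrite posE.
rewrite [X in (_ + X + _)%N]exchange_big -[in RHS]sum_nat_const -{1}sum1_card -!big_split /=.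
apply: eq_bigr => a aS;
  rewrite -sum1_card -big_split /= [RHS](bigD1 a) // [X in (X + _)%N](bigD1 a) //=.
rewrite ltnn addn0 add0n addnC; congr (_ + _)%N; apply: eq_bigr => b /andP[_ ba].
by case: ltngtP => // /ord_inj e; rewrite e eqxx in ba.
Qed.

Section DeterminantSide.
Variables (R : numFieldType) (n p1 p2 p3 : nat).
Hypotheses (p12 : (p1 <= p2)%N) (p23 : (p2 <= p3)%N) (p3N : (p3 <= n.*2)%N).
Variables (c : pred 'I_(n.*2)) (f g : 'I_n -> 'I_(n.*2)).
Hypotheses (fI : increasing f) (gI : increasing g).
Hypotheses (cf : forall i, c (f i)) (cg : forall j, ~~ c (g j)).
Hypothesis fgT : labels f g = setT.
Implicit Types (x : {ffun 'I_(n.*2) -> bool}).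

Let fJ : injective f := increasing_inj fI.
Let gJ : injective g := increasing_inj gI.
Let fg i j : f i != g j. Proof. by apply: contraNneq (cg j) => <-. Qed.

Lemma sum_all_labels (F : 'I_(n.*2) -> nat) : (\sum_k F k = \sum_i F (f i) + \sum_i F (g i))%N.
Proof. by rewrite -sum_labels // fgT; apply: eq_bigl => k; rewrite inE. Qed.

(** Let K be the number of black labels with [x] true. The selected set has 2K elements, and the sum
    of its labels is its inversion number plus K(2K - 1), the sum of the ranks within it. Adding the
    sum of k x_k doubles the black contributions and completes the white ones to the sum of all
    white labels. *)
Lemma vector_sign_inversions (r : 'S_n) x : (forall i, x (f i) != x (g (r i))) ->
  odd (\sum_(k < n.*2) k * x k + inversions setT (selected c x)) =
  odd (\sum_j g j + \sum_i x (f i)).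
Proof.
move=> xr; pose S := selected c x; pose K := (\sum_i x (f i))%N.
have selE F : (\sum_(a in S) F a = \sum_i x (f i) * F (f i) + \sum_j ~~ x (g j) * F (g j))%N.
  rewrite big_mkcond sum_all_labels; congr (_ + _)%N; apply: eq_bigr => i _; rewrite inE.
    by rewrite cf eqb_id; case: (x _); rewrite ?mul1n ?mul0n.
  by rewrite (negPf (cg i)) eqbF_neg; case: (x _); rewrite ?mul1n ?mul0n.
have cardS : #|S| = K.*2.
  rewrite -sum1_card selE -[K.*2]addnn; congr (_ + _)%N; first by apply: eq_bigr => i _;
    rewrite muln1.
  rewrite (reindex_inj (@perm_inj _ r)); apply: eq_bigr => i _ /=; rewrite muln1.
  by have := xr i; case: (x _); case: (x _).
have inv_sum : (\sum_(a in S) a = \sum_(a in S) pos S a + inversions setT S)%N.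
  rewrite /inversions !setTI -big_split; apply: eq_bigr => a _ /=.
  by rewrite -{1}(pos_setT a) (pos_split setT S) setTI.
have odd_pos : odd (\sum_(a in S) pos S a) = odd K.
  have arith P k : (P.*2 + k.*2 = k.*2 * k.*2)%N -> odd P = odd k.
    move=> e; have /(congr1 odd) : (P + k = (k * k).*2)%N by nia.
    by rewrite oddD odd_double; case: (odd P); case: (odd k).
  by apply: arith; rewrite -cardS sum_pos_self.
have gsum : (\sum_j g j = \sum_j ~~ x (g j) * g j + \sum_j g j * x (g j))%N.
  by rewrite -big_split; apply: eq_bigr => j _ /=; case: (x _);
    rewrite /= ?muln1 ?muln0 ?mul1n ?mul0n ?addn0.
have fsum : (\sum_i x (f i) * f i = \sum_i f i * x (f i))%N by apply: eq_bigr => i _;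
  rewrite mulnC.
have := congr1 odd inv_sum; rewrite selE fsum sum_all_labels gsum -/K -/S !oddD odd_pos.
by do 4!case: (odd (\sum_(i < n) _)); case: (odd _); case: (odd _).
Qed.

(** The pairs {f i, g (r i)} partition the labels, so the values of [x] on different pairs vary
    independently. *)
Lemma sum_vectors_prod (r : 'S_n) (G : 'I_n -> bool -> bool -> R) :
  \sum_(x : {ffun 'I_(n.*2) -> bool}) \prod_i G i (x (f i)) (x (g (r i))) = \prod_i \sum_u
    \sum_v G i u v.
Proof.
under [RHS]eq_bigr => i _ do rewrite pair_big /=.
rewrite bigA_distr_bigA /=.
pose h x : {ffun 'I_n -> bool * bool} := [ffun i => (x (f i), x (g (r i)))].
have h_inj : injective h.
  move=> x y /ffunP xy; apply/ffunP=> k; have : k \in labels f g by rewrite fgT inE.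
  rewrite inE => /orP[] /imsetP[i _ ->]; first by have := xy i; rewrite !ffunE => -[].
  by have := xy (r^-1 i)%g; rewrite !ffunE permKV => -[].
have h_bij : bijective h.
  apply: inj_card_bij h_inj _.
  by rewrite !card_ffun card_prod card_bool !card_ord -[n.*2]mul2n expnM.
rewrite [RHS](reindex h) /=; last exact: onW_bij.
by apply: eq_bigr => x _; apply: eq_bigr => i _; rewrite ffunE.
Qed.

(** Inside zone 0 or 1 no two allowed values differ; inside zone 2 the two choices cancel. Between
    different zones [u] is forced, and its sign together with the order of the labels is -1 exactly
    when one of them is in the part of zone 0 before p1. *)
Lemma allowed_pair_sum (k l : nat) (y : R) :
  \sum_u \sum_v (allowed p1 p2 p3 k u && allowed p1 p2 p3 l v)%:R *
     ((-1) ^+ u * ((-1) ^+ (l < k)%N * (u != v)%:R * y)) =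
  (-1) ^+ ((k < p1) + (l < p1))%N *
    (if zone p1 p2 p3 k != zone p1 p2 p3 l then y else 0).
Proof.
rewrite !big_bool /= /allowed.
have [[-> k1]|[[-> k1]|[-> k1]]] := zone_spec p1 p2 p3 k;
have [[-> l1]|[[-> l1]|[-> l1]]] := zone_spec p1 p2 p3 l => /=;
rewrite ?(mulr0, mul0r, mul1r, mulr1, addr0, add0r, expr1, expr0, mulN1r, oppr0, addNr) //;
by case: (ltnP l k) => lk; case: (ltnP k p1) => kp; case: (ltnP l p1) => lp;
  first [exfalso; lia | rewrite /=; ring].
Qed.

(** The Leibniz formula is expanded before summing over [x]. The exponent p1 counts the labels below
    p1, collected from the sums over single pairs. *)
Lemma determinant_side (y : 'I_(n.*2) -> 'I_(n.*2) -> R) :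
  \sum_(x | allowed_vector p1 p2 p3 x) vector_sign R x * ((-1) ^+ inversions setT (selected c x) *
    \det (\matrix_(i < n, j < n) ((-1) ^+ (g j < f i)%N *
        ((f i \in selected c x) == (g j \in selected c x))%:R * y (f i) (g j)))) =
  (-1) ^+ (\sum_j g j + p1) * \det (\matrix_(i < n, j < n)
    (if zone p1 p2 p3 (f i) != zone p1 p2 p3 (g j) then y (f i) (g j) else 0)).
Proof.
under [LHS]eq_bigr => x _ do rewrite {1}/determinant !mulr_sumr.
rewrite exchange_big /= [in RHS]/determinant mulr_sumr; apply: eq_bigr => r _.
(* The condition [allowed] is moved into the factors, so that [x] may range over all vectors. *)
pose G i u v : R := (allowed p1 p2 p3 (f i) u && allowed p1 p2 p3 (g (r i)) v)%:R *
     ((-1) ^+ u * ((-1) ^+ (g (r i) < f i)%N * (u != v)%:R * y (f i) (g (r i)))).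
transitivity ((-1) ^+ (\sum_j g j) * ((-1) ^+ r *
    \sum_(x : {ffun 'I_(n.*2) -> bool}) \prod_i G i (x (f i)) (x (g (r i))))).
  rewrite !mulr_sumr big_mkcond; apply: eq_bigr => x _.
  case: ifP => [/forallP ax|/negbT]; last first.
    rewrite negb_forall => /existsP[k ak]; have : k \in labels f g by rewrite fgT inE.
    suff P0 : k \in labels f g -> \prod_i G i (x (f i)) (x (g (r i))) = 0.
      by move/P0 ->; rewrite !mulr0.
    rewrite inE => /orP[] /imsetP[i _ ki]; rewrite ki in ak.
      by rewrite (bigD1 i) //= /G (negPf ak) /= !mul0r.
    by rewrite (bigD1 (r^-1 i)%g) //= /G permKV (negPf ak) andbF !mul0r.
  have GE : \prod_i G i (x (f i)) (x (g (r i))) =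
      (-1) ^+ (\sum_i x (f i))%N * \prod_i ((-1) ^+ (g (r i) < f i)%N *
        (x (f i) != x (g (r i)))%:R * y (f i) (g (r i))).
    rewrite -prodrXr -big_split; apply: eq_bigr => i _.
    by rewrite /G !ax mul1r.
  rewrite GE; set Q := \prod_i ((-1) ^+ _ * _ * _).
  have -> : \prod_i (\matrix_(i, j) ((-1) ^+ (g j < f i)%N *
      ((f i \in selected c x) == (g j \in selected c x))%:R * y (f i) (g j))) i (r i) = Q.
    apply: eq_bigr => i _; rewrite mxE !inE; congr (_ * _%:R * _); congr nat_of_bool.
    by rewrite cf (negPf (cg _)); case: (x _); case: (x _).
  have [/forallP xr|] := boolP [forall i, x (f i) != x (g (r i))]; last first.
    rewrite negb_forall => /existsP[i xi]; have -> : Q = 0; last by rewrite !mulr0.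
    by rewrite /Q (bigD1 i) //= (negPf xi) mulr0 !mul0r.
  rewrite /vector_sign [LHS]mulrA -exprD (signr_eq R (vector_sign_inversions xr)) exprD -!mulrA.
  by congr (_ * _); rewrite mulrCA.
rewrite sum_vectors_prod exprD -!mulrA; congr (_ * _); rewrite [RHS]mulrCA; congr (_ * _).
have -> : (-1) ^+ p1 = (-1) ^+ (\sum_(k < n.*2) (k < p1))%N :> R.
  congr (_ ^+ _); apply/esym.
  have p1N := leq_trans p12 (leq_trans p23 p3N).
  rewrite -[RHS]subn0 -(card_ord_interval 0 p1N) -sum1_card [RHS]big_mkcond.
  by apply: eq_bigr => k _; rewrite inE.
rewrite sum_all_labels [X in (_ + X)%N](reindex_inj (@perm_inj _ r)) /= -big_split /=.
rewrite -prodrXr -big_split; apply: eq_bigr => i _ /=.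
by rewrite /G allowed_pair_sum mxE.
Qed.
End DeterminantSide.

(** * Increasing enumeration of the labels of one colour *)

Section SelectedLabels.
Variables (n : nat) (P : pred 'I_(n.*2)) (d : 'I_n -> 'I_(n.*2)).
Hypothesis cardP : #|[set k | P k]| = n.

(** The common form of [black_label] and [white_label]. The list has length n, so [nth] never falls
    back on its default. *)
Definition nth_label (i : 'I_n) := nth (d i) [seq k <- enum 'I_(n.*2) | P k] i.

Lemma size_labels : size [seq k <- enum 'I_(n.*2) | P k] = n.
Proof.
rewrite -[RHS]cardP -sum1_card size_filter -sum1_count big_enum_cond /=.
by apply: eq_bigl => k; rewrite inE.
Qed.

Lemma nth_labelP i : P (nth_label i).
Proof.
have := mem_nth (d i) (_ : (i < size [seq k <- enum 'I_(n.*2) | P k])%N).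
by rewrite size_labels mem_filter => /(_ (ltn_ord i))/andP[].
Qed.

Lemma nth_label_increasing : increasing nth_label.
Proof.
move=> i j ij; rewrite /nth_label (set_nth_default (d i) (d j)) ?size_labels //.
have := @sorted_ltn_nth _ (fun a b : 'I_(n.*2) => (a < b)%N) _ (d i) [seq k <- enum 'I_(n.*2) |
  P k].
have ltT : transitive (fun a b : 'I_(n.*2) => (a < b)%N) by move=> ? ? ?; apply: ltn_trans.
move/(_ ltT) => h; apply: h => //; rewrite ?inE ?size_labels //.
apply: sorted_filter => //.
by have := iota_ltn_sorted 0 n.*2; rewrite -val_enum_ord sorted_map.
Qed.

Lemma nth_label_surj k : P k -> exists i, k = nth_label i.
Proof.
move=> Pk; have kin : k \in [seq k <- enum 'I_(n.*2) | P k] by rewrite mem_filter Pk mem_enum.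
have kn : (index k [seq k <- enum 'I_(n.*2) | P k] < n)%N by rewrite -[ltnRHS]size_labels
  index_mem.
by exists (Ordinal kn); rewrite /nth_label nth_index.
Qed.

End SelectedLabels.

(** * Comparison of the signs of the two sides *)

Section Signs.
Variables (n p1 p2 p3 : nat).
Hypotheses (p12 : (p1 <= p2)%N) (p23 : (p2 <= p3)%N) (p3N : (p3 <= n.*2)%N).

(** The label [g j] equals the number of labels below it: j white ones and some black ones. Black
    labels below white ones and white labels below black ones together count all n * n pairs. *)
Lemma crossings_bin_parity (c : pred 'I_(n.*2)) (f g : 'I_n -> 'I_(n.*2)) :
  increasing f -> increasing g -> (forall i, c (f i)) -> (forall j, ~~ c (g j)) ->
  labels f g = setT ->
  odd (crossings f g + 'C(n, 2) + \sum_j g j) = odd n.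
Proof.
move=> fI gI cf cg fgT; have fg i j : f i != g j by apply: contraNneq (cg j) => <-.
have -> : (\sum_j g j = \sum_j \sum_i (f i < g j) + 'C(n, 2))%N.
  rewrite -sum_ord_bin2 -big_split; apply: eq_bigr => j _ /=.
  rewrite -{1}(pos_setT (g j)) -fgT pos_labels //; try exact: increasing_inj.
  congr (_ + _)%N; rewrite -[RHS]sum_ord_lt; apply: eq_bigr => i _.
  by rewrite increasing_lt.
have : (crossings f g + \sum_j \sum_i (f i < g j) = n * n)%N.
  rewrite [X in (_ + X)%N]exchange_big /crossings -big_split /=.
  transitivity (\sum_(i < n) n)%N; last by rewrite sum_nat_const card_ord.
  apply: eq_bigr => i _; rewrite -big_split /= -[RHS]card_ord -sum1_card.
  by apply: eq_bigr => j _; case: ltngtP => // /ord_inj /eqP; rewrite eq_sym (negPf (fg i j)).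
move/(congr1 odd); rewrite !oddD oddM andbb => <-.
by case: (odd (crossings _ _)); case: (odd 'C(n, 2)); case: (odd (\sum_j _)).
Qed.

Variable s : {perm 'I_(n.*2)}.
Hypothesis s_planar : planar_pairing s.
Hypothesis s_zone : forall i : 'I_(n.*2), zone p1 p2 p3 (s i) != zone p1 p2 p3 i.

Let xs := vector_of_pairing p1 p2 p3 s.

(** The sign rule of [allowed_pair_sum], read at the pair of [k] and [s k] with the forced value of
    [xs]. *)
Lemma vector_of_pairing_parity (k : 'I_(n.*2)) :
  odd (s k < k)%N = odd (xs k + (k < p1) + (s k < p1)).
Proof.
rewrite /xs /vector_of_pairing ffunE; have := s_zone k.
have [[-> k1]|[[-> k1]|[-> k1]]] := zone_spec p1 p2 p3 k;
have [[-> l1]|[[-> l1]|[-> l1]]] := zone_spec p1 p2 p3 (s k) => //= _;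
by case: (ltnP (s k) k) => lk; case: (ltnP k p1) => kp; case: (ltnP (s k) p1) => lp //=; lia.
Qed.

Lemma sum_even_odd (F : 'I_(n.*2) -> nat) :
  (\sum_i F i = \sum_(k < n) F (even_label k) + \sum_(k < n) F (odd_label k))%N.
Proof.
have evI : increasing (@even_label n) by move=> i j ij; rewrite /= ltn_double.
have odI : increasing (@odd_label n) by move=> i j ij; rewrite /= ltnS ltn_double.
apply: (sum_all_labels (c := fun i => ~~ odd i)) => // [i|j|].
- by rewrite /= odd_double.
- by rewrite /= odd_double.
- exact: even_odd_labels.
Qed.

Lemma sum_partner_even (F : 'I_(n.*2) -> nat) :
  (\sum_(k < n) F (s (even_label k)) = \sum_(k < n) F (odd_label k))%N.
Proof.
have e : (\sum_(i < n.*2) (~~ odd i) * F (s i) = \sum_(i < n.*2) odd i * F i)%N.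
  rewrite [RHS](reindex_inj (@perm_inj _ s)); apply: eq_bigr => i _.
  by rewrite (planar_odd s_planar).
move: e; rewrite !sum_even_odd /=.
under eq_bigr => k _ do rewrite odd_double mul1n.
under [X in (_ + X)%N]eq_bigr => k _ do rewrite odd_double mul0n.
rewrite big1_eq addn0 => ->.
under eq_bigr => k _ do rewrite odd_double mul0n.
by rewrite big1_eq add0n; apply: eq_bigr => k _; rewrite odd_double mul1n.
Qed.

(** Summed over the even labels, [vector_of_pairing_parity] gives the values of [xs] there plus p1,
    while the exponent of [vector_sign] sees only the odd labels. Together the two sums of values
    make n, as [xs] is true at exactly one end of each pair. *)
Lemma signOE_vector (R : numFieldType) :
  signOE R s = vector_sign R xs * (-1) ^+ (n + p1).
Proof.
rewrite signOE_planar // prodrXr /vector_sign -exprD; apply: signr_eq.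
have xsC i : xs (s i) = ~~ xs i.
  have := vector_of_pairing_unique xs (planar_pairing_setT s_planar) s_zone.
  rewrite eqxx => /andP[_ /forallP/(_ i)].
  by case: (xs i); case: (xs (s i)).
have sum_xs : (\sum_k xs k = n)%N.
  apply: double_inj; rewrite -addnn [X in (X + _)%N](reindex_inj (@perm_inj _ s)) -big_split /=.
  rewrite -[RHS]card_ord -sum1_card; apply: eq_bigr => k _.
  by rewrite xsC; case: (xs k).
have sum_p1 : (\sum_(k < n.*2) (k < p1) = p1)%N.
  have p1N := leq_trans p12 (leq_trans p23 p3N).
  rewrite -[RHS]subn0 -(card_ord_interval 0 p1N) -sum1_card [RHS]big_mkcond.
  by apply: eq_bigr => k _; rewrite inE.
have odd_sum (F G : 'I_n -> nat) : (forall k, odd (F k) = odd (G k)) ->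
    odd (\sum_k F k) = odd (\sum_k G k).
  by move=> FG; rewrite !(big_morph odd oddD (erefl _)); apply: eq_bigr => k _.
have -> : odd (\sum_k (s (even_label k) < even_label k)) =
    odd (\sum_(k < n) xs (even_label k) + p1).
  rewrite -{1}sum_p1 sum_even_odd -(sum_partner_even (fun i => (i < p1)%N : nat)) -!big_split /=.
  by apply: odd_sum => k; rewrite vector_of_pairing_parity addnA.
have -> : odd (\sum_(k < n.*2) k * xs k + (n + p1)) =
    odd (\sum_(k < n) xs (odd_label k) + (n + p1)).
  rewrite sum_even_odd !oddD -[odd (\sum_(k < n) even_label k * _)]/(odd _); congr (_ (+) _).
  rewrite (odd_sum (fun k => even_label k * xs (even_label k))%N (fun=> 0%N)) => [|k].
    rewrite big1_eq /=; apply: odd_sum => k; rewrite oddM /= odd_double.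
    by case: (xs _).
  by rewrite oddM /= odd_double.
have := congr1 odd sum_xs; rewrite sum_even_odd !oddD => <-.
by case: (odd p1); case: (odd (\sum_k xs (even_label k))); case: (odd _).
Qed.

End Signs.

Theorem mainTheorem3 (R : numFieldType) (V : finType) (black : pred V)
    (E : {set V * V}) (wt : V * V -> R) (n : nat) (node : 'I_(n.*2) -> V)
    (rgb : 'I_(n.*2) -> 'I_3) (s : {perm 'I_(n.*2)}) :
  bipartite_edges black E ->
  injective node ->
  #|[set k | black (node k)]| = n ->
  planar_nodes_on_outer_face E node ->
  ZD E wt setT != 0 ->
  circ_contiguous rgb ->
  planar_pairing s ->
  (forall k, rgb (s k) != rgb k) ->
  ZDD E wt node s / (ZD E wt setT) ^+ 2 =
    signOE R s * \det (KW_matrix black E wt node rgb).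
Proof.
move=> bip node_inj card_black planar Z0 contig s_planar s_rgb.
set Z := ZD E wt setT.
have [p1 [p2 [p3 [c1 [c2 [c3 [/and3P[p12 p23 p3N] /and3P[c12 c13 c23] rgbE]]]]]]] :=
  contiguous_zones contig.
have zoneE (k l : 'I_(n.*2)) : (rgb k == rgb l) = (zone p1 p2 p3 k == zone p1 p2 p3 l).
  rewrite !rgbE /zone_color.
  have [[-> _]|[[-> _]|[-> _]]] := zone_spec p1 p2 p3 k;
  have [[-> _]|[[-> _]|[-> _]]] := zone_spec p1 p2 p3 l;
  by rewrite /= ?eqxx // ?(negPf c12) ?(negPf c13) ?(negPf c23) // eq_sym
    ?(negPf c12) ?(negPf c13) ?(negPf c23).
have s_zone i : zone p1 p2 p3 (s i) != zone p1 p2 p3 i by rewrite -zoneE s_rgb.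
pose c : pred 'I_(n.*2) := fun k => black (node k).
have card_white : #|[set k | ~~ c k]| = n.
  have := cardsC [set k | c k]; rewrite card_black card_ord.
  rewrite (_ : ~: _ = [set k | ~~ c k]); last by apply/setP=> k; rewrite !inE.
  by rewrite -[RHS]addnn => /addnI.
pose f := black_label black node; pose g := white_label black node.
have fI : increasing f := nth_label_increasing _ card_black.
have gI : increasing g := nth_label_increasing _ card_white.
have cf i : c (f i) := nth_labelP _ card_black i.
have cg i : ~~ c (g i) := nth_labelP _ card_white i.
have fgT : labels f g = setT.
  apply/setP=> k; rewrite !inE; apply/orP.
  by case: (boolP (c k)) => [/(nth_label_surj (widen_ord (n_le_double n))
    card_black)|/(nth_label_surj (widen_ord (n_le_double n)) card_white)] [i ->];
    [left|right]; apply: imset_f.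
have ZD0 : ZDdel E wt node set0 = Z by rewrite /ZDdel imset0 setC0.
pose H T := ZDdel E wt node T / Z.
have H0 : H set0 = 1 by rewrite /H ZD0 divff.
have Hrec (T : {set 'I_(n.*2)}) b : b \in T -> c b -> H T = \sum_(w in T | ~~ c w)
    (-1) ^+ (pos T b + pos T w).+1 * (H [set b; w] * H (T :\: [set b; w])).
  move=> bT cb; apply: (mulIf (mulf_neq0 Z0 Z0)); rewrite -/Z [RHS]mulr_suml.
  transitivity (ZDdel E wt node T * ZDdel E wt node set0).
    by rewrite ZD0 /H; field; exact: Z0.
  rewrite (condensation wt bip node_inj planar bT cb); apply: eq_bigr => w _.
  by rewrite /H -/Z; field; exact: Z0.
have HY k l : H [set k; l] = Y E wt (node k) (node l).
  congr (ZD _ _ _ / _); apply/setP=> v; rewrite imsetU !imset_set1 !inE negb_or andbT.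
  by rewrite andbC.
have sideL := double_dimer_side wt bip node_inj planar p12 p23 p3N s_planar s_zone.
have sideR := determinant_side p12 p23 p3N fI gI cf cg fgT (fun k l => H [set k; l]).
have minors x : H (selected c x) * H (~: selected c x) =
    (-1) ^+ (crossings f g + 'C(n, 2)) * ((-1) ^+ inversions setT (selected c x) *
    \det (\matrix_(i < n, j < n) ((-1) ^+ (g j < f i)%N *
        ((f i \in selected c x) == (g j \in selected c x))%:R * H [set f i; g j]))).
  have := masked_det H0 Hrec (selected c x) fI gI cf cg; rewrite fgT setTI setTD => ->.
  by rewrite exprD -mulrA.
have KWE : \matrix_(i < n, j < n) (if zone p1 p2 p3 (f i) != zone p1 p2 p3 (g j)
    then H [set f i; g j] else 0) = KW_matrix black E wt node rgb.
  by apply/matrixP=> i j; rewrite !mxE /= zoneE HY.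
rewrite KWE in sideR.
have vv : vector_sign R (vector_of_pairing p1 p2 p3 s) *
    vector_sign R (vector_of_pairing p1 p2 p3 s) = 1 by rewrite -expr2 sqrr_sign.
(* The sign of the surviving vector appears on the right through [signOE_vector]; its square is
   inserted on the left so that one copy cancels and the other is absorbed by
   [double_dimer_side]. *)
rewrite -[LHS]mul1r -vv -mulrA; rewrite (signOE_vector p12 p23 p3N s_planar s_zone) -!mulrA.
congr (_ * _); rewrite mulrA -sideL mulr_suml.
transitivity ((-1) ^+ (crossings f g + 'C(n, 2)) * ((-1) ^+ (\sum_j g j + p1) *
    \det (KW_matrix black E wt node rgb))).
  rewrite -sideR mulr_sumr; apply: eq_bigr => x _.
  rewrite [RHS]mulrCA -minors -mulrA; congr (_ * _).
  by rewrite /H -/Z; field; exact: Z0.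
(* The crossings, the binomial coefficient and the sum of the white labels add up to n modulo 2,
   which matches the exponent n + p1 of [signOE_vector]. *)
rewrite mulrA -exprD; congr (_ * _); apply: signr_eq.
by rewrite addnA oddD (crossings_bin_parity fI gI cf cg fgT) oddD.
Qed.
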